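(* Assume $\gamma\ge 0$. Then $\infty$ is an instantaneous entrance boundary for the process $X$ if and only if \[\int^{\infty}\frac{1}{x\,\Psi(1/x)\,R(x)}\,\mathrm{d}x<\infty\] (integrability in a neighbourhood of $\infty$). Moreover, if this integral condition holds, then for all $b>0$, $\mathbb{E}_\infty[T_b]=m(b)<\infty$, where $m(b):=\int_b^\infty \frac{W(x-b)}{R(x)}\,\mathrm{d}x$.
   Context: Let $\Psi(\lambda)=\gamma\lambda+\frac{\sigma^2}{2}\lambda^2+\int_0^\infty(e^{-\lambda z}-1+\lambda z)\,\pi(\mathrm{d}z)$ for $\lambda\ge0$, where $\gamma\in\mathbb{R}$, $\sigma\ge0$ and $\pi$ is a measure on $(0,\infty)$ with $\int_0^\infty (z\wedge z^2)\pi(\mathrm{d}z)<\infty$ (so $\gamma=\Psi'(0+)$). Let $Z$ be a spectrally positive Lévy process (no negative jumps) with $\mathbb{E}[e^{-\lambda Z_1}\mid Z_0=x]=e^{-\lambda x+\Psi(\lambda)}$ for $\lambda\ge0$. Let $R$ be continuous on $[0,\infty)$ and strictly positive on $(0,\infty)$. For $b\in\mathbb{R}$ let $\tau_b^-=\inf\{t\ge0:Z_t<b\}$. Set $\eta(s)=\int_0^{s\wedge\tau_0^-}\frac{\mathrm{d}r}{R(Z_r)}$, $\eta^{-1}(t)=\inf\{s\ge0:\eta(s)>t\}$ (with $\inf\emptyset=\infty$) and $X_t=Z_{\eta^{-1}(t)\wedge\tau_0^-}$. $\mathbb{P}_x,\mathbb{E}_x$ denote probability and expectation for $X$ started at $X_0=x$.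 For $b\ge0$, $T_b=\inf\{t\ge0:X_t<b\}$. The boundary $\infty$ is an instantaneous entrance boundary if $X$ does not explode (reach $\infty$ in finite time) and for every $t>0$, $\lim_{b\to\infty}\liminf_{x\to\infty}\mathbb{P}_x(T_b\le t)=1$; in that case $\mathbb{P}_\infty,\mathbb{E}_\infty$ refer to the càdlàg strong Markov process on $[0,\infty]$ with $X_0=\infty$ that leaves $\infty$ instantaneously and evolves, from any finite state $x$, as $X$ under $\mathbb{P}_x$. For $\gamma\ge0$, $W$ is the scale function: $W(x)=0$ for $x<0$, $W$ is continuous and strictly increasing on $[0,\infty)$, and $\int_0^\infty e^{-qy}W(y)\,\mathrm{d}y=1/\Psi(q)$ for all $q>0$. *)

(* Defs.v *)
From HB Require Import structures.
From mathcomp Require Import all_boot all_order all_algebra.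
From mathcomp Require Import all_classical all_reals all_analysis measurable_realfun.
Set Implicit Arguments. Unset Strict Implicit. Unset Printing Implicit Defensive.
Import Order.TTheory GRing.Theory Num.Theory.
Import numFieldNormedType.Exports.
Local Open Scope classical_set_scope.
Local Open Scope ring_scope.

Section Defs.
Variable R : realType.

Definition Psi (gam sig : R) (pi : {measure set R -> \bar R}) (lam : R) : R :=
  gam * lam + sig ^+ 2 / 2 * lam ^+ 2 +
  fine (\int[pi]_(z in `](0%R:R), +oo[) (expR (- (lam * z)) - 1 + lam * z)%:E)%E.

Definition levy_measure_cond (pi : {measure set R -> \bar R}) : Prop :=
  (\int[pi]_(z in `](0%R:R), +oo[) (Order.min z (z ^+ 2))%R%:E < +oo)%E.

Definition at_time (Y : R -> \bar R) (tau : \bar R) : \bar R :=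
  match tau with r%:E => Y r | _ => +oo%E end.

Definition first_below (z : R -> R) (b : R) : \bar R :=
  ereal_inf [set s%:E | s in [set s : R | 0 <= s /\ z s < b]].

Definition eta_tc (Rt : R -> R) (z : R -> R) (s : R) : \bar R :=
  (\int[lebesgue_measure]_(r in [set r : R | (0 <= r)%R /\ (r <= s)%R /\ (r%:E <= first_below z 0)%E])
      ((Rt (z r))%:E)^-1)%E.

Definition eta_inv (Rt : R -> R) (z : R -> R) (t : R) : \bar R :=
  ereal_inf [set s%:E | s in [set s : R | 0 <= s /\ (t%:E < eta_tc Rt z s)%E]].

Definition Xpath (Rt : R -> R) (z : R -> R) (t : R) : \bar R :=
  at_time (fun r => (z r)%:E) (Order.min (eta_inv Rt z t) (first_below z 0)).

Definition Tb (Y : R -> \bar R) (b : R) : \bar R :=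
  ereal_inf [set t%:E | t in [set t : R | 0 <= t /\ (Y t < b%:E)%E]].



Definition spec_pos_levy (d : measure_display) (T : measurableType d)
  (P : probability T R) (L : R -> T -> R) (Ps : R -> R) : Prop :=
  ( (forall t, measurable_fun setT (L t)) /\
      (forall w, L 0 w = 0) /\
      (forall w t, 0 <= t -> (fun s => L s w) @ at_right t --> L t w) /\
      (forall w t, 0 < t -> cvg ((fun s => L s w) @ at_left t)) /\
      (forall w t, 0 < t -> lim ((fun s => L s w) @ at_left t) <= L t w) /\
      (forall (n : nat) (t : nat -> R) (B : nat -> set R),
          0 <= t 0%N -> (forall i, t i <= t i.+1) -> (forall i, measurable (B i)) ->
          P (\bigcap_(i in `I_n) [set w | B i (L (t i.+1) w - L (t i) w)]) =
          (\prod_(i < n) P [set w | B i (L (t i.+1) w - L (t i) w)%R])%E) /\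
      (forall s t (B : set R), 0 <= s -> 0 <= t -> measurable B ->
          P [set w | B (L (s + t) w - L s w)] = P [set w | B (L t w)]) /\
      (forall lam, 0 <= lam ->
          (\int[P]_w (expR (- (lam * L 1 w)))%:E = (expR (Ps lam))%:E)%E)).

Definition Xof (Rt : R -> R) (T : Type) (L : R -> T -> R) (x : R) (w : T) : R -> \bar R :=
  Xpath Rt (fun r => x + L r w).

Definition non_explosive (d : measure_display) (T : measurableType d)
  (P : probability T R) (L : R -> T -> R) (Rt : R -> R) : Prop :=
  forall x, 0 <= x -> {ae P, forall w, forall t, 0 <= t -> (Xof Rt L x w t < +oo)%E}.

Definition inst_entrance (d : measure_display) (T : measurableType d)
  (P : probability T R) (L : R -> T -> R) (Rt : R -> R) : Prop :=
  non_explosive P L Rt /\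
  forall t, 0 < t ->
    (fun b => limf_einf
        (fun x => P [set w | (Tb (Xof Rt L x w) b <= t%:E)%E]) (pinfty_nbhs R))
      @ pinfty_nbhs R --> 1%E.

Definition scale_function (Ps : R -> R) (W : R -> R) : Prop :=
  [/\ (forall x, x < 0 -> W x = 0),
      {within `[0%R, +oo[, continuous W},
      {in `[0%R, +oo[ &, {mono W : x y / x < y}} &
      (forall q, 0 < q ->
        (\int[lebesgue_measure]_(y in `[0%R, +oo[) (expR (- (q * y)) * W y)%:E
           = ((Ps q)^-1)%:E)%E)].

Definition m_of (Rt W : R -> R) (b : R) : \bar R :=
  (\int[lebesgue_measure]_(x in `[b, +oo[) (W (x - b) / Rt x)%:E)%E.

Definition nat_filtration (T : Type) (Y : R -> T -> \bar R) (s : R) : set (set T) :=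
  <<s [set A | exists r (B : set (\bar R)),
          [/\ 0 <= r, r <= s, measurable B & A = Y r @^-1` B]] >>.

Definition stopping_time (T : Type) (Y : R -> T -> \bar R) (tau : T -> \bar R) : Prop :=
  (forall w, (0 <= tau w)%E) /\
  forall s, 0 <= s -> nat_filtration Y s [set w | (tau w <= s%:E)%E].

Definition stopped_sigma (T : Type) (Y : R -> T -> \bar R) (tau : T -> \bar R) : set (set T) :=
  [set A | forall s, 0 <= s -> nat_filtration Y s (A `&` [set w | (tau w <= s%:E)%E])].

(* P_infty: cadlag strong Markov process on [0,oo] started at oo, leaving oo
   instantaneously, and evolving from any finite state x as X under P_x *)
Definition Pinfty_version (d : measure_display) (T : measurableType d)
  (P : probability T R) (L : R -> T -> R) (Rt : R -> R)
  (d' : measure_display) (T' : measurableType d') (Q : probability T' R)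
  (Y : R -> T' -> \bar R) : Prop :=
  ( (forall r, measurable_fun setT (Y r)) /\
      (forall w, Y 0 w = +oo%E) /\
      (forall w t, 0 <= t -> (0 <= Y t w)%E) /\
      (forall w t, 0 <= t -> (fun s => Y s w) @ at_right t --> Y t w) /\
      (forall w t, 0 < t -> cvg ((fun s => Y s w) @ at_left t)) /\
      {ae Q, forall w, forall e, 0 < e -> exists t, [/\ 0 < t, t < e & (Y t w < +oo)%E]} /\
      (forall tau, stopping_time Y tau -> forall A, stopped_sigma Y tau A ->
        forall (n : nat) (t : 'I_n -> R) (B : 'I_n -> set (\bar R)),
          (forall i, 0 <= t i) -> (forall i, measurable (B i)) ->
          let G := A `&` [set w | (tau w < +oo)%E /\ (at_time (Y ^~ w) (tau w) < +oo)%E] in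
          Q (G `&` [set w | forall i, B i (at_time (Y ^~ w) (tau w + (t i)%:E)%E)]) =
          (\int[Q]_(w in G)
             P [set w0 | forall i, B i (Xof Rt L (fine (at_time (Y ^~ w) (tau w))) w0 (t i))])%E)).

Definition integrable_near_infty (f : R -> R) : Prop :=
  exists A, lebesgue_measure.-integrable `[A, +oo[ (fun x => (f x)%:E).

End Defs.

(* Main.v *)
(* For x >= b the passage time T_b of the time-changed process is the integral of 1/R(Z_v) over
   [0, tau_b], so everything rests on the law of the occupation measure of Z up to tau_b. The
   exponential martingale of Z, stopped at tau_b and integrated over time, gives the Laplace
   transform of the potential kernel; comparing it with 1/Psi, the Laplace transform of W, and using
   the uniqueness of Laplace transforms yields, for f >= 0,
     E_x int_0^tau_b f(Z_v) dv + int W(y - x) f(y) dy = int W(y - b) f(y) dy.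
   Hence E_x T_b <= m(b), and E_x T_b -> m(b) as x -> oo. If m(b) is finite, Markov's inequality and
   m(b) -> 0 give the entrance property. Conversely, the same identity conditioned at time s bounds
   the second moment of the integral of 1/R over the visits to [b, N) by 2 m_N(b)^2, so by
   Paley-Zygmund T_b exceeds m_N(b)/2 with probability at least 1/8 for all x >= N, and the entrance
   property forces m(b) < oo for some b. Finally W(x) is comparable to 1/(x Psi(1/x)), which turns
   finiteness of m(b) into the integral test. Started from infinity, the Markov property at a small
   time e gives E[T_b; T_b >= e] = e P(T_b >= e) + E[E_{Y_e} T_b; T_b >= e], and e -> 0. *)

Require Import Defs.
From HB Require Import structures.
From mathcomp Require Import all_boot all_order all_algebra finmap.
From mathcomp Require Import all_classical all_reals all_analysis measurable_realfun.
From mathcomp Require Import ring lra.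
Import Order.TTheory GRing.Theory Num.Theory.
Import numFieldNormedType.Exports.
Local Open Scope classical_set_scope.
Local Open Scope ring_scope.

Set Implicit Arguments. Unset Strict Implicit. Unset Printing Implicit Defensive.

(** * Integration tools *)

(** Beyond path regularity, [spec_pos_levy] gives only independent stationary increments and the
    transform at time 1. In place of conditioning, every identity is tested against a weight [xi]:
    nonnegative, bounded, determined by the past at [s], and zero off the event that [s] is at most
    [tau]. The choice [xi = 1], [s = 0] gives the mean of the occupation; [xi] equal to the reward
    at time [s] gives its second moment. Stopping at [tau] is a limit of first hits along grids. The
    limit is exact because, without negative jumps, [Z] equals [b] at time [tau]; the overshoot
    below [b] at a grid hit has no pathwise bound, and a second moment estimate controls it. The
    potential identity is a sum of nonnegative terms since either side may be infinite. The
    hypothesis [0 <= gam] makes Psi nonnegative, hence [tau] almost surely finite, and yields Psi (2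
    l) <= 6 Psi l, the source of the constants in the lower bound for W. *)

Section Monotone_class.
Context d (T : measurableType d) (R : realType).
Local Open Scope ereal_scope.
Import HBNNSimple.

(** Every nonnegative measurable function is an increasing limit of simple functions, and these are
    finite sums of nonnegative multiples of indicators; so closure under the three operations
    carries [Q] from indicators to all of them. *)
Lemma ge0_measurable_ind (Q : (T -> \bar R) -> Prop) :
  (forall A, measurable A -> Q (fun x => (\1_A x)%:E)) ->
  (forall (k : R) f, (0 <= k)%R -> measurable_fun setT f -> (forall x, 0 <= f x) ->
     Q f -> Q (fun x => k%:E * f x)) ->
  (forall f g, measurable_fun setT f -> (forall x, 0 <= f x) ->
     measurable_fun setT g -> (forall x, 0 <= g x) ->
     Q f -> Q g -> Q (fun x => f x + g x)) ->
  (forall f_ : (T -> \bar R)^nat, (forall n, measurable_fun setT (f_ n)) ->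
     (forall n x, 0 <= f_ n x) ->
     (forall x, {homo f_ ^~ x : n m / (n <= m)%N >-> n <= m}) ->
     (forall n, Q (f_ n)) -> Q (fun x => limn (f_ ^~ x))) ->
  forall f, measurable_fun setT f -> (forall x, 0 <= f x) -> Q f.
Proof.
move=> Qi Qs Qa Ql f mf f0.
pose f_ := nnsfun_approx measurableT mf.
have Q0 : Q (fun=> 0).
  have := Qi set0 measurable0; congr Q; apply/funext => x.
  by rewrite indic0.
have -> : f = (fun x => limn (fun n => (f_ n x)%:E)).
  by apply/funext => x; apply/esym/cvg_lim => //; exact: cvg_nnsfun_approx.
apply: Ql => [n|n x|x m n mn|n].
- exact/measurable_EFinP.
- by rewrite lee_fin.
- by rewrite lee_fin; exact/lefP/nd_nnsfun_approx.
have -> : (fun x => (f_ n x)%:E) =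
    (fun x => \sum_(k <- fset_set (range (f_ n)))
        (k * \1_(f_ n @^-1` [set k]) x)%:E).
  apply/funext => x; rewrite {1}fimfunE -fsumEFin//.
  by rewrite fsbig_finite.
have : {in fset_set (range (f_ n)), forall k : R, (0 <= k)%R}.
  by move=> k; rewrite in_fset_set// => /set_mem[x _ <-].
move: (fset_set _); move=> s.
(* Measurability and nonnegativity of the partial sums travel with [Q], since closure under addition
   asks for them. *)
have : {in (s : seq R), forall k : R, (0 <= k)%R} ->
    Q (fun x => \sum_(k <- (s : seq R)) (k * \1_(f_ n @^-1` [set k]) x)%:E) /\
    measurable_fun setT
      (fun x => \sum_(k <- (s : seq R)) (k * \1_(f_ n @^-1` [set k]) x)%:E) /\
    forall x, 0 <= \sum_(k <- (s : seq R)) (k * \1_(f_ n @^-1` [set k]) x)%:E.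
  elim: (s : seq R) => [_|k {}s IH sk].
    split; first by under eq_fun do rewrite big_nil.
    split => [|x]; last by rewrite big_nil.
    by under eq_fun do rewrite big_nil; exact: measurable_cst.
  have /IH[Qs1 [ms1 s10]] : {in s, forall k : R, (0 <= k)%R}.
    by move=> j js; apply: sk; rewrite inE js orbT.
  have k0 : (0 <= k)%R by apply: sk; rewrite inE eqxx.
  have mI : measurable_fun setT (fun x => (k * \1_(f_ n @^-1` [set k]) x)%:E).
    exact/measurable_EFinP/measurable_funM.
  have I0 x : 0 <= (k * \1_(f_ n @^-1` [set k]) x)%:E by rewrite lee_fin mulr_ge0.
  split.
    under eq_fun do rewrite big_cons; apply: Qa => //.
    under eq_fun do rewrite EFinM; apply: Qs => //.
    - exact/measurable_EFinP.
    - exact: Qi.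
  split => [|x]; last by rewrite big_cons adde_ge0.
  under eq_fun do rewrite big_cons.
  exact: emeasurable_funD.
by move=> /[apply] -[].
Qed.

End Monotone_class.

Section Weighted_image.
Context d d' (T : measurableType d) (T' : measurableType d') (R : realType).
Variables (mu : {measure set T -> \bar R}) (phi : T -> \bar R) (Y : T -> T').
Hypotheses (mphi : measurable_fun setT phi) (phi0 : forall x, (0 <= phi x)%E)
  (mY : measurable_fun setT Y).
Local Open Scope ereal_scope.

(* The hypotheses are arguments of the definition so that the measure structure can be inferred. *)
Definition weighted_image of measurable_fun setT phi & (forall x, 0 <= phi x) &
    measurable_fun setT Y := fun B : set T' => \int[mu]_(x in Y @^-1` B) phi x.

Local Notation nu := (weighted_image mphi phi0 mY).

Let mYB B : measurable B -> measurable (Y @^-1` B).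
Proof. by move=> mB; rewrite -[_ @^-1` _]setTI; exact: mY. Qed.

Let nu0 : nu set0 = 0. Proof. by rewrite /weighted_image preimage_set0 integral_set0. Qed.
Let nu_ge0 B : 0 <= nu B. Proof. by rewrite /weighted_image integral_ge0. Qed.
Let nu_sigma_additive : semi_sigma_additive nu.
Proof.
move=> F mF tF mUF; rewrite /weighted_image preimage_bigcup.
rewrite ge0_integral_bigcup//.
- by apply: is_cvg_ereal_nneg_natsum_cond => // n _ _; exact: integral_ge0.
- by move=> k; exact: mYB.
- exact: measurable_funTS.
- apply/trivIsetP => /= i j _ _ ij; rewrite -preimage_setI.
  by move/trivIsetP : tF => /(_ _ _ _ _ ij) ->//; rewrite preimage_set0.
Qed.

HB.instance Definition _ := isMeasure.Build _ _ _ nu nu0 nu_ge0 nu_sigma_additive.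

(** [nu] is the image under [Y] of the measure with density [phi]; one monotone class induction
    proves the density formula and the change of variables together. *)
Lemma ge0_integral_weighted_image (f : T' -> \bar R) :
  measurable_fun setT f -> (forall y, 0 <= f y) ->
  \int[nu]_y f y = \int[mu]_x (phi x * f (Y x)).
Proof.
move: f; apply: ge0_measurable_ind => [B mB|k f k0 mf f0 IH|f g mf f0 mg g0 IHf IHg|f_ mf f0 nf IH].
- rewrite integral_indic// setIT /nu /weighted_image.
  rewrite [LHS]integral_mkcond; apply: eq_integral => x _.
  rewrite patchE indicE /=; have [YB|YB] := boolP (x \in Y @^-1` B).
    by move: YB; rewrite inE /= => YB; rewrite mem_set// mule1.
  by rewrite [Y x \in B](_ : _ = false) ?mule0//; apply: contraNF YB; rewrite !inE.
- rewrite ge0_integralZl_EFin//.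
  rewrite IH -ge0_integralZl_EFin//.
  + by apply: eq_integral => x _; rewrite muleCA.
  + by move=> x _; rewrite mule_ge0.
  + by apply: emeasurable_funM => //; exact: measurableT_comp.
- rewrite ge0_integralD// IHf IHg -ge0_integralD//; last 4 first.
  + by move=> x _; rewrite mule_ge0.
  + by apply: emeasurable_funM => //; exact: measurableT_comp.
  + by move=> x _; rewrite mule_ge0.
  + by apply: emeasurable_funM => //; exact: measurableT_comp.
  by apply: eq_integral => x _; rewrite ge0_muleDr.
- rewrite monotone_convergence//.
  transitivity (\int[mu]_x limn (fun n => phi x * f_ n (Y x))).
    rewrite monotone_convergence//.
    + by congr (limn _); apply/funext => n; rewrite IH.
    + by move=> n; apply: emeasurable_funM => //; exact: measurableT_comp.
    + by move=> n x _; rewrite mule_ge0.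
    + by move=> x _ m n mn; rewrite lee_wpmul2l// nf.
  apply: eq_integral => x _.
  have cf : cvgn (f_ ^~ (Y x)) by apply: ereal_nondecreasing_is_cvgn => m n mn; exact: nf.
  have [->|px0] := eqVneq (phi x) 0.
    by rewrite mul0e; under eq_fun do rewrite mul0e; rewrite lim_cst.
  have [py|py] := eqVneq (phi x) +oo; last first.
    have pf : phi x \is a fin_num by rewrite ge0_fin_numE// lt_neqAle py leey.
    by apply/cvg_lim => //; apply: cvgeZl.
  (* Multiplication by +oo is not continuous at 0: a sequence that is identically zero is separated
     from one that becomes positive, whose product with +oo is eventually constant. *)
  rewrite py; have [f00|[n0 fn0]] : (forall n, f_ n (Y x) = 0) \/ exists n, 0 < f_ n (Y x).
    have [H|/existsNP[n /eqP Hn]] := pselect (forall n, f_ n (Y x) = 0); first by left.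
    by right; exists n; rewrite lt0e Hn f0.
    under eq_fun do rewrite f00 mule0; under [X in _ = _ * limn X]eq_fun do rewrite f00.
    by rewrite !lim_cst// mule0.
  have gt0lim : 0 < limn (f_ ^~ (Y x)).
    apply: (lt_le_trans fn0); apply: lime_ge => //; near=> m; apply: nf; near: m.
    exact: nbhs_infty_ge.
  rewrite gt0_mulye//; apply/cvg_lim => //.
  apply: cvg_near_cst; near=> n.
  rewrite gt0_mulye//; apply: (lt_le_trans fn0); apply: nf; near: n.
  exact: nbhs_infty_ge.
Unshelve. all: by end_near. Qed.

End Weighted_image.

Section Independence.
Context d (T : measurableType d) (R : realType) (P : probability T R).
Local Open Scope ereal_scope.

(** Both sides are finite measures in [A] that agree on a pi-system containing the whole space; the
    right one is a multiple of [P], built with [mscale]. *)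
Lemma indep_g_sigma (G : set (set T)) (C : set T) :
  G `<=` measurable -> setI_closed G -> G setT -> measurable C ->
  (forall A, G A -> P (A `&` C) = P A * P C) ->
  forall A, <<s G>> A -> P (A `&` C) = P A * P C.
Proof.
move=> Gm GI GT mC H A sA.
have rP : (0 <= fine (P C))%R by rewrite fine_ge0.
have PCE : (fine (P C))%:E = P C by rewrite fineK// fin_num_measure.
rewrite muleC.
pose r := NngNum rP.
have m2E B : mscale r P B = P C * P B by rewrite -PCE.
rewrite -m2E -[LHS]/(mrestr P mC A).
apply: (@g_sigma_algebra_measure_unique _ _ _ G Gm (fun=> setT) (fun=> GT)) => //.
- by rewrite bigcup_const.
- by move=> B GB; transitivity (P C * P B); [rewrite muleC -H|rewrite -m2E].
- by move=> _; rewrite /= /mrestr ltey_eq fin_num_measure//; exact: measurableI.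
Qed.

(** Independence makes the joint law a product, and Tonelli integrates over the second variable with
    the first one frozen. This form replaces conditional expectation. *)
Lemma indep_integral d1 d2 (T1 : measurableType d1) (T2 : measurableType d2)
    (U : T -> T1) (V : T -> T2) :
  measurable_fun setT U -> measurable_fun setT V ->
  (forall A B, measurable A -> measurable B ->
    P (U @^-1` A `&` V @^-1` B) = P (U @^-1` A) * P (V @^-1` B)) ->
  forall F : T1 * T2 -> \bar R, measurable_fun setT F -> (forall z, 0 <= F z) ->
  \int[P]_w F (U w, V w) = \int[P]_w \int[P]_w' F (U w, V w').
Proof.
move=> mU mV UV F mF F0.
pose U' : {mfun T >-> T1} := mfun_Sub (mem_set mU).
pose V' : {mfun T >-> T2} := mfun_Sub (mem_set mV).
have mUV : measurable_fun setT (fun w => (U w, V w)) by exact: measurable_fun_pair.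
pose W' : {mfun T >-> (T1 * T2)%type} := mfun_Sub (mem_set mUV).
transitivity (\int[distribution P W']_z F z).
  by rewrite ge0_integral_distribution.
transitivity (\int[(distribution P U' \x distribution P V')]_z F z).
  apply: eq_measure_integral => A mA _; apply/esym.
  by apply: product_measure_unique => // B C mB mC; rewrite /distribution/= /pushforward/= -UV.
rewrite fubini_tonelli1// ge0_integral_distribution//; last 2 first.
- exact: measurable_fun_fubini_tonelli_F.
- by move=> x; apply: integral_ge0.
apply: eq_integral => w _ /=; rewrite /fubini_F ge0_integral_distribution//.
by apply: measurableT_comp => //; exact: pair1_measurable.
Qed.

End Independence.

Lemma integrable_indicD d (T : measurableType d) (R : realType)
    (mu : {measure set T -> \bar R}) (D A : set T) :
  measurable D -> measurable A -> (mu A < +oo)%E ->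
  mu.-integrable D (fun x => (\1_A x)%:E).
Proof.
move=> mD mA Aoo; apply/integrableP; split; first exact/measurable_EFinP.
under eq_integral do rewrite gee0_abs ?lee_fin//.
rewrite integral_indic//; apply: le_lt_trans Aoo.
by apply: le_measure; rewrite ?inE//; exact: measurableI.
Qed.

Lemma cvg_integral_dominated d (T : measurableType d) (R : realType)
    (mu : {measure set T -> \bar R}) (D : set T) (f_ : (T -> \bar R)^nat) (f g : T -> \bar R) :
  measurable D ->
  (forall n, measurable_fun D (f_ n)) -> (forall x, D x -> f_ ^~ x @ \oo --> f x) ->
  mu.-integrable D g -> (forall n x, D x -> `|f_ n x| <= g x)%E ->
  (\int[mu]_(x in D) f_ n x)%E @[n --> \oo] --> (\int[mu]_(x in D) f x)%E.
Proof.
move=> mD mf cf ig fg.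
have [] // := @dominated_convergence _ _ _ mu D mD f_ f g mf _ _ ig _.
- exact: (emeasurable_fun_cvg f_).
- exact: aeW.
- by apply: aeW => x n; exact: fg.
Qed.

Section Bounded_second_moment.
Context d (T : measurableType d) (R : realType) (P : probability T R).
Local Open Scope ereal_scope.

(* A bound on second moments makes the sequence uniformly integrable: [x <= min x M + x^2/M]. *)
Lemma cvg_integral_L2 (X_ : nat -> T -> R) (X : T -> R) (C l : R) :
  (forall n, measurable_fun setT (X_ n)) -> measurable_fun setT X ->
  (forall n w, 0 <= X_ n w)%R -> (forall w, 0 <= X w)%R ->
  (forall w, X_ ^~ w @ \oo --> X w) ->
  (forall n, \int[P]_w ((X_ n w) ^+ 2)%:E <= C%:E) ->
  (\int[P]_w (X_ n w)%:E @[n --> \oo] --> l%:E) ->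
  \int[P]_w (X w)%:E = l%:E.
Proof.
move=> mX_ mX X_0 X0 cX HC cl.
have C0 : (0 <= C)%R.
  by rewrite -lee_fin; apply: le_trans (HC 0%N); apply: integral_ge0 => w _; rewrite lee_fin sqr_ge0.
apply/eqP; rewrite eq_le; apply/andP; split.
  (* Fatou's lemma gives the upper bound [l]; the lower bound comes from the truncation at [M]. *)
  have := @fatou _ _ _ P setT measurableT (fun n w => (X_ n w)%:E) _ _.
  rewrite (cvg_limn_einf_sup cl).1 => H.
  have HX : \int[P]_w (X w)%:E = \int[P]_x limn_einf (fun n => (X_ n x)%:E).
    apply: eq_integral => w _.
    by rewrite (@cvg_limn_einf_sup _ _ (X w)%:E _).1//; apply/cvg_EFin; [exact: nearW|exact: cX].
  rewrite HX; apply: H.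
  - by move=> n; exact/measurable_EFinP.
  - by move=> n w _; rewrite lee_fin.
apply/lee_addgt0Pr => e e0.
(* Chosen so that [C / M <= e]; the added 1 keeps [M] positive when [C] is 0. *)
pose M := (C / e + 1)%R.
have M0 : (0 < M)%R by rewrite ltr_wpDl// divr_ge0// ltW.
have CM : (C / M <= e)%R.
  by rewrite ler_pdivrMr// mulrDr mulrCA mulfV ?gt_eqF// !mulr1 lerDl ltW.
have mmin n : measurable_fun setT (fun w => (Num.min (X_ n w) M)%:E).
  by apply/measurable_EFinP; apply: measurable_minr.
have cmin : \int[P]_w (Num.min (X_ n w) M)%:E @[n --> \oo] --> \int[P]_w (Num.min (X w) M)%:E.
  apply: (@cvg_integral_dominated _ _ _ P setT (fun n w => (Num.min (X_ n w) M)%:E) _ (cst M%:E)) => //.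
  - move=> w _; apply/cvg_EFin; first exact: nearW.
    rewrite /comp/=; under eq_fun do rewrite minr_absE; rewrite minr_absE.
    by apply: cvgMl; apply: cvgB; [|apply: cvg_norm; apply: cvgB => //; exact: cvg_cst];
      apply: cvgD => //; exact: cvg_cst.
  - exact: finite_measure_integrable_cst.
  - by move=> n w _; rewrite gee0_abs lee_fin ?ge_min ?lexx ?orbT// le_min X_0 ltW.
have cmin2 : \int[P]_w (Num.min (X_ n w) M)%:E + (C / M)%:E @[n --> \oo] -->
    \int[P]_w (Num.min (X w) M)%:E + (C / M)%:E.
  by apply: cvgeD => //; [rewrite fin_num_adde_defl|exact: cvg_cst].
have lle : l%:E <= \int[P]_w (Num.min (X w) M)%:E + (C / M)%:E.
  rewrite -(cvg_lim _ cl)// -(cvg_lim _ cmin2)//.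
  apply: lee_lim; [exact: cvgP cl|exact: cvgP cmin2|apply: nearW => n].
  have mX2 : measurable_fun setT (fun w => (X_ n w ^+ 2)%:E).
    by apply/measurable_EFinP; apply: measurable_funX.
  apply: (@le_trans _ _ (\int[P]_w ((Num.min (X_ n w) M)%:E + (M^-1)%:E * (X_ n w ^+ 2)%:E))).
    apply: ge0_le_integral => //.
    - by move=> w _; rewrite lee_fin.
    - exact/measurable_EFinP.
    - by apply: emeasurable_funD => //; exact: measurable_funeM.
    - move=> w _; rewrite -EFinM -EFinD lee_fin.
      have [XM|MX] := leP (X_ n w) M; first by rewrite lerDl mulr_ge0// ?sqr_ge0// invr_ge0 ltW.
      apply: (@le_trans _ _ (M^-1 * X_ n w ^+ 2)%R); last by rewrite lerDr ltW.
      by rewrite mulrC ler_pdivlMr// expr2 ler_wpM2l// ltW.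
  rewrite ge0_integralD//; last 3 first.
  - by move=> w _; rewrite lee_fin le_min X_0 ltW.
  - by move=> w _; rewrite -EFinM lee_fin mulr_ge0// ?sqr_ge0// invr_ge0 ltW.
  - exact: measurable_funeM.
  rewrite leeD2l// ge0_integralZl//; last 2 first.
  - by move=> w _; rewrite lee_fin sqr_ge0.
  - by rewrite lee_fin invr_ge0 ltW.
  by rewrite muleC EFinM lee_wpmul2r// lee_fin invr_ge0 ltW.
apply: (le_trans lle); apply: leeD; last by rewrite lee_fin.
apply: ge0_le_integral => //.
- by move=> w _; rewrite lee_fin le_min X0 ltW.
- by apply/measurable_EFinP; apply: measurable_minr.
- exact/measurable_EFinP.
- by move=> w _; rewrite lee_fin ge_min lexx.
Qed.

End Bounded_second_moment.

(** * Uniqueness of the Laplace transform *)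

Section Laplace.
Context (R : realType).

Lemma expRN_le1 (y : R) : 0 <= y -> expR (- y) <= 1.
Proof. by move=> y0; rewrite -expR0 ler_expR oppr_le0. Qed.

(* [bernstein n g u] is the expectation of [g] under the binomial law with parameters [n], [u]. *)
Fixpoint bernstein (n : nat) (g : nat -> R) (u : R) : R :=
  if n is n'.+1 then u * bernstein n' (g \o succn) u + (1 - u) * bernstein n' g u
  else g 0%N.

(** Variance plus squared mean of a binomial variable shifted by [a]. The free shift absorbs the
    [succn] of the recursion and so makes the induction close. *)
Lemma bernstein_sqr n (a u : R) :
  bernstein n (fun k => (k%:R + a) ^+ 2) u = n%:R * u * (1 - u) + (n%:R * u + a) ^+ 2.
Proof.
elim: n a => [|n IH] a /=; first by ring.
rewrite IH [X in bernstein n X u](_ : _ = fun k => (k%:R + (a + 1)) ^+ 2); last first.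
  by apply/funext => k /=; rewrite -natr1; ring.
by rewrite IH -natr1; ring.
Qed.

Lemma bernsteinZ n g (c u : R) : bernstein n (fun k => c * g k) u = c * bernstein n g u.
Proof.
elim: n g => //= n IH g.
by rewrite IH [X in bernstein n X u](_ : _ = fun k => c * (g \o succn) k)// IH; ring.
Qed.

Lemma bernsteinD n g h (u : R) :
  bernstein n (fun k => g k + h k) u = bernstein n g u + bernstein n h u.
Proof.
elim: n g h => //= n IH g h.
rewrite IH [X in bernstein n X u](_ : _ = fun k => (g \o succn) k + (h \o succn) k)//.
by rewrite IH; ring.
Qed.

Lemma bernstein_cst n (c u : R) : bernstein n (fun=> c) u = c.
Proof. by elim: n => //= n IH; rewrite [X in bernstein n X u](_ : _ = fun=> c)// IH; ring. Qed.

Lemma le_bernstein n g h (u : R) : 0 <= u <= 1 -> (forall k, g k <= h k) ->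
  bernstein n g u <= bernstein n h u.
Proof.
move=> /andP[u0 u1]; elim: n g h => //= n IH g h gh.
apply: lerD; first by rewrite ler_wpM2l// IH// => k; exact: gh.
by rewrite ler_wpM2l ?subr_ge0// IH.
Qed.

(** Chebyshev's argument for Lipschitz functions: a deviation z satisfies z <= e + z^2 / e, and
    taking the binomial expectation turns z^2 into a variance of at most 1 / n.+1. *)
Lemma bernstein_lipschitz n (f : R -> R) (K u e : R) : 0 <= u <= 1 -> 0 < e -> 0 <= K ->
  (forall a b, `|f a - f b| <= K * `|a - b|) ->
  `|bernstein n.+1 (fun k => f (k%:R / n.+1%:R)) u - f u| <= K * (e + (n.+1%:R * e)^-1).
Proof.
move=> u01 e0 K0 fK.
have n0 : 0 < n.+1%:R :> R by rewrite ltr0n.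
set N : R := n.+1%:R in n0 *.
pose q k : R := K * (e + (k%:R - N * u) ^+ 2 * (N ^+ 2 * e)^-1).
have Bq : bernstein n.+1 q u <= K * (e + (N * e)^-1).
  rewrite /q bernsteinZ ler_wpM2l// bernsteinD bernstein_cst lerD2l.
  rewrite [X in bernstein _ X u](_ : _ = fun k => (N ^+ 2 * e)^-1 * (k%:R + - (N * u)) ^+ 2); last first.
    by apply/funext => k; rewrite mulrC.
  rewrite bernsteinZ bernstein_sqr -/N subrr expr0n/= addr0.
  have -> : (N ^+ 2 * e)^-1 * (N * u * (1 - u)) = (N * e)^-1 * (u * (1 - u)).
    by field; rewrite !gt_eqF.
  rewrite -[leRHS]mulr1 ler_wpM2l ?invr_ge0 ?mulr_ge0 ?ltW//.
  by move: u01 => /andP[u0 u1]; nra.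
have fq k : `|f (k%:R / N) - f u| <= q k.
  apply: (le_trans (fK _ _)); rewrite ler_wpM2l//.
  have -> : k%:R / N - u = (k%:R - N * u) / N by field; rewrite gt_eqF.
  set x := k%:R - N * u; rewrite normrM (@gtr0_norm _ N^-1) ?invr_gt0//.
  have -> : e + x ^+ 2 * (N ^+ 2 * e)^-1 = e + (`|x| / N) ^+ 2 / e.
    by rewrite -(real_normK (num_real x)); field; rewrite !gt_eqF.
  set z := _ / N; have z0 : 0 <= z by rewrite divr_ge0// ltW.
  have [ze|ez] := leP z e; first by rewrite (le_trans ze)// lerDl divr_ge0// ?sqr_ge0// ltW.
  apply: (@le_trans _ _ (z ^+ 2 / e)); last by rewrite lerDr ltW.
  by rewrite ler_pdivlMr// expr2 ler_wpM2l// ltW.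
set Bf := bernstein _ _ u.
have h1 : f u <= Bf + bernstein n.+1 q u.
  rewrite -[leLHS](bernstein_cst n.+1 (f u) u) /Bf -bernsteinD.
  by apply: le_bernstein => // k /=; move: (fq k); rewrite ler_norml => /andP[]; lra.
have h2 : Bf <= f u + bernstein n.+1 q u.
  rewrite -[X in X + _](bernstein_cst n.+1 (f u) u) /Bf -bernsteinD.
  by apply: le_bernstein => // k /=; move: (fq k); rewrite ler_norml => /andP[]; lra.
set D := K * _ in Bq *; rewrite ler_norml; apply/andP; split.
  by move: (le_trans h1 (lerD (lexx Bf) Bq)); lra.
by move: (le_trans h2 (lerD (lexx (f u)) Bq)); lra.
Qed.

Lemma bernstein_cvg (f : R -> R) (K u : R) : 0 <= u <= 1 -> 0 <= K ->
  (forall a b, `|f a - f b| <= K * `|a - b|) ->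
  bernstein n.+1 (fun k => f (k%:R / n.+1%:R)) u @[n --> \oo] --> f u.
Proof.
move=> u01 K0 fK; apply/cvgrPdist_le => e e0.
have K1 : 0 < K + 1 by rewrite ltr_wpDl.
(* Each of the two error terms is then at most K s; [K + 1] allows for [K = 0]. *)
pose s := e / (2 * (K + 1)).
have s0 : 0 < s by rewrite divr_gt0// mulr_gt0.
have sE : s = e / (2 * (K + 1)) by [].
clearbody s.
near=> n; rewrite distrC; apply: (le_trans (bernstein_lipschitz n u01 s0 K0 fK)).
have n0 : 0 < n.+1%:R :> R by rewrite ltr0n.
have ns : (n.+1%:R * s)^-1 <= s.
  rewrite -[leRHS]invrK lef_pV2 ?posrE ?mulr_gt0 ?invr_gt0//.
  rewrite -ler_pdivrMr//; apply: ltW; apply: (@lt_trans _ _ n%:R); last by rewrite ltr_nat.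
  by near: n; exact: nbhs_infty_gtr.
apply: (@le_trans _ _ ((K + 1) * (s + s))).
  apply: ler_pM => //; [by rewrite addr_ge0 ?invr_ge0 ?mulr_ge0 ?ltW|by rewrite lerDl|by rewrite lerD2l].
have -> // : (K + 1) * (s + s) = e by rewrite sE; field; rewrite gt_eqF.
Unshelve. all: by end_near. Qed.

Lemma measurable_bernstein (h : R -> R) n g :
  measurable_fun setT h -> measurable_fun setT (fun y => bernstein n g (h y)).
Proof.
move=> mh; elim: n g => [g|n IH g] /=; first exact: measurable_cst.
apply: measurable_funD; apply: measurable_funM => //.
by apply: measurable_funB => //; exact: measurable_cst.
Qed.

Lemma bernstein_ge0 n g (u : R) : 0 <= u <= 1 -> (forall k, 0 <= g k) -> 0 <= bernstein n g u.
Proof. by move=> u01 g0; rewrite -(bernstein_cst n 0 u); exact: le_bernstein. Qed.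


Lemma subset01_expRN (y : R) : 0 <= y -> 0 <= expR (- y) <= 1.
Proof. by move=> y0; rewrite expR_ge0 expRN_le1. Qed.

Variables m1 m2 : {measure set R -> \bar R}.
Local Notation D := `[(0:R), +oo[%classic.
Local Notation u := (fun y : R => expR (- y)).
Hypothesis eqL : forall n : nat,
  (\int[m1]_(y in D) (expR (- (n.+1%:R * y)))%:E = \int[m2]_(y in D) (expR (- (n.+1%:R * y)))%:E)%E.
Hypothesis finL : (\int[m1]_(y in D) (expR (- y))%:E < +oo)%E.

Let mu_ : measurable_fun setT u.
Proof. by apply: measurableT_comp => //; exact: measurable_oppr. Qed.

Let mu1_ : measurable_fun setT (fun y => 1 - u y).
Proof. by apply: measurable_funB. Qed.

(** Unfolding [bernstein] once only raises [i] or [j], so integrals of Bernstein polynomials reduce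
    by induction to monomials. The exponent [i.+1] keeps one factor [u], without which the integrals
    could be infinite. *)
Let W (i j n : nat) (g : nat -> R) (y : R) := u y ^+ i.+1 * (1 - u y) ^+ j * bernstein n g (u y).

Let mW i j n g : measurable_fun setT (W i j n g).
Proof.
apply: measurable_funM; last exact: measurable_bernstein.
by apply: measurable_funM; exact: measurable_funX.
Qed.

Let mWE i j n g : measurable_fun D (EFin \o W i j n g).
Proof. by apply: measurable_funTS; apply/measurable_EFinP. Qed.

Let W_ge0 i j n g y : D y -> (forall k, 0 <= g k) -> 0 <= W i j n g y.
Proof.
rewrite /= in_itv/= andbT => y0 g0; have /andP[u0 u1] := subset01_expRN y0.
by rewrite !mulr_ge0 ?exprn_ge0 ?subr_ge0// bernstein_ge0// u0.
Qed.

Let WE i j y : W i j 0 (fun=> 1) y = u y ^+ i.+1 * (1 - u y) ^+ j.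
Proof. by rewrite /W /= mulr1. Qed.

Let I0 (m : {measure set R -> \bar R}) i :
  (\int[m]_(y in D) (W i 0 0 (fun=> 1%R) y)%:E = \int[m]_(y in D) (expR (- (i.+1%:R * y)))%:E)%E.
Proof.
apply: eq_integral => y _; rewrite WE expr0 mulr1 -expRM_natl; congr (expR _)%:E.
by rewrite mulrN.
Qed.

Let finI i j : (\int[m1]_(y in D) (W i j 0 (fun=> 1%R) y)%:E < +oo)%E.
Proof.
apply: le_lt_trans finL; apply: ge0_le_integral => //.
- by move=> y Dy; rewrite lee_fin W_ge0.
- by apply: measurable_funTS; apply/measurable_EFinP.
- by apply: measurable_funTS; apply/measurable_EFinP.
- move=> y; rewrite /= in_itv/= andbT => y0; have /andP[u0 u1] := subset01_expRN y0.
  rewrite lee_fin WE exprS -[leRHS]mulr1 -mulrA ler_wpM2l//.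
  by rewrite -[leRHS]mulr1 ler_pM ?exprn_ge0 ?subr_ge0// exprn_ile1 ?subr_ge0// gerBl.
Qed.

(** From (1 - u)^j = (1 - u)^(j+1) + u (1 - u)^j the case [j.+1] follows by subtraction, which is
    legitimate because the subtracted integral is finite. *)
Let eqI i j : (\int[m1]_(y in D) (W i j 0 (fun=> 1%R) y)%:E = \int[m2]_(y in D) (W i j 0 (fun=> 1%R) y)%:E)%E.
Proof.
elim: j i => [|j IH] i; first by rewrite !I0 eqL.
have split_ (m : {measure set R -> \bar R}) :
    (\int[m]_(y in D) (W i j 0 (fun=> 1%R) y)%:E =
     \int[m]_(y in D) (W i j.+1 0 (fun=> 1%R) y)%:E + \int[m]_(y in D) (W i.+1 j 0 (fun=> 1%R) y)%:E)%E.
  rewrite -ge0_integralD//; last 4 first.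
  - by move=> y Dy; rewrite lee_fin W_ge0.
  - exact: mWE.
  - by move=> y Dy; rewrite lee_fin W_ge0.
  - exact: mWE.
  by apply: eq_integral => y _; rewrite -EFinD !WE; congr (_%:E); rewrite !exprS; ring.
have H := IH i; rewrite !split_ -(IH i.+1) in H.
have f : (\int[m1]_(y in D) (W i.+1 j 0 (fun=> 1%R) y)%:E)%E \is a fin_num.
  by rewrite ge0_fin_numE ?finI// integral_ge0// => y Dy; rewrite lee_fin W_ge0.
by rewrite -(addeK (\int[m1]_(y in D) (W i j.+1 0 (fun=> 1%R) y)%:E) f) H addeK.
Qed.

Let eqB i j n g : (forall k, 0 <= g k) ->
  (\int[m1]_(y in D) (W i j n g y)%:E = \int[m2]_(y in D) (W i j n g y)%:E)%E.
Proof.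
elim: n i j g => [|n IH] i j g g0.
  have E (m : {measure set R -> \bar R}) : (\int[m]_(y in D) (W i j 0 g y)%:E =
      (g 0%N)%:E * \int[m]_(y in D) (W i j 0 (fun=> 1%R) y)%:E)%E.
    rewrite -ge0_integralZl_EFin//.
    - by apply: eq_integral => y _; rewrite -EFinM /W /= mulr1 mulrC.
    - by move=> y Dy; rewrite lee_fin W_ge0.
    - exact: mWE.
  by rewrite !E eqI.
have E (m : {measure set R -> \bar R}) : (\int[m]_(y in D) (W i j n.+1 g y)%:E =
   \int[m]_(y in D) (W i.+1 j n (g \o succn) y)%:E + \int[m]_(y in D) (W i j.+1 n g y)%:E)%E.
  rewrite -ge0_integralD//; last 4 first.
  - by move=> y Dy; rewrite lee_fin W_ge0// => k; exact: g0.
  - exact: mWE.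
  - by move=> y Dy; rewrite lee_fin W_ge0.
  - exact: mWE.
  by apply: eq_integral => y _; rewrite -EFinD; congr (_%:E); rewrite /W /= !exprS; ring.
by rewrite !E !IH// => k; exact: g0.
Qed.

Let finu2 : (\int[m2]_(y in D) (u y)%:E < +oo)%E.
Proof.
have := eqL 0; under eq_integral do rewrite mul1r.
by under [in X in _ = X -> _]eq_integral do rewrite mul1r; move=> <-.
Qed.

Let iu (m : {measure set R -> \bar R}) : (\int[m]_(y in D) (u y)%:E < +oo)%E ->
  m.-integrable D (EFin \o u).
Proof.
move=> H; apply/integrableP; split; first by apply: measurable_funTS; apply/measurable_EFinP.
apply: le_lt_trans H; apply: ge0_le_integral => //.
- by apply: measurableT_comp => //; apply: measurable_funTS; apply/measurable_EFinP.
- by apply: measurable_funTS; apply/measurable_EFinP.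
- by move=> y _; rewrite gee0_abs// lee_fin expR_ge0.
Qed.

Let eqLip (f : R -> R) (K : R) : 0 <= K -> (forall a b, `|f a - f b| <= K * `|a - b|) ->
  (forall a, 0 <= f a <= 1) ->
  (\int[m1]_(y in D) (u y * f (u y))%:E = \int[m2]_(y in D) (u y * f (u y))%:E)%E.
Proof.
move=> K0 fK f01.
pose g n k := f (k%:R / n.+1%:R).
have C (m : {measure set R -> \bar R}) : (\int[m]_(y in D) (u y)%:E < +oo)%E ->
    ((\int[m]_(y in D) (W 0 0 n.+1 (g n) y)%:E)%E @[n --> \oo] -->
     \int[m]_(y in D) (u y * f (u y))%:E)%E.
  move=> H; apply: (@cvg_integral_dominated _ _ _ m D _ _ (EFin \o u)) => //.
  - by move=> n; exact: mWE.
  - move=> y; rewrite /= in_itv/= andbT => y0; apply/cvg_EFin; first exact: nearW.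
    rewrite /comp/= /W expr1 expr0 mulr1; apply: cvgMr.
    exact: (bernstein_cvg (subset01_expRN y0) K0 fK).
  - exact: iu.
  - move=> n y Dy; have y01 : 0 <= u y <= 1 by apply: subset01_expRN; move: Dy; rewrite /= in_itv/= andbT.
    rewrite gee0_abs ?lee_fin; last by rewrite W_ge0// => k; have /andP[] := f01 (k%:R / n.+1%:R).
    rewrite /W expr1 expr0 mulr1 -[leRHS]mulr1 ler_wpM2l ?expR_ge0//.
    by rewrite -[leRHS](bernstein_cst n.+1 1 (u y)) le_bernstein// => k; have /andP[] := f01 (k%:R / n.+1%:R).
have c1 := C m1 finL; have c2 := C m2 finu2.
rewrite -(cvg_lim _ c1)// -(cvg_lim _ c2)//; congr (limn _); apply/funext => n.
by rewrite eqB// => k; have /andP[] := f01 (k%:R / n.+1%:R).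
Qed.

(** Lipschitz functions with values in [0, 1] that increase to the indicator of the ray v > c. *)
Let h (c : R) (k : nat) (v : R) := Num.min 1 (k%:R * Num.max (v - c) 0).

Let h_lip c k a b : `|h c k a - h c k b| <= k%:R * `|a - b|.
Proof.
have H1 (x y : R) : `|Num.max (x - c) 0 - Num.max (y - c) 0| <= `|x - y|.
  have n1 := ler_norm (x - y); have := ler_norm (y - x); rewrite distrC => n2.
  by rewrite ler_norml; case: (leP (x - c) 0); case: (leP (y - c) 0) => *; apply/andP; split; lra.
have H2 (x y : R) : `|Num.min 1 x - Num.min 1 y| <= `|x - y|.
  have n1 := ler_norm (x - y); have := ler_norm (y - x); rewrite distrC => n2.
  by rewrite ler_norml; case: (leP 1 x); case: (leP 1 y) => *; apply/andP; split; lra.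
apply: (le_trans (H2 _ _)); rewrite -mulrBr normrM ger0_norm//.
by rewrite ler_wpM2l.
Qed.

Let h01 c k a : 0 <= h c k a <= 1.
Proof. by rewrite /h ge_min lexx le_min ler01/= mulr_ge0// le_max lexx orbT. Qed.

Let eqray (c : R) : (\int[m1]_(y in D) (u y * (c < u y)%R%:R)%:E = \int[m2]_(y in D) (u y * (c < u y)%R%:R)%:E)%E.
Proof.
have mh k : measurable_fun setT (h c k).
  apply: measurable_minr => //; apply: measurable_funM => //.
  by apply: measurable_maxr => //; apply: measurable_funB.
have C (m : {measure set R -> \bar R}) : (\int[m]_(y in D) (u y)%:E < +oo)%E ->
    ((\int[m]_(y in D) (u y * h c n (u y))%:E)%E @[n --> \oo] -->
     \int[m]_(y in D) (u y * (c < u y)%R%:R)%:E)%E.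
  move=> H; apply: (@cvg_integral_dominated _ _ _ m D _ _ (EFin \o u)) => //.
  - move=> n; apply: measurable_funTS; apply/measurable_EFinP; apply: measurable_funM => //.
    exact: measurableT_comp.
  - move=> y Dy; apply/cvg_EFin; first exact: nearW.
    rewrite /comp/=; apply: cvgMr; have [cu|uc] := ltP c (u y); last first.
      apply: cvg_near_cst; apply: nearW => n.
      by rewrite /h max_r ?subr_le0// mulr0 min_r.
    apply: cvg_near_cst; near=> n.
    rewrite /h max_l ?subr_ge0 ?(ltW cu)// min_l//.
    rewrite -ler_pdivrMr ?subr_gt0// div1r; apply: ltW; near: n; exact: nbhs_infty_gtr.
  - exact: iu.
  - move=> n y Dy; have /andP[h0 h1] := h01 c n (u y).
    rewrite gee0_abs ?lee_fin; last by rewrite mulr_ge0 ?expR_ge0.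
    by rewrite -[leRHS]mulr1 ler_wpM2l ?expR_ge0.
have c1 := C m1 finL; have c2 := C m2 finu2.
rewrite -(cvg_lim _ c1)// -(cvg_lim _ c2)//; congr (limn _); apply/funext => n.
exact: (@eqLip _ n%:R).
Unshelve. all: by end_near. Qed.

Let phi (y : R) : \bar R := (u y * \1_D y)%:E.

Let mphi : measurable_fun setT phi.
Proof. by apply/measurable_EFinP; apply: measurable_funM. Qed.

Let phi0 y : (0 <= phi y)%E.
Proof. by rewrite lee_fin mulr_ge0 ?expR_ge0. Qed.

Let phiE (m : {measure set R -> \bar R}) (f : R -> \bar R) :
  (\int[m]_y (phi y * f y) = \int[m]_(y in D) ((u y)%:E * f y))%E.
Proof.
rewrite [RHS]integral_mkcond; apply: eq_integral => y _; rewrite patchE /phi indicE.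
by case: (y \in D); rewrite /= ?mulr1// mulr0 mul0e.
Qed.

(** After y is mapped to exp (- y) in (0, 1], transforms at positive integers are moments, and
    Bernstein approximation passes from moments to rays. The rays form a pi-system on which the
    measures weighted by exp (- y) are finite; the factor exp y then removes the weight. *)
Lemma laplace_transform_unique (f : R -> \bar R) :
  measurable_fun setT f -> (forall y, 0 <= f y)%E ->
  (\int[m1]_(y in D) f y = \int[m2]_(y in D) f y)%E.
Proof.
move=> mf f0.
pose nu (m : {measure set R -> \bar R}) : {measure set R -> \bar R} := weighted_image m mphi phi0 (@measurable_id _ R setT).
have nuE (m : {measure set R -> \bar R}) (g : R -> \bar R) : measurable_fun setT g -> (forall y, 0 <= g y)%E ->
    (\int[nu m]_y g y = \int[m]_(y in D) ((u y)%:E * g y))%E.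
  by move=> mg g0; rewrite /nu ge0_integral_weighted_image// phiE.
have nuI (m : {measure set R -> \bar R}) A : measurable A ->
    nu m A = (\int[m]_(y in D) (u y * \1_A y)%:E)%E.
  move=> mA; transitivity (\int[nu m]_y (\1_A y)%:E)%E; first by rewrite integral_indic// setIT.
  by rewrite nuE//; apply/measurable_EFinP.
have eqnu A : measurable A -> nu m1 A = nu m2 A.
  move: A; apply: (@measure_unique _ _ _ (@RGenInftyO.G R) (fun n => `]-oo, (n%:R : R)[%classic) _ _ _ _ (nu m1) (nu m2)).
  - exact: RGenInftyO.measurableE.
  - move=> _ _ [a ->] [b ->]; exists (Num.min a b); apply/seteqP; split => y /=;
      rewrite !in_itv/= lt_min; first by case=> -> ->.
    by move=> /andP[].
  - by move=> n; exists n%:R.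
  - rewrite -subTset => y _; exists (Num.bound `|y|) => //=; rewrite in_itv/=.
    exact: (le_lt_trans (ler_norm _) (archi_boundP (normr_ge0 _))).
  - move=> _ [a ->]; rewrite !nuI//.
    have E y : (u y * \1_(`]-oo, a[%classic) y)%:E = (u y * (expR (- a) < u y)%R%:R)%:E.
      by rewrite ltr_expR ltrN2 indicE mem_setE in_itv.
    under eq_integral do rewrite E; under [RHS]eq_integral do rewrite E.
    exact: eqray.
  - move=> n; rewrite nuI//; apply: le_lt_trans finL; apply: ge0_le_integral => //.
    + apply: measurable_funTS; apply/measurable_EFinP; apply: measurable_funM => //.
    + by apply: measurable_funTS; apply/measurable_EFinP.
    + by move=> y _; rewrite lee_fin -[leRHS]mulr1 ler_wpM2l ?expR_ge0// indicE; case: (_ \in _).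
have fE (m : {measure set R -> \bar R}) : (\int[m]_(y in D) f y = \int[nu m]_y ((expR y)%:E * f y))%E.
  rewrite nuE.
  - apply: eq_integral => y _.
    by rewrite muleA -EFinM -expRD addNr expR0 mul1e.
  - by apply: emeasurable_funM => //; apply/measurable_EFinP.
  - by move=> y; rewrite mule_ge0// lee_fin expR_ge0.
by rewrite !fE; apply: eq_measure_integral => A mA _; exact: eqnu.
Qed.

End Laplace.

(** * The Laplace exponent and the scale function *)

Section Laplace_exponent.
Context (R : realType) (gam sig : R) (pi : {measure set R -> \bar R}).
Hypotheses (gam0 : 0 <= gam) (pi_cond : levy_measure_cond pi).

Local Notation Ps := (Psi gam sig pi).
Local Notation D := `](0:R), +oo[%classic.

Definition psi_kernel (u : R) : R := expR (- u) - 1 + u.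

Lemma psi_kernel_ge0 u : 0 <= psi_kernel u.
Proof. by rewrite /psi_kernel; have := expR_ge1Dx (- u); lra. Qed.

Lemma psi_kernel_lex u : 0 <= u -> psi_kernel u <= u.
Proof. by move=> u0; rewrite /psi_kernel; have := expRN_le1 u0; lra. Qed.

Lemma psi_kernel_lex2 u : 0 <= u -> psi_kernel u <= u ^+ 2.
Proof.
move=> u0; have u1 : 0 < 1 + u by rewrite ltr_wpDr.
have : expR (- u) <= (1 + u)^-1 by rewrite expRN lef_pV2 ?posrE ?expR_gt0// expR_ge1Dx.
rewrite /psi_kernel => H; apply: (@le_trans _ _ ((1 + u)^-1 - 1 + u)); first by rewrite !lerD.
have -> : (1 + u)^-1 - 1 + u = u ^+ 2 / (1 + u) by field; rewrite gt_eqF.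
by rewrite ler_pdivrMr// ler_peMr ?sqr_ge0// lerDl.
Qed.

Lemma psi_kernel_homo u v : 0 <= u -> u <= v -> psi_kernel u <= psi_kernel v.
Proof.
move=> u0 uv; rewrite /psi_kernel.
have E : expR (- v) = expR (- u) * expR (- (v - u)) by rewrite -expRD; congr expR; lra.
have h1 := expR_ge1Dx (- (v - u)); have h2 := expRN_le1 u0; have h3 := expR_gt0 (- u).
by rewrite E; nra.
Qed.

(** Doubling produces exactly twice the kernel plus (1 - exp (- u))^2, and this square is at most
    four times the kernel: 6 = 2 + 4. *)
Lemma psi_kernel_double u : 0 <= u -> psi_kernel (2 * u) <= 6 * psi_kernel u.
Proof.
move=> u0.
have E2 : expR (- (2 * u)) = expR (- u) ^+ 2 by rewrite -expRM_natl mulrN.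
have -> : psi_kernel (2 * u) = 2 * psi_kernel u + (1 - expR (- u)) ^+ 2.
  by rewrite /psi_kernel E2; ring.
suff : (1 - expR (- u)) ^+ 2 <= 4 * psi_kernel u by lra.
have e0 := expR_gt0 (- u); have e1 := expRN_le1 u0; have eu := expR_ge1Dx (- u).
(* For u <= 2 the bound exp (- u) >= (1 - u / 2)^2 suffices; for u > 2 the kernel exceeds 1 while
   the square stays below 1. *)
have [u2|u2] := leP u 2.
  have : (1 - u / 2) ^+ 2 <= expR (- u).
    have -> : expR (- u) = expR (- (u / 2)) ^+ 2 by rewrite -expRM_natl; congr expR; lra.
    have := expR_ge1Dx (- (u / 2)) => h.
    by rewrite ler_pXn2r ?nnegrE ?expR_ge0//; lra.
  by rewrite /psi_kernel; nra.
by rewrite /psi_kernel; nra.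
Qed.

Lemma measurable_psi_kernel (l : R) : measurable_fun setT (fun z : R => (psi_kernel (l * z))%:E).
Proof.
apply/measurable_EFinP; apply: measurable_funD; last exact: measurable_funM.
apply: measurable_funB => //; apply: measurableT_comp => //.
by apply: measurableT_comp => //; exact: measurable_funM.
Qed.

(** The bounds u and u^2 for the kernel combine to max (l, l^2) times min (z, z^2). Finiteness
    ensures that the [fine] in [Psi] returns the true integral and not a default value. *)
Lemma psi_integral_lty l : 0 <= l -> (\int[pi]_(z in D) (psi_kernel (l * z))%:E < +oo)%E.
Proof.
move=> l0.
have mm : measurable_fun D (fun z : R => (Num.min z (z ^+ 2))%:E).
  by apply: measurable_funTS; apply/measurable_EFinP; apply: measurable_minr => //; exact: measurable_funX.
have m0 z : D z -> (0 <= (Num.min z (z ^+ 2))%:E)%E.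
  by rewrite /= in_itv/= andbT => z0; rewrite lee_fin le_min sqr_ge0 ltW.
have ml0 : 0 <= Num.max l (l ^+ 2) by rewrite le_max l0.
apply: (@le_lt_trans _ _ (\int[pi]_(z in D) ((Num.max l (l ^+ 2))%:E * (Num.min z (z ^+ 2))%:E))%E).
  apply: ge0_le_integral => //.
  - by move=> z _; rewrite lee_fin psi_kernel_ge0.
  - by apply: measurable_funTS; exact: measurable_psi_kernel.
  - exact: measurable_funeM.
  - move=> z; rewrite /= in_itv/= andbT => z0; rewrite -EFinM lee_fin.
    have lz : 0 <= l * z by rewrite mulr_ge0// ltW.
    have [zz|zz] := leP z (z ^+ 2).
      by rewrite (le_trans (psi_kernel_lex lz))// ler_wpM2r ?le_max ?lexx// ltW.
    by rewrite (le_trans (psi_kernel_lex2 lz))// exprMn ler_wpM2r ?sqr_ge0// le_max lexx orbT.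
rewrite ge0_integralZl_EFin// lte_mul_pinfty// lee_fin//.
Qed.

Let J l := fine (\int[pi]_(z in D) (psi_kernel (l * z))%:E)%E.

Let JE l : 0 <= l -> ((J l)%:E = \int[pi]_(z in D) (psi_kernel (l * z))%:E)%E.
Proof.
move=> l0; rewrite /J fineK// ge0_fin_numE ?psi_integral_lty//.
by apply: integral_ge0 => z _; rewrite lee_fin psi_kernel_ge0.
Qed.

Let J_ge0 l : 0 <= J l.
Proof. by rewrite fine_ge0// integral_ge0// => z _; rewrite lee_fin psi_kernel_ge0. Qed.

Lemma PsiE l : Ps l = gam * l + sig ^+ 2 / 2 * l ^+ 2 + J l.
Proof. by []. Qed.

Let sig2 : 0 <= sig ^+ 2 / 2. Proof. by rewrite divr_ge0// sqr_ge0. Qed.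

Lemma Psi_ge0 l : 0 <= l -> 0 <= Ps l.
Proof. by move=> l0; rewrite PsiE !addr_ge0 ?J_ge0// mulr_ge0// sqr_ge0. Qed.

Lemma Psi_homo l l' : 0 <= l -> l <= l' -> Ps l <= Ps l'.
Proof.
move=> l0 ll'; rewrite !PsiE; have l'0 : 0 <= l' by exact: le_trans ll'.
apply: lerD; [apply: lerD|].
- by rewrite ler_wpM2l.
- by rewrite ler_wpM2l// ler_pXn2r ?nnegrE.
rewrite -lee_fin !JE//; apply: ge0_le_integral => //.
- by move=> z _; rewrite lee_fin psi_kernel_ge0.
- by apply: measurable_funTS; exact: measurable_psi_kernel.
- by apply: measurable_funTS; exact: measurable_psi_kernel.
- move=> z; rewrite /= in_itv/= andbT => z0; rewrite lee_fin; apply: psi_kernel_homo.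
    by rewrite mulr_ge0// ltW.
  by rewrite ler_wpM2r// ltW.
Qed.

(** The linear, quadratic and integral terms grow by at most 2, 4 and 6, and all three are
    nonnegative. *)
Lemma Psi_double l : 0 <= l -> Ps (2 * l) <= 6 * Ps l.
Proof.
move=> l0; rewrite !PsiE.
have JJ : J (2 * l) <= 6 * J l.
  rewrite -lee_fin EFinM !JE ?mulr_ge0// -ge0_integralZl_EFin//.
  - apply: ge0_le_integral => //.
    + by move=> z _; rewrite lee_fin psi_kernel_ge0.
    + by apply: measurable_funTS; exact: measurable_psi_kernel.
    + by apply: measurable_funeM; apply: measurable_funTS; exact: measurable_psi_kernel.
    + move=> z; rewrite /= in_itv/= andbT => z0; rewrite -EFinM lee_fin -mulrA.
      by rewrite psi_kernel_double// mulr_ge0// ltW.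
  - by move=> z _; rewrite lee_fin psi_kernel_ge0.
  - by apply: measurable_funTS; exact: measurable_psi_kernel.
have h := J_ge0 l; have gl : 0 <= gam * l by rewrite mulr_ge0.
have sl : 0 <= sig ^+ 2 / 2 * l ^+ 2 by rewrite mulr_ge0// sqr_ge0.
by move: JJ sl; rewrite exprMn; set a := sig ^+ 2 / 2; nra.
Qed.

End Laplace_exponent.

Section Scale_function.
Context (R : realType) (Ps W : R -> R).
Hypotheses (scW : scale_function Ps W) (Ps_ge0 : forall q, 0 < q -> 0 <= Ps q).

Local Notation mu := (@lebesgue_measure R).
Local Notation D := `[(0:R), +oo[%classic.
Let f (q y : R) := expR (- (q * y)) * W y.

Lemma scale_lt0 x : x < 0 -> W x = 0. Proof. by case: scW => + _ _ _; exact. Qed.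

Lemma scale_measurable : measurable_fun setT W.
Proof.
have -> : [set: R] = `]-oo, (0:R)[%classic `|` D.
  apply/seteqP; split => // x _ /=; rewrite !in_itv/= andbT.
  by case: (ltP x 0) => ?; [left|right].
apply/measurable_funU => //; split.
  apply: (eq_measurable_fun (cst (0 : R))); last exact: measurable_cst.
  by move=> x; rewrite inE/= in_itv/= => x0; rewrite scale_lt0.
apply: subspace_continuous_measurable_fun => //.
by case: scW.
Qed.

Let mf q : measurable_fun setT (f q).
Proof.
apply: measurable_funM; last exact: scale_measurable.
apply: measurableT_comp => //; apply: measurableT_comp => //.
Qed.

Let mfE q : measurable_fun D (EFin \o f q).
Proof. by apply: measurable_funTS; apply/measurable_EFinP. Qed.

Lemma scale_laplace q : 0 < q -> (\int[mu]_(y in D) (f q y)%:E = ((Ps q)^-1)%:E)%E.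
Proof. by case: scW => _ _ _; exact. Qed.

(** The sign of [W] is still unknown here. The integral is the difference of the integrals of the
    positive and negative parts, and it could not have a finite value if one of them were
    infinite. *)
Let f_integrable q : 0 < q -> mu.-integrable D (EFin \o f q).
Proof.
move=> q0; have := scale_laplace q0; rewrite integralE.
set a := (\int[mu]_(x in D) _)%E; set b := (X in (a - X)%E) => ab.
have a0 : (0 <= a)%E by exact: integral_ge0.
have b0 : (0 <= b)%E by exact: integral_ge0.
apply/integrableP; split; first exact: mfE.
apply: (@le_lt_trans _ _ (a + b)%E).
  rewrite -ge0_integralD//; last 2 first.
  - by apply: measurable_funepos; exact: mfE.
  - by apply: measurable_funeneg; exact: mfE.
  rewrite le_eqVlt; apply/orP; left; apply/eqP; apply: eq_integral => y _.
  by rewrite -[LHS]/((abse \o (EFin \o f q)) y) fune_abse.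
move: ab a0 b0; case: a => [a| |] //; case: b => [b| |] //= ab a0 b0.
by rewrite ltry.
Qed.

Lemma scale_lt x y : 0 <= x -> x < y -> W x < W y.
Proof.
move=> x0 xy; case: scW => _ _ m _.
by rewrite m// in_itv/= andbT// (le_trans x0 (ltW xy)).
Qed.

Lemma scale_le x y : 0 <= x -> x <= y -> W x <= W y.
Proof.
by move=> x0; rewrite le_eqVlt => /predU1P[->//|xy]; rewrite ltW// scale_lt.
Qed.

(* If [W] were negative on [[0, delta]], then after multiplication by [expR (q * delta)] the
   Laplace transform would tend to -oo as [q] grows, but it equals [1 / Ps q >= 0]. *)
Lemma scale0_ge0 : 0 <= W 0.
Proof.
rewrite leNgt; apply/negP => W0.
have [de de0 Wde] : exists2 de, 0 < de & W de < 0.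
  have cW : W x @[x --> 0^'+] --> W 0.
    case: scW => _ cW _ _.
    have /continuous_within_itvcyP[] := cW; by [].
  have : \forall x \near (0:R)^'+, W x < 0 by apply: (cvgr_lt (W 0)).
  have : \forall x \near (0:R)^'+, 0 < x by exact: nbhs_right_gt.
  by move=> h1 h2; have [x [x0 Wx]] := filter_ex (filterI h1 h2); exists x.
pose C := fine (\int[mu]_(y in D) ((EFin \o f 1)^\+ y))%E.
have CE : (\int[mu]_(y in D) ((EFin \o f 1)^\+ y) = C%:E)%E.
  rewrite fineK// ge0_fin_numE; last exact: integral_ge0.
  have /integrableP[_] : mu.-integrable D ((EFin \o f 1)^\+)%E.
    by apply: integrable_funepos => //; exact: f_integrable.
  by under eq_integral do rewrite gee0_abs//.
have C0 : 0 <= C by rewrite fine_ge0// integral_ge0.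
have key q : 1 <= q -> - W de * q * de ^+ 2 / 4 <= expR de * C.
  move=> q1; have q0 : 0 < q by exact: lt_le_trans q1.
  pose c := - W de * q * (de / 2).
  have c0 : 0 <= c by rewrite !mulr_ge0 ?oppr_ge0 ?divr_ge0 ?ltW.
  (* On [0, de / 2] the value [W y] is at most [W de < 0] and its exponential factor is at least q
     de / 2, which pays for [c]. Where [W y] is positive, y exceeds [de], so the factor exp (q (de -
     y)) is largest at q = 1. *)
  have ptw y : D y -> expR (q * de) * f q y + c * \1_(`[0, de / 2]%classic) y <= expR de * Num.max (f 1 y) 0.
    rewrite /= in_itv/= andbT => y0.
    have E r : expR (r * de) * f r y = expR (r * (de - y)) * W y.
      by rewrite /f mulrA -expRD; congr (expR _ * _); ring.
    have E1 := E 1; rewrite !mul1r in E1.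
    rewrite E -[X in X * Num.max _ _]mul1r -mulrA; rewrite mul1r maxr_pMr ?expR_ge0// E1 mulr0.
    have e1 := expR_gt0 (q * (de - y)); have e2 := expR_gt0 (de - y).
    rewrite indicE mem_setE in_itv/= y0/=.
    have [yd|dy] := leP y (de / 2).
      have Wy : W y <= W de by apply: scale_le => //; lra.
      rewrite le_max; apply/orP; right; rewrite mulr1 /c.
      have h : q * (de / 2) <= expR (q * (de - y)).
        apply: (le_trans _ (expR_ge1Dx _)); apply: (@le_trans _ _ (q * (de - y))); last by rewrite lerDr.
        by apply: ler_wpM2l; lra.
      set e := expR _ in h e1 *.
      have p1 : e * W y <= e * W de by rewrite ler_pM2l.
      have p2 : - W de * (q * (de / 2)) <= - W de * e by rewrite ler_wpM2l//; lra.
      by lra.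
    rewrite !mulr0 addr0 le_max.
    have [Wy|Wy] := leP (W y) 0; first by apply/orP; right; nra.
    apply/orP; left; rewrite ler_wpM2r ?(ltW Wy)// ler_expR.
    have : de < y by rewrite ltNge; apply/negP => yde; have := scale_le y0 yde; lra.
    by nra.
  have i1 : mu.-integrable D (fun y => (expR (q * de))%:E * (f q y)%:E)%E.
    by apply: integrableZl => //; exact: f_integrable.
  have iI : mu.-integrable D (fun y => (\1_(`[0, de / 2]%classic) y)%:E)%E.
    apply: integrable_indicD => //.
    have := lebesgue_measure_itv `[0, de / 2]; rewrite /= => ->; by case: ifP => _; rewrite -?EFinB ltry.
  have i2 : mu.-integrable D (fun y => c%:E * (\1_(`[0, de / 2]%classic) y)%:E)%E.
    by apply: integrableZl.
  have I1 : (\int[mu]_(y in D) ((expR (q * de))%:E * (f q y)%:E + c%:E * (\1_(`[0, de / 2]%classic) y)%:E)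
      <= \int[mu]_(y in D) ((expR de)%:E * (EFin \o f 1)^\+ y))%E.
    apply: le_integral => //.
    - exact: integrableD.
    - by apply: integrableZl => //; apply: integrable_funepos => //; exact: f_integrable.
    - move=> y; rewrite inE => Dy; rewrite -!EFinM -EFinD funeposE/= -EFin_max -EFinM.
      by rewrite lee_fin; exact: ptw.
  move: I1; rewrite integralD// integralZl//; last exact: f_integrable.
  rewrite scale_laplace// integralZl// integral_indic//.
  rewrite integralZl//; last by apply: integrable_funepos => //; exact: f_integrable.
  rewrite CE setIidl; last by move=> y/=; rewrite !in_itv/= => /andP[->].
  rewrite /= lebesgue_measure_itv/= lte_fin divr_gt0// -EFinB -!EFinM -EFinD lee_fin subr0.
  apply: le_trans; rewrite -[leLHS]add0r lerD//.
    by rewrite mulr_ge0 ?expR_ge0// invr_ge0 Ps_ge0.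
  by rewrite /c le_eqVlt; apply/orP; left; apply/eqP; field.
have wd : 0 < - W de * de ^+ 2 / 4 by rewrite divr_gt0// mulr_gt0// ?oppr_gt0// exprn_gt0.
(* With this q the left side of [key] exceeds the right side by the positive number [w]. *)
pose q := 1 + expR de * C / (- W de * de ^+ 2 / 4).
have q1 : 1 <= q by rewrite lerDl divr_ge0 ?(ltW wd)// mulr_ge0 ?expR_ge0.
have := key q q1; set w := - W de * de ^+ 2 / 4 in wd q q1 *.
have -> : - W de * q * de ^+ 2 / 4 = q * w by rewrite /w; ring.
by rewrite /q mulrDl mul1r divfK ?gt_eqF// gerDr leNgt wd.
Qed.

Lemma scale_ge0 y : 0 <= W y.
Proof.
have [y0|y0] := ltP y 0; first by rewrite scale_lt0.
exact: (le_trans scale0_ge0 (scale_le _ y0)).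
Qed.

Lemma scale_gt0 y : 0 < y -> 0 < W y.
Proof. by move=> y0; exact: (le_lt_trans scale0_ge0 (scale_lt _ y0)). Qed.

Let f_ge0 q y : 0 <= f q y.
Proof. by rewrite mulr_ge0 ?expR_ge0// scale_ge0. Qed.

(* On [[x, 2x]] the integrand is at least [expR (- 2 q x) * W x]. *)
Lemma scale_laplace_ge q x : 0 < q -> 0 < x -> x * (expR (- (2 * q * x)) * W x) <= (Ps q)^-1.
Proof.
move=> q0 x0; rewrite -lee_fin -scale_laplace//.
apply: (@le_trans _ _ (\int[mu]_(y in `[x, (2 * x)%R]) (cst (expR (- (2 * q * x)) * W x)%:E y))%E).
  rewrite integral_cst//= lebesgue_measure_itv/= lte_fin ltr_pMl// ltr1n -EFinB -EFinM lee_fin mulrC.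
  by rewrite le_eqVlt; apply/orP; left; apply/eqP; ring.
apply: (@le_trans _ _ (\int[mu]_(y in `[x, (2 * x)%R]) (f q y)%:E)%E).
  apply: ge0_le_integral => //.
  - by move=> y _; rewrite lee_fin mulr_ge0 ?expR_ge0// scale_ge0.
  - apply: measurable_funTS; apply/measurable_EFinP; exact: mf.
  - move=> y; rewrite /= in_itv/= => /andP[xy yx]; rewrite lee_fin.
    rewrite ler_pM ?expR_ge0 ?scale_ge0//; last by rewrite scale_le// ltW.
    by rewrite ler_expR lerN2 -mulrA [_ * (q * x)]mulrCA ler_pM2l.
apply: ge0_subset_integral => //.
- exact: mfE.
- by move=> y _; rewrite lee_fin f_ge0.
- by move=> y/=; rewrite !in_itv/= => /andP[xy _]; rewrite andbT (le_trans (ltW x0)).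
Qed.

(** The inverse of [Ps q] dominates a positive number, which excludes the value 0 left open by
    [Ps_ge0]. *)
Lemma scale_exponent_gt0 q : 0 < q -> 0 < Ps q.
Proof.
move=> q0; rewrite -invr_gt0; apply: lt_le_trans (scale_laplace_ge q0 ltr01).
by rewrite mul1r mulr_gt0 ?expR_gt0// scale_gt0.
Qed.

(** [scale_laplace_ge] at q = 1 / x, where its exponential factor is exp (- 2). *)
Lemma scale_upper x : 0 < x -> W x <= expR 2 * (x * Ps x^-1)^-1.
Proof.
move=> x0; have x10 : 0 < x^-1 by rewrite invr_gt0.
have := scale_laplace_ge x10 x0; rewrite -mulrA mulVf ?gt_eqF// mulr1 expRN.
rewrite mulrCA ler_pdivrMl ?expR_gt0// => H.
by rewrite invfM mulrCA -ler_pdivrMl ?invr_gt0// invrK.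
Qed.

Hypothesis Ps_double : forall q, 0 < q -> Ps (2 * q) <= 6 * Ps q.

(** Cut the Laplace integral at x: below, it is at most x W(x); above, half of the exponent is spent
    on the factor exp (- q x / 2), and doubling bounds the rest by 6 / Ps q. For q = 8 / x the tail
    is absorbed. Three further doublings bring q back to 1 / x, so 432 = 2 * 6^3. *)
Lemma scale_lower x : 0 < x -> (x * Ps x^-1)^-1 <= 432 * W x.
Proof.
(* Then q x / 2 = 4, large enough for 6 exp (- 4) <= 1 / 2, and 8 is a power of 2. *)
move=> x0; pose q := 8 / x; have q0 : 0 < q by rewrite divr_gt0.
have q20 : 0 < q / 2 by rewrite divr_gt0.
have P0 := scale_exponent_gt0 q0.
have P1 : (Ps (q / 2))^-1 <= 6 * (Ps q)^-1.
  have := Ps_double q20; rewrite mulrC divfK// => H.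
  have P20 := scale_exponent_gt0 q20.
  by rewrite -[leLHS]mul1r ler_pdivrMr// mulrAC ler_pdivlMr// mul1r.
have I1 : (Ps q)^-1 <= x * W x + expR (- (q * x / 2)) * (Ps (q / 2))^-1.
  rewrite -lee_fin EFinD [X in (_ + X)%E]EFinM -!scale_laplace//.
  have m1 : measurable_fun D (fun y => (W x * \1_(`[0, x]%classic) y)%:E).
    by apply: measurable_funTS; apply/measurable_EFinP; apply: measurable_funM.
  have -> : ((x * W x)%:E = \int[mu]_(y in D) (W x * \1_(`[0, x]%classic) y)%:E)%E.
    under eq_integral do rewrite EFinM; rewrite ge0_integralZl_EFin//; last 2 first.
    - by apply: measurable_funTS; apply/measurable_EFinP.
    - exact: scale_ge0.
    rewrite integral_indic// setIidl; last by move=> y/=; rewrite !in_itv/= => /andP[->].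
    by rewrite /= lebesgue_measure_itv/= lte_fin x0 -EFinB -EFinM subr0 mulrC.
  rewrite -ge0_integralZl_EFin ?expR_ge0//; last 2 first.
  - by move=> y _; rewrite lee_fin f_ge0.
  - exact: mfE.
  rewrite -ge0_integralD//; last 3 first.
  - by move=> y _; rewrite lee_fin mulr_ge0// scale_ge0.
  - by move=> y _; rewrite -EFinM lee_fin mulr_ge0 ?expR_ge0.
  - by apply: measurable_funeM; exact: mfE.
  apply: ge0_le_integral => //.
  - by move=> y _; rewrite lee_fin f_ge0.
  - exact: mfE.
  - by apply: emeasurable_funD => //; apply: measurable_funeM; exact: mfE.
  move=> y; rewrite /= in_itv/= andbT => y0; rewrite -EFinM -EFinD lee_fin.
  rewrite indicE mem_setE in_itv/= y0/=; have [yx|xy] := leP y x.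
    rewrite mulr1; apply: (@le_trans _ _ (W x)); last by rewrite lerDl mulr_ge0 ?expR_ge0.
    rewrite /f -[leRHS]mul1r ler_pM ?expR_ge0 ?scale_ge0 ?scale_le//.
    by rewrite expRN_le1// mulr_ge0// ltW.
  rewrite mulr0 add0r /f mulrA -expRD ler_wpM2r ?scale_ge0// ler_expR.
  by have := ltW xy; nra.
have E4 : 6 * expR (- (q * x / 2)) <= 1 / 2.
  have -> : q * x / 2 = 4 by rewrite /q; field; rewrite gt_eqF.
  have e4 : (16 : R) <= expR 4.
    have -> : expR (4 : R) = expR (1 : R) ^+ 4 by rewrite -(expRM_natl 4) mulr1.
    have e1 := expR_ge1Dx (1 : R).
    have e2 : (2 : R) <= expR 1 by lra.
    have -> : (16 : R) = 2 ^+ 4 by rewrite -natrX.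
    rewrite ler_pXn2r ?nnegrE//; lra.
  by rewrite expRN ler_pdivrMr ?expR_gt0//; lra.
have P8 : Ps q <= 216 * Ps x^-1.
  have x10 : 0 < x^-1 by rewrite invr_gt0.
  have -> : q = 2 * (2 * (2 * x^-1)) by rewrite /q; field; rewrite gt_eqF.
  have h1 : Ps (2 * x^-1) <= 6 * Ps x^-1 by exact: Ps_double.
  have h2 : Ps (2 * (2 * x^-1)) <= 6 * Ps (2 * x^-1) by apply: Ps_double; rewrite mulr_gt0.
  have h3 : Ps (2 * (2 * (2 * x^-1))) <= 6 * Ps (2 * (2 * x^-1)) by apply: Ps_double; rewrite !mulr_gt0.
  by lra.
have P2 : (Ps q)^-1 / 2 <= x * W x.
  have Pi0 : 0 < (Ps q)^-1 by rewrite invr_gt0.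
  have := expR_gt0 (- (q * x / 2)); move: (expR _) E4 I1 => e E4 I1 e0.
  have : e * (Ps (q / 2))^-1 <= e * (6 * (Ps q)^-1) by rewrite ler_pM2l.
  have : (6 * e) * (Ps q)^-1 <= 1 / 2 * (Ps q)^-1 by rewrite ler_pM2r.
  by lra.
have Px : 0 < Ps x^-1 by apply: scale_exponent_gt0; rewrite invr_gt0.
rewrite invfM ler_pdivrMr// [x^-1]lock -[leLHS]mul1r -lock ler_pdivrMr//.
have : 1 / 2 <= x * W x * Ps q.
  by have := ler_wpM2r (ltW P0) P2; rewrite mulrAC mulVf ?gt_eqF.
have xW : 0 <= x * W x by rewrite mulr_ge0 ?scale_ge0// ltW.
have : x * W x * Ps q <= x * W x * (216 * Ps x^-1) by rewrite ler_wpM2l.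
by lra.
Qed.

End Scale_function.

Lemma measurable_invr (R : realType) : measurable_fun setT (fun y : R => y^-1).
Proof.
rewrite -(setvU [set (0 : R)]); apply/measurable_funU => //; first exact: measurableC.
split.
  apply: open_continuous_measurable_fun.
    by apply: closed_openC; exact: closed_eq.
  move=> y; rewrite inE/= => /eqP y0; exact: inv_continuous.
apply: (eq_measurable_fun (cst (0 : R))); last exact: measurable_cst.
by move=> y; rewrite inE/= => ->; rewrite invr0.
Qed.

(** * Finiteness and decay of the mean passage integral *)

Section Mean_passage_integral.
Context (R : realType) (Ps W Rt : R -> R).
Hypotheses (scW : scale_function Ps W) (Ps_ge0 : forall q, 0 < q -> 0 <= Ps q)
  (Ps_homo : forall q q', 0 < q -> q <= q' -> Ps q <= Ps q')
  (Ps_double : forall q, 0 < q -> Ps (2 * q) <= 6 * Ps q)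
  (Rt_cont : {within `[(0:R), +oo[, continuous Rt}) (Rt_gt0 : forall x, 0 < x -> 0 < Rt x).

Local Notation mu := (@lebesgue_measure R).

(** Extension of 1 / Rt by zero, giving a test function on the whole line for the potential
    formula. *)
Definition inv_rate (A : set R) (y : R) : R := \1_A y / Rt y.

Lemma rate_measurable (A : set R) : measurable A -> A `<=` `[0, +oo[ -> measurable_fun A Rt.
Proof.
move=> mA A0; apply: (@measurable_funS _ _ _ _ `[(0:R), +oo[%classic) => //.
exact: subspace_continuous_measurable_fun.
Qed.

Lemma inv_rate_measurable (A : set R) : measurable A -> A `<=` `]0, +oo[ ->
  measurable_fun setT (inv_rate A).
Proof.
move=> mA A0.
have A0' : A `<=` `[0, +oo[.
  by move=> y /A0/=; rewrite !in_itv/= !andbT; exact: ltW.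
rewrite -(setvU A); apply/measurable_funU => //; first exact: measurableC.
split.
  apply: (eq_measurable_fun (cst (0 : R))); last exact: measurable_cst.
  by move=> y; rewrite inE => nA; rewrite /inv_rate indicE memNset// mul0r.
apply: (eq_measurable_fun (fun y => (Rt y)^-1)).
  by move=> y; rewrite /inv_rate inE => Ay; rewrite indicE mem_set// mul1r.
by apply: (measurableT_comp (@measurable_invr R)); exact: rate_measurable.
Qed.

Lemma inv_rate_ge0 (A : set R) y : A `<=` `]0, +oo[ -> 0 <= inv_rate A y.
Proof.
move=> A0; rewrite /inv_rate indicE; have [|] := boolP (y \in A); last by rewrite mul0r.
by rewrite inE => /A0/=; rewrite in_itv/= andbT => y0; rewrite divr_ge0// ltW// Rt_gt0.
Qed.

Lemma itv_ge_gt0 (b : R) : 0 < b -> `[b, +oo[ `<=` `]0, +oo[.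
Proof. by move=> b0 y/=; rewrite !in_itv/= !andbT; exact: lt_le_trans. Qed.

Lemma itv_geN_gt0 (b N : R) : 0 < b -> `[b, N[ `<=` `]0, +oo[.
Proof.
by move=> b0 y/=; rewrite !in_itv/= andbT => /andP[by_ _]; exact: lt_le_trans by_.
Qed.

Lemma m_ofE b : 0 < b ->
  (m_of Rt W b = \int[mu]_y ((inv_rate `[b, +oo[ y)%:E * (W (y - b))%:E))%E.
Proof.
move=> b0; rewrite /m_of [LHS]integral_mkcond; apply: eq_integral => y _.
rewrite patchE /inv_rate indicE; case: ifPn => yb /=; last by rewrite mul0r mul0e.
by rewrite mul1r -EFinM mulrC.
Qed.

Let mWb (b : R) : measurable_fun setT (fun y : R => (W (y - b))%:E).
Proof.
apply/measurable_EFinP; apply: measurableT_comp; first exact: scale_measurable scW.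
exact: measurable_funB.
Qed.

Let mIW (A : set R) (b : R) : measurable A -> A `<=` `]0, +oo[ ->
  measurable_fun setT (fun y : R => ((inv_rate A y)%:E * (W (y - b))%:E)%E).
Proof.
move=> mA A0; apply: emeasurable_funM; last exact: mWb.
by apply/measurable_EFinP; exact: inv_rate_measurable.
Qed.

Let IW_ge0 (A : set R) (b y : R) : A `<=` `]0, +oo[ -> (0 <= (inv_rate A y)%:E * (W (y - b))%:E)%E.
Proof.
move=> A0; rewrite mule_ge0// lee_fin ?inv_rate_ge0//.
exact: (scale_ge0 scW Ps_ge0).
Qed.

(** Cutting at level n makes the integrand bounded and supported below all large starting points, as
    the second moment bound and the exact mean formula require. *)
Lemma truncated_mean_cvg b : 0 < b ->
  (\int[mu]_y ((inv_rate `[b, n%:R[ y)%:E * (W (y - b))%:E))%E @[n --> \oo] --> m_of Rt W b.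
Proof.
move=> b0; rewrite m_ofE//.
have E : (\int[mu]_y ((inv_rate `[b, +oo[ y)%:E * (W (y - b))%:E))%E =
    (\int[mu]_y limn (fun n : nat => ((inv_rate `[b, n%:R[ y)%:E * (W (y - b))%:E)))%E.
  apply: eq_integral => y _; apply/esym/cvg_lim => //; apply: cvg_near_cst.
  near=> n; congr ((_ / _)%:E * _)%E; rewrite !indicE !mem_setE !in_itv/= andbT.
  suff -> : y < n%:R by rewrite andbT.
  by near: n; exact: nbhs_infty_gtr.
rewrite E; apply: cvg_monotone_convergence => //.
- by move=> n; apply: mIW => //; exact: itv_geN_gt0.
- by move=> n y _; apply: IW_ge0; exact: itv_geN_gt0.
- move=> y _ m n mn; apply: lee_wpmul2r; first by rewrite lee_fin (scale_ge0 scW Ps_ge0).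
  rewrite lee_fin /inv_rate !indicE !mem_setE !in_itv/=.
  have [by_|yb] := leP b y; last by rewrite /= !mul0r.
  have y0 : 0 < Rt y by rewrite Rt_gt0// (lt_le_trans b0).
  apply: ler_wpM2r; first by rewrite invr_ge0 ltW.
  have [ym|_] := ltP y m%:R; last by rewrite ler0n.
  by rewrite (lt_le_trans ym) ?ler_nat.
Unshelve. all: by end_near. Qed.

(** For b >= n + 1 the monotonicity of [W] bounds m(b) by the part of the integral m(1) over [n + 1,
    oo), which tends to 0 by dominated convergence. *)
Lemma m_of_cvg0 : (forall b, 0 < b -> (m_of Rt W b < +oo)%E) ->
  forall e : R, 0 < e -> exists2 b0, 0 < b0 & forall b, b0 <= b -> (m_of Rt W b <= e%:E)%E.
Proof.
move=> fin e e0.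
have m1 := fin 1 ltr01.
have B (c : R) : 1 <= c -> `[c, +oo[ `<=` `]0, +oo[.
  by move=> c1; apply: itv_ge_gt0; exact: lt_le_trans c1.
have i1 : mu.-integrable setT (fun y => ((inv_rate `[1, +oo[ y)%:E * (W (y - 1))%:E)%E).
  apply/integrableP; split; first by apply: mIW => //; exact: B.
  apply: le_lt_trans m1; rewrite m_ofE// le_eqVlt; apply/orP; left; apply/eqP.
  by apply: eq_integral => y _; rewrite gee0_abs// IW_ge0//; exact: B.
have n1 n : 1 <= n.+1%:R :> R by rewrite ler1n.
have : (\int[mu]_y ((inv_rate `[n.+1%:R, +oo[ y)%:E * (W (y - 1))%:E))%E @[n --> \oo] -->
    (\int[mu]_y (cst 0 y))%E.
  apply: (cvg_integral_dominated measurableT _ _ i1).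
  - by move=> n; apply: mIW => //; exact: B.
  - move=> y _; apply: cvg_near_cst; near=> n.
    rewrite /inv_rate indicE memNset ?mul0r ?mul0e//= in_itv/= andbT; apply/negP; rewrite -ltNge.
    apply: (@lt_trans _ _ n%:R); last by rewrite ltr_nat.
    by near: n; exact: nbhs_infty_gtr.
  - move=> n y _; rewrite gee0_abs ?IW_ge0//; last exact: B.
    apply: lee_wpmul2r; first by rewrite lee_fin (scale_ge0 scW Ps_ge0).
    rewrite lee_fin /inv_rate !indicE !mem_setE !in_itv/= !andbT.
    have [ny|yn] := leP n.+1%:R y; last first.
      rewrite /= mul0r; have := @inv_rate_ge0 `[1, +oo[ y (B _ (lexx 1)).
      by rewrite /inv_rate indicE mem_setE in_itv/= andbT.
    by rewrite (le_trans (n1 n)).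
rewrite integral_cst// mul0e => /fine_cvgP[fn /cvgrPdist_le/(_ e e0)] => h.
have [n [fN]] := filter_ex (filterI fn h); rewrite /= sub0r normrN => hN.
exists n.+1%:R => // b nb.
have b0 : 0 < b by exact: lt_le_trans nb.
rewrite m_ofE//.
apply: (@le_trans _ _ (\int[mu]_y ((inv_rate `[n.+1%:R, +oo[ y)%:E * (W (y - 1))%:E))%E).
  apply: ge0_le_integral => //.
  - by move=> y _; apply: IW_ge0; exact: itv_ge_gt0.
  - by apply: mIW => //; exact: itv_ge_gt0.
  - by apply: mIW => //; exact: B.
  - move=> y _; rewrite /inv_rate !indicE !mem_setE !in_itv/= !andbT.
    have [by_|yb] := leP b y; last first.
      rewrite /= mul0r mul0e; apply: mule_ge0; rewrite lee_fin ?(scale_ge0 scW Ps_ge0)//.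
      have := @inv_rate_ge0 `[n.+1%:R, +oo[ y (B _ (n1 n)).
      by rewrite /inv_rate indicE mem_setE in_itv/= andbT.
    rewrite (le_trans nb by_)/= lee_wpmul2l//.
      by rewrite lee_fin mul1r invr_ge0 ltW// Rt_gt0// (lt_le_trans b0).
    by rewrite lee_fin (scale_le scW) ?subr_ge0// lerD2l lerN2 (le_trans (n1 n)).
by rewrite -(fineK fN) lee_fin; exact: (le_trans (ler_norm _)).
Unshelve. all: by end_near. Qed.

Let Ps_gt0 q : 0 < q -> 0 < Ps q. Proof. exact: scale_exponent_gt0 scW Ps_ge0 q. Qed.

Let V (x : R) := (x * Ps x^-1 * Rt x)^-1.

Let V_ge0 x : 0 < x -> 0 <= V x.
Proof. by move=> x0; rewrite invr_ge0 !mulr_ge0 ?ltW ?Rt_gt0 ?Ps_gt0 ?invr_gt0. Qed.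

Let V_measurable (A : R) : 0 < A -> measurable_fun `[A, +oo[ V.
Proof.
move=> A0; apply: (measurableT_comp (@measurable_invr R)).
have AB : `[A, +oo[ `<=` `[(0:R), +oo[.
  by move=> y/=; rewrite !in_itv/= !andbT; apply: le_trans; exact: ltW.
apply: measurable_funM; last exact: rate_measurable.
apply: measurable_funM => //.
(* Measurability of x |-> Ps (1 / x) comes from monotonicity; the clamp at [A] makes the function
   monotone on the whole line. *)
apply: (eq_measurable_fun (fun x : R => Ps (Num.max x A)^-1 : R)).
  by move=> x; rewrite inE/= in_itv/= andbT => Ax; rewrite max_l.
apply: nonincreasing_measurable => // x y xy; apply: Ps_homo.
  by rewrite invr_gt0 lt_max A0 orbT.
have h z : 0 < Num.max z A by rewrite lt_max A0 orbT.
by rewrite lef_pV2 ?posrE// ge_max !le_max lexx xy orbT.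
Qed.

(** For y >= 2 b one has W (y / 2) <= W (y - b). The lower bound for W at y / 2 costs 432, and
    replacing y / 2 by y costs a factor 3 by doubling: 1296 = 3 * 432. *)
Lemma m_of_integrable_near_infty b : 0 < b -> (m_of Rt W b < +oo)%E -> integrable_near_infty V.
Proof.
move=> b0 fin; exists (2 * b); have b20 : 0 < 2 * b by rewrite mulr_gt0.
apply/integrableP; split; first by apply/measurable_EFinP; exact: V_measurable.
have bb : `[2 * b, +oo[ `<=` `[b, +oo[.
  by move=> y/=; rewrite !in_itv/= !andbT; lra.
have C0 : 0 <= 1296 :> R by rewrite ler0n.
have mWR (A : R) : 0 < A -> measurable_fun `[A, +oo[ (fun y => (W (y - b) / Rt y)%:E).
  move=> A0; apply/measurable_EFinP; apply: measurable_funM.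
    by apply: measurable_funTS; apply/measurable_EFinP; exact: mWb.
  apply: (measurableT_comp (@measurable_invr R)); apply: rate_measurable => //.
  by move=> y/=; rewrite !in_itv/= !andbT; apply: le_trans; exact: ltW.
have WR0 y : b <= y -> 0 <= W (y - b) / Rt y.
  move=> yb; rewrite divr_ge0 ?(scale_ge0 scW Ps_ge0)// ltW// Rt_gt0//.
  exact: lt_le_trans yb.
apply: (@le_lt_trans _ _ (\int[mu]_(y in `[(2 * b)%R, +oo[) (1296%:E * (W (y - b) / Rt y)%:E))%E).
  apply: ge0_le_integral => //.
  - by apply: measurableT_comp => //; apply/measurable_EFinP; exact: V_measurable.
  - by apply: measurable_funeM; exact: mWR.
  - move=> y; rewrite /= in_itv/= andbT => by_.
    have y0 : 0 < y by exact: lt_le_trans by_.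
    have R0 := Rt_gt0 y0.
    rewrite /= ger0_norm ?V_ge0// -EFinM lee_fin mulrA /V invfM ler_wpM2r ?invr_ge0 ?(ltW R0)//.
    have y20 : 0 < y / 2 by rewrite divr_gt0.
    have h1 := scale_lower scW Ps_ge0 Ps_double y20.
    have h2 : W (y / 2) <= W (y - b) by apply: (scale_le scW); lra.
    have Py0 : 0 < Ps y^-1 by apply: Ps_gt0; rewrite invr_gt0.
    have h3 : Ps (y / 2)^-1 <= 6 * Ps y^-1.
      have -> : (y / 2)^-1 = 2 * y^-1 by rewrite invf_div mulrC.
      by apply: Ps_double; rewrite invr_gt0.
    have P20 : 0 < Ps (y / 2)^-1 by apply: Ps_gt0; rewrite invr_gt0.
    have h4 : (y * Ps y^-1)^-1 <= 3 * (y / 2 * Ps (y / 2)^-1)^-1.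
      rewrite -[leLHS]mul1r ler_pdivrMr ?mulr_gt0// mulrAC ler_pdivlMr ?mulr_gt0// mul1r.
      by have := ler_wpM2l (ltW y20) h3; lra.
    by lra.
rewrite ge0_integralZl_EFin//; last 2 first.
- by move=> y; rewrite /= in_itv/= andbT => by_; rewrite lee_fin WR0//; lra.
- exact: mWR.
rewrite lte_mul_pinfty//; apply: le_lt_trans fin; apply: ge0_subset_integral => //.
- exact: mWR.
- by move=> y; rewrite /= in_itv/= andbT => by_; rewrite lee_fin WR0.
Qed.

(** On the bounded part [b, c[ the rate has a positive minimum by compactness; beyond c,
    [scale_upper] compares the integrand with V. *)
Lemma integrable_near_infty_m_of b : 0 < b -> integrable_near_infty V -> (m_of Rt W b < +oo)%E.
Proof.
move=> b0 [A /integrableP[mV finV]].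
pose c := Num.max A b; have c0 : 0 < c by rewrite lt_max b0 orbT.
have bc : b <= c by rewrite le_max lexx orbT.
have mWR (B : R) : 0 < B -> measurable_fun `[B, +oo[ (fun y => (W (y - b) / Rt y)%:E).
  move=> B0; apply/measurable_EFinP; apply: measurable_funM.
    by apply: measurable_funTS; apply/measurable_EFinP; exact: mWb.
  apply: (measurableT_comp (@measurable_invr R)); apply: rate_measurable => //.
  by move=> y/=; rewrite !in_itv/= !andbT; apply: le_trans; exact: ltW.
have WR0 y : b <= y -> 0 <= W (y - b) / Rt y.
  move=> yb; rewrite divr_ge0 ?(scale_ge0 scW Ps_ge0)// ltW// Rt_gt0//.
  exact: lt_le_trans yb.
have bcE : `[b, +oo[%classic = `[b, c[%classic `|` `[c, +oo[%classic.
  apply/seteqP; split => y /=; rewrite !in_itv/= !andbT.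
    by move=> by_; case: (ltP y c) => ?; [left|right]; rewrite ?by_.
  by case=> [/andP[]//|]; exact: le_trans.
rewrite /m_of bcE ge0_integral_setU//; last 3 first.
- by rewrite -bcE; exact: mWR.
- by move=> y; rewrite -bcE/= in_itv/= andbT => by_; rewrite lee_fin WR0.
- apply/disj_setPS => y [] /=; rewrite !in_itv/= => /andP[_ yc]; rewrite andbT => cy.
  by move: yc; rewrite ltNge cy.
apply: lte_add_pinfty.
  have [x0 x0in x0min] : exists2 x0, x0 \in `[b, c] & forall t, t \in `[b, c] -> Rt x0 <= Rt t.
    apply: EVT_min => //; apply: continuous_subspaceW Rt_cont => y/=; rewrite !in_itv/= andbT.
    by move=> /andP[by_ _]; apply: le_trans by_; exact: ltW.
  have Rx0 : 0 < Rt x0.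
    by apply: Rt_gt0; move: x0in; rewrite in_itv/= => /andP[bx _]; exact: lt_le_trans bx.
  apply: (@le_lt_trans _ _ (\int[mu]_(y in `[b, c[) (cst (W c / Rt x0)%:E y))%E).
    apply: ge0_le_integral => //.
    - by move=> y; rewrite /= in_itv/= => /andP[by_ _]; rewrite lee_fin WR0.
    - apply: (@measurable_funS _ _ _ _ `[b, +oo[%classic) => //; last exact: mWR.
      by rewrite bcE; left.
    - move=> y; rewrite /= in_itv/= => /andP[by_ yc]; rewrite lee_fin.
      have y0 : 0 < y by exact: lt_le_trans by_.
      rewrite ler_pM ?(scale_ge0 scW Ps_ge0) ?invr_ge0 ?(ltW (Rt_gt0 y0))//.
        by apply: (scale_le scW); lra.
      by rewrite lef_pV2 ?posrE ?Rx0 ?(Rt_gt0 y0)// x0min// in_itv/= by_ ltW.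
  rewrite integral_cst// /= lebesgue_measure_itv/=; case: ifP => _; last by rewrite mule0.
  by rewrite -EFinB -EFinM ltry.
have e2 := expR_ge0 (2 : R).
apply: (@le_lt_trans _ _ (\int[mu]_(y in `[c, +oo[) ((expR 2)%:E * (V y)%:E))%E).
  apply: ge0_le_integral => //.
  - by move=> y; rewrite /= in_itv/= andbT => cy; rewrite lee_fin WR0// (le_trans bc).
  - exact: mWR.
  - by apply: measurable_funeM; apply/measurable_EFinP; exact: V_measurable.
  - move=> y; rewrite /= in_itv/= andbT => cy.
    have y0 : 0 < y by exact: lt_le_trans cy.
    rewrite -EFinM lee_fin /V invfM mulrA ler_wpM2r ?invr_ge0 ?(ltW (Rt_gt0 y0))//.
    apply: le_trans (scale_upper scW Ps_ge0 y0).
    by apply: (scale_le scW); lra.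
rewrite ge0_integralZl_EFin//; last 2 first.
- by move=> y; rewrite /= in_itv/= andbT => cy; rewrite lee_fin V_ge0// (lt_le_trans c0).
- by apply/measurable_EFinP; exact: V_measurable.
rewrite lte_mul_pinfty//; apply: le_lt_trans finV.
apply: (@le_trans _ _ (\int[mu]_(y in `[c, +oo[) `|(V y)%:E|)%E).
  rewrite le_eqVlt; apply/orP; left; apply/eqP; apply: eq_integral => y.
  rewrite inE/= in_itv/= andbT => cy; rewrite /= ger0_norm// V_ge0//.
  exact: lt_le_trans cy.
apply: ge0_subset_integral => //; first exact: measurableT_comp.
by move=> y/=; rewrite !in_itv/= !andbT; apply: le_trans; rewrite le_max lexx.
Qed.

End Mean_passage_integral.

(** * Regular paths *)

Section Regular_paths.
Context (R : realType).

Definition regular_path (z : R -> R) :=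
  (forall t, 0 <= t -> z @ at_right t --> z t) /\
  (forall t, 0 < t -> cvg (z @ at_left t)) /\
  (forall t, 0 < t -> lim (z @ at_left t) <= z t).

Lemma right_continuous_lt (z : R -> R) (b s : R) : z @ at_right s --> z s -> z s < b ->
  exists2 e, 0 < e & forall v, s <= v -> v < s + e -> z v < b.
Proof.
move=> rc zs; have : \forall x \near s^'+, z x < b by exact: (cvgr_lt (z s)).
rewrite near_withinE => /nbhs_ballP[e /= e0 he]; exists e => // v sv vse.
have [<-//|vs] := eqVneq s v; have {}sv : s < v by rewrite lt_neqAle vs.
by apply: he => //; rewrite /ball/= ltr0_norm ?subr_lt0//; lra.
Qed.

Lemma right_continuous_gt (z : R -> R) (b s : R) : z @ at_right s --> z s -> b < z s ->
  exists2 e, 0 < e & forall v, s <= v -> v < s + e -> b < z v.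
Proof.
move=> rc zs; have [e e0 he] : exists2 e, 0 < e & forall v, s <= v -> v < s + e -> - z v < - b.
  apply: (@right_continuous_lt (fun v => - z v)); last by rewrite ltrN2.
  exact: cvgN.
by exists e => // v sv ve; have := he v sv ve; rewrite ltrN2.
Qed.

Lemma rat_itvP (a c : R) : a < c -> exists q : rat, a < ratr q < c.
Proof.
by move=> ac; have [q] := rat_in_itvoo ac; rewrite in_itv/= => h; exists q.
Qed.

Variables (z : R -> R) (b : R).
Local Notation tau := (first_below z b).

Lemma first_below_ge0 : (0 <= tau)%E.
Proof. by apply: le_ereal_inf_tmp => _ [s [s0 _] <-]; rewrite lee_fin. Qed.

Lemma first_below_le s : 0 <= s -> z s < b -> (tau <= s%:E)%E.
Proof. by move=> s0 zs; apply: ereal_inf_lbound; exists s. Qed.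

Lemma before_first_below s : 0 <= s -> (s%:E < tau)%E -> b <= z s.
Proof. by move=> s0; apply: contraTT; rewrite -ltNge -leNgt => zs; exact: first_below_le. Qed.

Lemma first_below_ltP t : reflect (exists s, [/\ 0 <= s, s < t & z s < b]) (tau < t%:E)%E.
Proof.
apply: (iffP idP) => [/ereal_inf_lt[_ [s [s0 zs] <-]]|[s [s0 st zs]]].
  by rewrite lte_fin => st; exists s.
by apply: le_lt_trans (first_below_le s0 zs) _; rewrite lte_fin.
Qed.

Hypothesis zreg : regular_path z.

Lemma below_right_open s : 0 <= s -> z s < b ->
  exists2 e, 0 < e & forall v, s <= v -> v < s + e -> z v < b.
Proof. by move=> s0; apply: right_continuous_lt; case: zreg => + _; exact. Qed.

(** By right continuity a value below b persists for a while, so a rational time witnesses it. This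
    is what makes passage times measurable. *)
Lemma first_below_lt_ratP t :
  reflect (exists q : rat, [/\ 0 <= ratr q :> R, ratr q < t & z (ratr q) < b]) (tau < t%:E)%E.
Proof.
apply: (iffP (first_below_ltP t)) => [[s [s0 st zs]]|[q [q0 qt zq]]]; last by exists (ratr q).
have [e e0 he] := below_right_open s0 zs.
have [q /andP[sq qe]] : exists q : rat, s < ratr q < Num.min t (s + e).
  by apply: rat_itvP; rewrite lt_min st ltrDl.
move: qe; rewrite lt_min => /andP[qt qe]; exists q; split => //.
- exact: le_trans (ltW sq).
- exact: he (ltW sq) qe.
Qed.

Hypothesis z0 : b <= z 0.

(** A value above b would persist beyond [tau] by right continuity. A value below b is excluded
    since the left limit is at least b and jumps go upward; at time 0 the initial condition takes
    over. *)
Lemma first_below_attained t : tau = t%:E -> z t = b.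
Proof.
move=> taut; have t0 : 0 <= t by rewrite -lee_fin -taut first_below_ge0.
apply/eqP; rewrite eq_le; apply/andP; split.
  rewrite leNgt; apply/negP => zt.
  have [e e0 he] := right_continuous_gt (zreg.1 t t0) zt.
  have /first_below_ltP[s [s0 st zs]] : (tau < (t + e)%:E)%E by rewrite taut lte_fin ltrDl.
  have ts : t <= s by rewrite -lee_fin -taut first_below_le.
  by have := he s ts st; rewrite ltNge (ltW zs).
have [->//|tn0] := eqVneq t 0; have {}t0 : 0 < t by rewrite lt_neqAle eq_sym tn0.
apply: le_trans (zreg.2.2 t t0); apply: limr_ge; first exact: zreg.2.1.
near=> s; apply: before_first_below; first by near: s; apply: nbhs_left_ge.
by rewrite taut lte_fin; near: s; exact: nbhs_left_lt.
Unshelve. all: by end_near. Qed.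

Lemma le_first_below_ge s : 0 <= s -> (s%:E <= tau)%E -> b <= z s.
Proof.
move=> s0; rewrite le_eqVlt => /predU1P[st|]; last exact: before_first_below.
by rewrite (first_below_attained (esym st)).
Qed.

End Regular_paths.

(** * Spectrally positive processes *)

Section Right_approximation.
Context (R : realType).

(** The least multiple of 1 / n.+1 that is strictly above r, for r >= 0; strictness is what the
    filter [at_right] demands. *)
Definition right_approx (n : nat) (r : R) : R := (Num.truncn (n.+1%:R * r)).+1%:R / n.+1%:R.

Lemma right_approx_gt n r : r < right_approx n r.
Proof. by rewrite ltr_pdivlMr ?ltr0n// mulrC truncnS_gt. Qed.

Lemma right_approx_le n r : 0 <= r -> right_approx n r <= r + n.+1%:R^-1.
Proof.
move=> r0; rewrite ler_pdivrMr ?ltr0n// mulrDl mulVf ?pnatr_eq0//.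
rewrite -natr1 lerD2r mulrC truncn_le mulr_ge0//.
Qed.

Lemma right_approx_cvg r : 0 <= r -> right_approx n r @[n --> \oo] --> r.
Proof.
move=> r0; apply: (@squeeze_cvgr _ _ _ _ (fun=> r) (fun n => r + n.+1%:R^-1)).
- by apply: nearW => n; rewrite ltW ?right_approx_gt// right_approx_le.
- exact: cvg_cst.
- rewrite -[X in _ --> X]addr0; apply: cvgD; first exact: cvg_cst.
  exact: cvg_harmonic.
Qed.

Lemma right_approx_cvg_comp (z : R -> R) r : 0 <= r -> z @ at_right r --> z r ->
  z (right_approx n r) @[n --> \oo] --> z r.
Proof.
move=> r0 /cvg_at_rightP; apply; split; last exact: right_approx_cvg.
by move=> n; exact: right_approx_gt.
Qed.

Lemma measurable_fun_nat_index d (T : measurableType d) d' (T' : measurableType d')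
    (k : T -> nat) (h : nat -> T -> T') :
  (forall n, measurable [set x | k x = n]) -> (forall n, measurable_fun setT (h n)) ->
  measurable_fun setT (fun x => h (k x) x).
Proof.
move=> mk mh _ B mB; rewrite setTI.
have -> : (fun x => h (k x) x) @^-1` B = \bigcup_n ([set x | k x = n] `&` h n @^-1` B).
  apply/seteqP; split => x /=; first by move=> Bx; exists (k x).
  by case=> n _ [<-].
apply: bigcupT_measurable => n; apply: measurableI; first exact: mk.
by rewrite -[_ @^-1` _]setTI; exact: mh.
Qed.

Lemma measurable_truncn_eq d (T : measurableType d) (f : T -> R) n :
  measurable_fun setT f -> measurable [set x | Num.truncn (f x) = n].
Proof.
move=> mf.
have le_ m : measurable [set x | (Num.truncn (f x) <= m)%N].
  have -> : [set x | (Num.truncn (f x) <= m)%N] = f @^-1` `]-oo, m.+1%:R[.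
    by apply/seteqP; split => x /=; rewrite in_itv/= truncn_le_nat.
  by rewrite -[_ @^-1` _]setTI; exact: mf.
case: n => [|n].
  by have := le_ 0%N; congr measurable; apply/seteqP; split => x /=; rewrite leqn0 => /eqP.
have := measurableD (le_ n.+1) (le_ n); congr measurable.
apply/seteqP; split => x /=.
  by move=> [h1 /negP]; rewrite -ltnNge => h2; apply/eqP; rewrite eqn_leq h1 h2.
by move=> ->; rewrite leqnn ltnn.
Qed.

End Right_approximation.

Section Levy_process.
Context d (T : measurableType d) (R : realType) (P : probability T R)
  (L : R -> T -> R) (Ps : R -> R).
Hypothesis HL : spec_pos_levy P L Ps.

Lemma levy_measurable t : measurable_fun setT (L t). Proof. by case: HL. Qed.
Lemma levy0 w : L 0 w = 0. Proof. by case: HL => _ []. Qed.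

Lemma levy_regular (x : R) w : regular_path (fun r => x + L r w).
Proof.
case: HL => _ [_] [rc [lc [nj _]]]; split; [|split].
- by move=> t t0; apply: cvgD; [exact: cvg_cst|exact: rc].
- by move=> t t0; apply: is_cvgD; [exact: is_cvg_cst|exact: lc].
- move=> t t0; rewrite limD; [|exact: is_cvg_cst|exact: lc].
  by rewrite lim_cst// lerD2l; exact: nj.
Qed.

Lemma levy_right_continuous w t : 0 <= t -> (fun s => L s w) @ at_right t --> L t w.
Proof. by move=> t0; case: HL => _ [_] [rc _]; exact: rc. Qed.

(** A limit of maps that read the process at countably many times only. Time is clamped because
    paths are prescribed on [0, +oo[ alone. *)
Lemma levy_joint_measurable : measurable_fun setT (fun z : R * T => L (Num.max z.1 0) z.2).
Proof.
pose h n (z : R * T) : R := L (right_approx n (Num.max z.1 0)) z.2.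
apply/measurable_EFinP; apply: (emeasurable_fun_cvg (fun n z => (h n z)%:E)).
  move=> n; apply/measurable_EFinP.
  apply: (@measurable_fun_nat_index _ _ _ _ (fun z : R * T => Num.truncn (n.+1%:R * Num.max z.1 0))
    (fun k z => L (k.+1%:R / n.+1%:R) z.2)).
    move=> k; apply: measurable_truncn_eq; apply: measurable_funM => //.
    by apply: measurable_maxr => //; exact: measurable_fst.
  by move=> k; apply: (measurableT_comp (levy_measurable _)); exact: measurable_snd.
move=> z _; apply/cvg_EFin; first exact: nearW.
apply: (@right_approx_cvg_comp _ (fun r => L r z.2)); first by rewrite le_max lexx orbT.
by apply: levy_right_continuous; rewrite le_max lexx orbT.
Qed.

(** A pi-system generating the past up to [s]. Indexing [B] by the time, not by the position,
    reduces an intersection to concatenating the lists. *)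
Definition cylinder (s : R) : set (set T) :=
  [set A | exists (ts : seq R) (B : R -> set R), [/\ forall u, u \in ts -> 0 <= u <= s,
     forall u, measurable (B u) & A = [set w | forall u, u \in ts -> B u (L u w)]]].

Lemma cylinderT s : cylinder s setT.
Proof.
exists [::], (fun=> setT); split => //.
by apply/seteqP; split.
Qed.

Lemma cylinder_setI s : setI_closed (cylinder s).
Proof.
move=> _ _ [ts [B [ts0 mB ->]]] [ts' [B' [ts'0 mB' ->]]].
exists (ts ++ ts'), (fun u => (if u \in ts then B u else setT) `&` (if u \in ts' then B' u else setT)).
split.
- by move=> u; rewrite mem_cat => /orP[]; [exact: ts0|exact: ts'0].
- by move=> u; apply: measurableI; case: ifP.
- apply/seteqP; split => w /=.
    by move=> [h1 h2] u; rewrite mem_cat => _; split; case: ifPn => // ?; [exact: h1|exact: h2].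
  move=> h; split => u uts.
    by have [] := h u; rewrite ?mem_cat uts.
  by have [] := h u; rewrite ?mem_cat uts ?orbT.
Qed.

(** The space is a parameter because the lemma serves both the given sigma-algebra and the one
    generated by increments. *)
Lemma measurable_finite_times d0 (T0 : measurableType d0) (M : R -> T0 -> R) (ts : seq R) (B : R -> set R) :
  (forall u, u \in ts -> measurable_fun setT (M u)) -> (forall u, measurable (B u)) ->
  measurable [set w | forall u, u \in ts -> B u (M u w)].
Proof.
move=> mM mB; elim: ts mM => [|t ts IH] mM.
  by rewrite [X in measurable X](_ : _ = setT)//; apply/seteqP; split.
have -> : [set w | forall u, u \in t :: ts -> B u (M u w)] =
    (M t @^-1` B t) `&` [set w | forall u, u \in ts -> B u (M u w)].
  apply/seteqP; split => w /=.
    by move=> h; split => [|u uts]; apply: h; rewrite inE ?eqxx// uts orbT.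
  by move=> [h1 h2] u; rewrite inE => /predU1P[->//|]; exact: h2.
apply: measurableI.
  by rewrite -[_ @^-1` _]setTI; apply: (mM t) => //; rewrite inE eqxx.
by apply: IH => u uts; apply: mM; rewrite inE uts orbT.
Qed.

Lemma cylinder_measurable s : cylinder s `<=` measurable.
Proof.
move=> _ [ts [B [_ mB ->]]]; apply: measurable_finite_times => // u _.
exact: levy_measurable.
Qed.

Lemma levy_increment_measurable s t : measurable_fun setT (fun w => L t w - L s w).
Proof. by apply: measurable_funB; exact: levy_measurable. Qed.

(** The hypothesis speaks of increments, a cylinder of values. Rectangles of the increments between
    the sorted times form a pi-system independent of the last increment; the values are sums of
    those increments, so the cylinder belongs to the generated sigma-algebra. *)
Lemma levy_indep_cylinder s t A C : 0 <= s -> s <= t -> cylinder s A -> measurable C ->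
  P (A `&` [set w | C (L t w - L s w)]) = (P A * P [set w | C (L t w - L s w)%R])%E.
Proof.
move=> s0 st [ts [B [ts0 mB ->]]] mC.
have mI (C' : set R) a b : measurable C' -> measurable [set w | C' (L b w - L a w)].
  by move=> mC'; rewrite -[[set w | _]]setTI; exact: levy_increment_measurable.
pose us := sort <=%R ts; pose n := size us.
(* The default value [t] of [nth] serves as the last time: [tm n.+1 = s], [tm n.+2 = t], and later
   increments are trivial. *)
pose l := 0 :: rcons us s; pose tm i := nth t l i.
have us0 u : u \in us -> 0 <= u <= s by rewrite mem_sort; exact: ts0.
have lst : {in l, forall u, u <= t}.
  move=> u; rewrite inE mem_rcons inE => /or3P[/eqP->|/eqP->|/us0/andP[_ us_]] //.
  - exact: le_trans st.
  - exact: le_trans st.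
have l_sorted : sorted <=%R l.
  have ss : sorted <=%R us by apply: sort_sorted; exact: le_total.
  have p0 : path <=%R 0 us.
    rewrite path_sortedE ?ss ?andbT; last exact: le_trans.
    by apply/allP => u /us0 /andP[].
  rewrite /l /= rcons_path p0/=.
  have : last 0 us \in 0 :: us by exact: mem_last.
  by rewrite inE => /predU1P[->//|/us0 /andP[]].
have tm0 : tm 0%N = 0 by [].
have tmS i : tm i <= tm i.+1.
  have [il|il] := ltnP i.+1 (size l).
    by apply: (sorted_leq_nth le_trans le_refl t l_sorted); rewrite ?inE// ltnW.
  rewrite /tm [X in _ <= X]nth_default//; have [il'|il'] := ltnP i (size l).
    by apply: lst; exact: mem_nth.
  by rewrite nth_default.
have tmn1 : tm n.+1 = s by rewrite /tm /l /= nth_rcons ltnn eqxx.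
have tmn2 : tm n.+2 = t by rewrite /tm nth_default//= size_rcons.
pose De i w := L (tm i.+1) w - L (tm i) w.
pose G := [set A | exists B : nat -> set R, (forall i, measurable (B i)) /\
  A = \bigcap_(i in `I_n) [set w | B i (De i w)]].
have rect (B' : nat -> set R) m : (forall i, measurable (B' i)) ->
    P (\bigcap_(i in `I_m) [set w | B' i (De i w)]) = (\prod_(i < m) P [set w | B' i (De i w)])%E.
  by move=> mB'; case: HL => _ [_] [_] [_] [_] [ind _]; apply: (ind m tm B') => //; rewrite tm0.
apply: (@indep_g_sigma _ _ _ P G).
- move=> _ [B' [mB' ->]]; apply: bigcap_measurableType => i _; exact: mI.
- move=> _ _ [B1 [mB1 ->]] [B2 [mB2 ->]]; exists (fun i => B1 i `&` B2 i); split.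
    by move=> i; exact: measurableI.
  by rewrite -bigcapI.
- exists (fun=> setT); split => //; by apply/seteqP; split.
- exact: mI.
- move=> _ [B' [mB' ->]].
  (* Index [n] is the increment that ends at [s], left unconstrained; index [n.+1] is the one from
     [s] to [t]. *)
  pose B2 i := if (i < n)%N then B' i else if i == n then setT else C.
  have mB2 i : measurable (B2 i) by rewrite /B2; case: ifP => // _; case: ifP.
  have := rect B2 n.+2 mB2; rewrite !big_ord_recr/=.
  have -> : \bigcap_(i in `I_n.+2) [set w | B2 i (De i w)] =
     \bigcap_(i in `I_n) [set w | B' i (De i w)] `&` [set w | C (L t w - L s w)].
    apply/seteqP; split => w /=.
      move=> h; split => [i /= ni|].
        by have := h i (leq_trans ni (leq_trans (leqnSn _) (leqnSn _))); rewrite /B2 ni.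
      by have := h n.+1 (ltnSn _); rewrite /B2 ltnNge leqnSn/= gtn_eqF// /De tmn1 tmn2.
    move=> [h1 h2] i /= ni; rewrite /B2; case: ifPn => [|ni']; first exact: h1.
    case: ifPn => // ni2; have -> : i = n.+1.
      apply/eqP; rewrite eqn_leq -ltnS ni/= ltn_neqAle eq_sym ni2/= leqNgt//.
    by rewrite /De tmn1 tmn2.
  move=> ->; rewrite rect//; congr (_ * _)%E.
    rewrite /B2 ltnn eqxx [X in (_ * P X)%E](_ : _ = setT) ?probability_setT ?mule1//.
    by apply: eq_bigr => i _; rewrite ltn_ord.
  by rewrite /B2 ltnNge leqnSn/= gtn_eqF// /De tmn1 tmn2.
pose TG := g_sigma_algebraType G.
have mDe i : (i < n)%N -> measurable_fun setT (De i : TG -> R).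
  move=> ni _ C' mC'; rewrite setTI; apply: sub_sigma_algebra.
  exists (fun j => if j == i then C' else setT); split; first by move=> j; case: ifP.
  apply/seteqP; split => w /=; first by move=> h j jn; case: ifPn => // /eqP ->.
  by move=> /(_ i ni); rewrite eqxx.
have mL j : (j <= n)%N -> measurable_fun setT (L (tm j) : TG -> R).
  elim: j => [_|j IH jn].
    by rewrite tm0; apply: (@eq_measurable_fun _ _ TG R setT (cst 0)) => [w _|]; rewrite ?levy0//; exact: measurable_cst.
  apply: (@eq_measurable_fun _ _ TG R setT (fun w => L (tm j) w + De j w)) => [w _|]; first by rewrite /De addrC subrK.
  by apply: measurable_funD; [exact: IH (ltnW jn)|exact: mDe].
apply: (@measurable_finite_times _ TG L) => // u uts.
have uus : u \in us by rewrite mem_sort.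
have -> : u = tm (index u us).+1.
  by rewrite /tm /l /= nth_rcons index_mem uus nth_index.
by apply: mL; rewrite index_mem.
Qed.

Lemma levy_stationary (g : R -> \bar R) s t : 0 <= s -> 0 <= t ->
  measurable_fun setT g -> (forall y, 0 <= g y)%E ->
  (\int[P]_w g (L (s + t)%R w - L s w)%R = \int[P]_w g (L t w))%E.
Proof.
move=> s0 t0 mg g0; case: HL => _ [_] [_] [_] [_] [_] [st _].
have mD := levy_increment_measurable s (s + t); have mt := levy_measurable t.
transitivity (\int[pushforward P (fun w => L (s + t) w - L s w)%R]_y g y)%E.
  by rewrite ge0_integral_pushforward.
transitivity (\int[pushforward P (L t)]_y g y)%E; last by rewrite ge0_integral_pushforward.
by apply: eq_measure_integral => A mA _; exact: st.
Qed.

Definition past_measurable (s : R) (X : T -> R) :=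
  measurable_fun setT (X : g_sigma_algebraType (cylinder s) -> R).

Lemma levy_past_measurable u s : 0 <= u <= s -> past_measurable s (L u).
Proof.
move=> us _ B mB; rewrite setTI; apply: sub_sigma_algebra.
exists [:: u], (fun=> B); split => //.
  by move=> v; rewrite inE => /eqP ->.
by apply/seteqP; split => w /=; [move=> h v; rewrite inE => /eqP -> |apply; rewrite inE].
Qed.

Lemma cylinder_sigma_measurable s : <<s cylinder s >> `<=` measurable.
Proof. by apply: smallest_sub; [exact: sigma_algebra_measurable|exact: cylinder_measurable]. Qed.

Lemma past_measurableW s X : past_measurable s X -> measurable_fun setT X.
Proof.
move=> mX _ B mB; apply: cylinder_sigma_measurable.
exact: mX.
Qed.

(** The Markov property in tested form: a weight from the past factors out of the expectation of a
    later increment. *)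
Lemma levy_indep_integral s t (X : T -> R) (g : R -> \bar R) : 0 <= s -> 0 <= t ->
  past_measurable s X -> (forall w, 0 <= X w) -> measurable_fun setT g -> (forall y, 0 <= g y)%E ->
  (\int[P]_w ((X w)%:E * g (L (s + t)%R w - L s w)%R) = \int[P]_w (X w)%:E * \int[P]_w g (L t w))%E.
Proof.
move=> s0 t0 mX X0 mg g0.
(* Viewing the identity as a map into the past sigma-algebra makes every past-measurable variable a
   function of one random element. *)
pose U : T -> g_sigma_algebraType (cylinder s) := id.
have mU : measurable_fun setT U.
  by move=> _ A mA; rewrite setTI; exact: (@cylinder_sigma_measurable s A mA).
pose F (z : g_sigma_algebraType (cylinder s) * R) := ((X z.1)%:E * g z.2)%E.
have mF : measurable_fun setT F.
  apply: emeasurable_funM; last exact: (measurableT_comp mg measurable_snd).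
  by apply/measurable_EFinP; exact: (measurableT_comp mX measurable_fst).
have st : s <= s + t by rewrite lerDl.
have := @indep_integral _ _ _ P _ _ _ _ U _ mU (levy_increment_measurable s (s + t)) _ F mF _.
move=> ->; first last.
- by move=> z; rewrite /F mule_ge0// lee_fin.
- move=> A C mA mC.
  apply: (@indep_g_sigma _ _ _ P (cylinder s)) => //.
  + exact: cylinder_measurable.
  + exact: cylinder_setI.
  + exact: cylinderT.
  + by rewrite -[_ @^-1` _]setTI; exact: levy_increment_measurable.
  + by move=> A' cA'; exact: levy_indep_cylinder.
have mgL : measurable_fun setT (fun w => g (L (s + t) w - L s w)).
  exact: (measurableT_comp mg (levy_increment_measurable _ _)).
rewrite /F/=; under eq_integral => w _ do rewrite ge0_integralZl ?lee_fin// levy_stationary//.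
rewrite ge0_integralZr//.
- by apply/measurable_EFinP; exact: past_measurableW mX.
- by move=> w _; rewrite lee_fin.
- by apply: integral_ge0.
Qed.

End Levy_process.

(** * Exponential moments at every time *)

Section Levy_exponent.
Context d (T : measurableType d) (R : realType) (P : probability T R)
  (L : R -> T -> R) (Ps : R -> R).
Hypothesis HL : spec_pos_levy P L Ps.
Variable q : R.
Hypothesis q0 : 0 <= q.

Let e (y : R) : \bar R := (expR (- (q * y)))%:E.
Let me_ : measurable_fun setT e.
Proof.
apply/measurable_EFinP; apply: measurableT_comp => //; apply: measurableT_comp => //.
Qed.
Let e0 y : (0 <= e y)%E. Proof. by rewrite lee_fin expR_ge0. Qed.
Let phi t : \bar R := (\int[P]_w e (L t w))%E.

Let phi_ge0 t : (0 <= phi t)%E. Proof. exact: integral_ge0. Qed.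

Let me_L t : measurable_fun setT (fun w => e (L t w)).
Proof. exact: (measurableT_comp me_ (levy_measurable HL t)). Qed.

Lemma past_measurable_exp (s u : R) : 0 <= u <= s ->
  past_measurable L s (fun w => expR (- (q * L u w))).
Proof.
move=> us; have := levy_past_measurable (L := L) us; rewrite /past_measurable => mL.
by apply: measurableT_comp => //; apply: measurableT_comp => //; exact: measurable_funM.
Qed.

Let phiD s t : 0 <= s -> 0 <= t -> phi (s + t) = (phi s * phi t)%E.
Proof.
move=> s0 t0; rewrite /phi.
rewrite -(levy_indep_integral HL s0 t0 (X := fun w => expR (- (q * L s w))))//.
- apply: eq_integral => w _; rewrite /e -EFinM -expRD; congr (expR _)%:E; ring.
- by apply: past_measurable_exp; rewrite s0 lexx.
Qed.

Let phi1 : phi 1 = (expR (Ps q))%:E.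
Proof. by case: HL => _ [_] [_] [_] [_] [_] [_ H]; exact: H. Qed.

Let phi0 : phi 0 = 1%E.
Proof.
rewrite /phi (eq_integral (cst 1%E)); first by rewrite integral_cst//= mul1e probability_setT.
by move=> w _; rewrite /e (levy0 HL) mulr0 oppr0 expR0.
Qed.

Let phi_nat n : phi n%:R = (expR (n%:R * Ps q))%:E.
Proof.
elim: n => [|n IH]; first by rewrite phi0 mul0r expR0.
by rewrite -natr1 phiD// IH phi1 -EFinM -expRD; congr (expR _)%:E; ring.
Qed.

(** The product phi(t) phi(N - t) = phi(N) is finite and positive, so neither factor is 0 or +oo,
    with 0 times +oo being 0. *)
Let phi_fin t : 0 <= t -> exists2 r, 0 < r & phi t = r%:E.
Proof.
move=> t0; pose N := Num.bound t.
have tN : 0 <= N%:R - t by rewrite subr_ge0 ltW// archi_boundP.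
have := phi_nat N; rewrite -[N%:R](subrKC t) phiD//.
have := phi_ge0 t; have := phi_ge0 (N%:R - t).
case: (phi t) => [r| |] //; case: (phi _) => [r'| |] //.
- rewrite !lee_fin => r'0 r0 [rE]; exists r => //.
  rewrite lt_neqAle r0 andbT; apply/eqP => r00.
  by move: rE; rewrite -r00 mul0r => /esym/eqP; rewrite gt_eqF// expR_gt0.
- rewrite lee_fin => _ r0; move: r0; rewrite le_eqVlt => /predU1P[<-|r0].
    by rewrite mul0e => -[] /esym/eqP; rewrite gt_eqF// expR_gt0.
  by rewrite gt0_muley.
- rewrite lee_fin => r0 _; move: r0; rewrite le_eqVlt => /predU1P[<-|r0].
    by rewrite mule0 => -[] /esym/eqP; rewrite gt_eqF// expR_gt0.
  by rewrite gt0_mulye.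
Qed.

Let phi_rat (k n : nat) : phi (k%:R / n.+1%:R) = (expR (k%:R / n.+1%:R * Ps q))%:E.
Proof.
have h0 : 0 <= k%:R / n.+1%:R :> R by rewrite divr_ge0.
have [r r0 rE] := phi_fin h0.
have H m : phi (m%:R * (k%:R / n.+1%:R)) = (r ^+ m)%:E.
  elim: m => [|m IH]; first by rewrite mul0r phi0 expr0.
  rewrite -natr1 mulrDl mul1r phiD ?mulr_ge0// IH rE -EFinM exprSr//.
have := H n.+1; rewrite mulrCA mulfV ?pnatr_eq0// mulr1 phi_nat => -[rk].
rewrite rE; congr EFin; apply/eqP.
have : r ^+ n.+1 == (expR (k%:R / n.+1%:R * Ps q)) ^+ n.+1.
  rewrite -rk -expRM_natl; apply/eqP; congr expR; field.
  by rewrite addrC natr1 pnatr_eq0.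
by rewrite eqrXn2 ?ltW ?expR_gt0.
Qed.

Let phi_le t : 0 <= t -> (phi t <= (expR (t * Ps q))%:E)%E.
Proof.
move=> t0.
have c1 : (expR (right_approx n t * Ps q))%:E @[n --> \oo] --> (expR (t * Ps q))%:E.
  apply/cvg_EFin; first exact: nearW.
  apply: continuous_cvg; first exact: continuous_expR.
  by apply: cvgMl; exact: right_approx_cvg.
rewrite -(cvg_limn_einf_sup c1).1.
have -> : phi t = (\int[P]_w limn_einf (fun n => e (L (right_approx n t) w)))%E.
  apply: eq_integral => w _; apply/esym.
  have c2 : e (L (right_approx n t) w) @[n --> \oo] --> e (L t w).
    apply/cvg_EFin; first exact: nearW.
    apply: continuous_cvg; first exact: continuous_expR.
    apply: cvgN; apply: cvgMr.
    by apply: (@right_approx_cvg_comp _ (fun r => L r w)) => //; exact: (levy_right_continuous HL).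
  by rewrite (cvg_limn_einf_sup c2).1.
apply: (@le_trans _ _ (limn_einf (fun n => phi (right_approx n t)))).
  by apply: fatou.
by under eq_fun do rewrite phi_rat.
Qed.

(** Multiplicativity settles nonnegative rational times, and Fatou along rationals from the right
    gives the upper bound. The same bound at N - t, together with phi(t) phi(N - t) = phi(N), forces
    equality. *)
Lemma levy_exponent t : 0 <= t ->
  (\int[P]_w (expR (- (q * L t w)))%:E = (expR (t * Ps q))%:E)%E.
Proof.
move=> t0; apply/eqP; rewrite eq_le phi_le//=.
pose N := Num.bound t.
have tN : 0 <= N%:R - t by rewrite subr_ge0 ltW// archi_boundP.
have [r r0 rE] := phi_fin t0; have [r' r'0 r'E] := phi_fin tN.
rewrite -/(phi t) rE lee_fin.
have := phi_le tN; rewrite r'E lee_fin => h.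
have := phi_nat N; rewrite -[in phi _](subrKC t N%:R) phiD// rE r'E -EFinM => -[E].
have E2 : expR (N%:R * Ps q) = expR (t * Ps q) * expR ((N%:R - t) * Ps q).
  by rewrite -expRD; congr expR; ring.
rewrite -(ler_pM2r (expR_gt0 ((N%:R - t) * Ps q))) -E2 -E.
by rewrite ler_pM2l.
Qed.

End Levy_exponent.

(** * First passage along grids *)

Lemma emeasurable_from_lt d (T : measurableType d) (R : realType) (f : T -> \bar R) :
  (forall r : R, measurable [set w | (f w < r%:E)%E]) -> measurable_fun setT f.
Proof.
move=> mf; apply: (measurability _ (@ErealGenInftyO.measurableE R)).
move=> _ [_ [r ->] <-]; rewrite setTI.
by have := mf r; congr measurable; apply/seteqP; split => w /=; rewrite in_itv.
Qed.

Lemma measurable_fun_natr d (T : measurableType d) (R : realType) (f : T -> bool) :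
  measurable_fun setT f -> measurable_fun setT (fun w => (f w)%:R : R).
Proof.
move=> mf; apply: (eq_measurable_fun (fun w => if f w then 1 else 0 : R)).
  by move=> w _; case: (f w).
exact: measurable_fun_ifT.
Qed.

Lemma measurable_fun_all d (T : measurableType d) (I : eqType) (p : I -> T -> bool) (r : seq I) :
  (forall i, i \in r -> measurable_fun setT (p i)) ->
  measurable_fun setT (fun w => all (p ^~ w) r).
Proof.
elim: r => [_|i r IH mp] /=; first exact: measurable_cst.
apply: measurable_and; first by apply: mp; rewrite inE eqxx.
by apply: IH => j jr; apply: mp; rewrite inE jr orbT.
Qed.

(* Only the first index satisfying [p] contributes. *)
Lemma sum_first_hit (R : realType) (p : nat -> bool) (F : nat -> R) (N : nat) :
  \sum_(k < N) (p k && all (fun j => ~~ p j) (iota 0 k))%:R * F k =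
  if has p (iota 0 N) then F (find p (iota 0 N)) else 0.
Proof.
elim: N => [|N IH]; first by rewrite big_ord0.
have -> : iota 0 N.+1 = iota 0 N ++ [:: N] by rewrite -[N.+1]addn1 iotaD add0n.
rewrite big_ord_recr/= IH has_cat find_cat/= orbF.
have -> : all (fun j => ~~ p j) (iota 0 N) = ~~ has p (iota 0 N) by exact: all_predC.
case: ifPn => [hp|hp]; first by rewrite andbF mul0r addr0.
rewrite size_iota andbT add0r; case: (p N); last by rewrite mul0r.
by rewrite mul1r addn0.
Qed.

Lemma right_continuous_cvg_seq (R : realType) (z : R -> R) (t : R) (u : nat -> R) :
  z @ at_right t --> z t -> (\forall n \near \oo, t <= u n) -> u n @[n --> \oo] --> t ->
  z (u n) @[n --> \oo] --> z t.
Proof.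
move=> rc tu ut; apply/cvgrPdist_lt => e e0.
have := rc; move=> /cvgrPdist_lt/(_ e e0); rewrite near_withinE => /nbhs_ballP[r r0 hr].
have ut' : \forall n \near \oo, `|t - u n| < r by move/cvgrPdist_lt : ut; exact.
near=> n; have tun : t <= u n by near: n.
have [->|tn] := eqVneq (u n) t; first by rewrite subrr normr0.
apply: hr; last by rewrite lt_neqAle eq_sym tn.
by rewrite /ball/=; near: n.
Unshelve. all: by end_near. Qed.

Section Grid_passage.
Context (R : realType) (z : R -> R) (b s t : R).
Hypotheses (zreg : regular_path z) (z0 : b <= z 0) (s0 : 0 <= s) (st : s < t).
Local Notation tau := (first_below z b).

Definition grid (s t : R) (n k : nat) : R := s + (t - s) * (k%:R / n.+1%:R).

Definition grid_hit n := has (fun k => z (grid s t n k) < b) (iota 0 n.+2).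
(** Without a hit, [find] returns [n.+2] and the value lies beyond [t]; hence the guard [grid_hit]
    in the statements about it. *)
Definition grid_time n := grid s t n (find (fun k => z (grid s t n k) < b) (iota 0 n.+2)).

Lemma grid_itv n k : (k < n.+2)%N -> s <= grid s t n k <= t.
Proof.
move=> kn; rewrite /grid lerDl mulr_ge0 ?subr_ge0 ?(ltW st)//=.
rewrite -lerBrDl ler_piMr ?subr_ge0 ?(ltW st)// ler_pdivrMr ?ltr0n// mul1r ler_nat.
exact: kn.
Qed.

Lemma grid_time_itv n : grid_hit n -> s <= grid_time n <= t.
Proof.
by move=> hn; apply: grid_itv; rewrite -[X in (_ < X)%N](size_iota 0) -has_find.
Qed.

Lemma grid_time_below n : grid_hit n -> z (grid_time n) < b.
Proof.
by move=> hn; have := nth_find 0%N hn; rewrite nth_iota ?add0n// -[X in (_ < X)%N](size_iota 0) -has_find.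
Qed.

Lemma grid_no_hit n : (t%:E <= tau)%E -> grid_hit n = false.
Proof.
move=> tt; apply/negP => hn; have := grid_time_below hn.
have /andP[sg gt_] := grid_time_itv hn; rewrite ltNge => /negP; apply.
apply: le_first_below_ge => //; first exact: (le_trans s0).
by apply: le_trans tt; rewrite lee_fin.
Qed.

Hypothesis stau : (s%:E <= tau)%E.

(** Just after [tau] the path is below b on some interval, and every fine enough grid has a point in
    it. The first grid hit lies between [tau] and that point. *)
Lemma grid_time_cvg : (tau < t%:E)%E ->
  (\forall n \near \oo, grid_hit n) /\ (\forall n \near \oo, fine tau <= grid_time n) /\
  grid_time n @[n --> \oo] --> fine tau.
Proof.
move=> taut.
have tauf : tau = (fine tau)%:E.
  by rewrite fineK// ge0_fin_numE ?first_below_ge0// (lt_le_trans taut)// leey.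
set th := fine tau in tauf *.
have sth : s <= th by rewrite -lee_fin -tauf.
have tht : th < t by rewrite -lte_fin -tauf.
have key e : 0 < e -> \forall n \near \oo, grid_hit n /\ th <= grid_time n <= th + e.
  (* The second bound keeps the grid point found below inside the horizon [t]. *)
  move=> e0; pose e' := Num.min e (t - th).
  have e'0 : 0 < e' by rewrite lt_min e0 subr_gt0.
  have /first_below_ltP[u [u0 ue zu]] : (tau < (th + e')%:E)%E by rewrite tauf lte_fin ltrDl.
  have thu : th <= u by rewrite -lee_fin -tauf first_below_le.
  have [d d0 hd] := below_right_open zreg u0 zu.
  pose m := Num.min d (th + e' - u).
  have m0 : 0 < m by rewrite lt_min d0 subr_gt0.
  near=> n.
  have step : (t - s) / n.+1%:R < m.
    rewrite ltr_pdivrMr ?ltr0n// mulrC -ltr_pdivrMr//.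
    apply: (@lt_trans _ _ n%:R); last by rewrite ltr_nat.
    by near: n; exact: nbhs_infty_gtr.
  (* [c] is the position of [u] in units of the mesh, and [k] is the first grid index strictly after
     it. *)
  pose c := (u - s) / (t - s) * n.+1%:R; pose k := (Num.truncn c).+1.
  have ts0 : 0 < t - s by rewrite subr_gt0.
  have c0 : 0 <= c by rewrite mulr_ge0// divr_ge0 ?subr_ge0 ?(le_trans sth)// ltW.
  have us : u = s + (t - s) * (c / n.+1%:R).
    by rewrite /c mulfK ?pnatr_eq0// mulrC divfK ?gt_eqF// subrKC.
  have ug : u < grid s t n k.
    by rewrite {1}us /grid ltrD2l ltr_pM2l// ltr_pM2r ?invr_gt0 ?ltr0n// truncnS_gt.
  have gu : grid s t n k < u + m.
    apply: le_lt_trans (_ : u + (t - s) / n.+1%:R < _); last by rewrite ltrD2l.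
    rewrite {1}us /grid -addrA lerD2l -mulrDr ler_pM2l// -[X in _ <= _ + X]mul1r -mulrDl.
    by rewrite ler_pM2r ?invr_gt0 ?ltr0n// /k -natr1 lerD2r truncn_le.
  have zk : z (grid s t n k) < b.
    apply: hd; first exact: ltW.
    by apply: (lt_le_trans gu); rewrite lerD2l ge_min lexx.
  have gth : grid s t n k < th + e'.
    by apply: (lt_le_trans gu); rewrite -lerBrDl ge_min lexx orbT.
  have kn : (k < n.+2)%N.
    have : grid s t n k < t by apply: (lt_le_trans gth); rewrite -lerBrDl ge_min lexx orbT.
    rewrite /grid -ltrBrDl -[X in _ < X]mulr1 ltr_pM2l// ltr_pdivrMr ?ltr0n// mul1r ltr_nat.
    by move=> kn; exact: (ltn_trans kn).
  have hn : grid_hit n by apply/hasP; exists k; rewrite ?mem_iota//.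
  split => //; apply/andP; split.
    rewrite -lee_fin -tauf; apply: first_below_le; last exact: grid_time_below.
    by have /andP[sg _] := grid_time_itv hn; exact: (le_trans s0).
  apply: (@le_trans _ _ (grid s t n k)); last first.
    by apply: (le_trans (ltW gth)); rewrite lerD2l ge_min lexx.
  rewrite /grid_time /grid lerD2l ler_pM2l// ler_pM2r ?invr_gt0 ?ltr0n// ler_nat.
  rewrite leqNgt; apply/negP => kf.
  by have := before_find 0%N kf; rewrite nth_iota// add0n zk.
split; [|split].
- by apply: filterS (key 1 ltr01) => n [].
- by apply: filterS (key 1 ltr01) => n [_ /andP[]].
- apply/cvgrPdist_le => e e0; apply: filterS (key e e0) => n [_ /andP[h1 h2]].
  by rewrite distrC ger0_norm ?subr_ge0// lerBlDl.
Unshelve. all: by end_near. Qed.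

End Grid_passage.

Section Passage.
Context d (T : measurableType d) (R : realType) (P : probability T R)
  (L : R -> T -> R) (Ps : R -> R).
Hypotheses (HL : spec_pos_levy P L Ps) (Ps_gt0 : forall q, 0 < q -> 0 < Ps q).

Lemma past_measurable_le s t X : s <= t -> past_measurable L s X -> past_measurable L t X.
Proof.
move=> st mX _ B mB; rewrite setTI; have := mX measurableT B mB; rewrite setTI.
apply: sub_smallest2r; first exact: smallest_sigma_algebra.
move=> _ [ts [B' [ts0 mB' ->]]]; exists ts, B'; split => // u uts.
by have /andP[-> us] := ts0 u uts; exact: le_trans st.
Qed.

Lemma past_measurable_natr s (f : T -> bool) :
  measurable_fun setT (f : g_sigma_algebraType (cylinder L s) -> bool) ->
  past_measurable L s (fun w => (f w)%:R).
Proof. exact: measurable_fun_natr. Qed.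

Lemma past_measurableM s X Y : past_measurable L s X -> past_measurable L s Y ->
  past_measurable L s (fun w => X w * Y w).
Proof. exact: measurable_funM. Qed.

Variables (x b : R).
Hypothesis bx : b <= x.

Local Notation Z := (fun r w => x + L r w).
Local Notation tau := (fun w => first_below (fun r => x + L r w) b).

Lemma level_reg w : regular_path (fun r => x + L r w). Proof. exact: levy_regular HL x w. Qed.

Lemma level0 w : b <= x + L 0 w. Proof. by rewrite (levy0 HL) addr0. Qed.

Lemma level_past u s : 0 <= u <= s -> past_measurable L s (Z u).
Proof.
move=> us; apply: measurable_funD; first exact: measurable_cst.
exact: levy_past_measurable us.
Qed.

Lemma passage_lt_past t : <<s cylinder L t >> [set w | (tau w < t%:E)%E].
Proof.
pose TG := g_sigma_algebraType (cylinder L t).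
pose F (q : rat) : set TG := if (0 <= ratr q :> R) && (ratr q < t) then [set w | Z (ratr q) w < b] else set0.
have -> : [set w | (tau w < t%:E)%E] = \bigcup_q F q.
  apply/seteqP; split => w /=.
    move=> /(first_below_lt_ratP _ (level_reg w))[q [q0 qt zq]]; exists q => //.
    by rewrite /F q0 qt.
  case=> q _; rewrite /F; case: ifPn => // /andP[q0 qt] zq.
  by apply/(first_below_lt_ratP _ (level_reg w)); exists q.
apply: (@bigcupT_measurable_rat _ TG) => q; rewrite /F; case: ifPn => [/andP[q0 qt]|_]; last exact: measurable0.
have mZ : measurable_fun setT (Z (ratr q) : TG -> R) by apply: level_past; rewrite q0 ltW.
have := mZ measurableT `]-oo, b[%classic (measurable_itv _); rewrite setTI.
by congr measurable; apply/seteqP; split => w /=; rewrite in_itv.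
Qed.

Lemma measurable_passage : measurable_fun setT tau.
Proof.
apply: emeasurable_from_lt => r; apply: (cylinder_sigma_measurable HL (s := r)).
exact: (@passage_lt_past r).
Qed.

Variables (s M : R) (xi : T -> R).
Hypotheses (s0 : 0 <= s) (mxi : past_measurable L s xi) (xi0 : forall w, 0 <= xi w)
  (xiM : forall w, xi w <= M) (xi_tau : forall w, xi w != 0 -> (s%:E <= tau w)%E).

Let mxi' : measurable_fun setT xi. Proof. exact (past_measurableW HL mxi). Qed.
Let mZ t : measurable_fun setT (Z t).
Proof. by apply: measurable_funD => //; exact: levy_measurable HL t. Qed.
Let mexpZ p t : measurable_fun setT (fun w => expR (- (p * Z t w))).
Proof.
apply: measurableT_comp => //; apply: measurableT_comp => //.
by apply: measurable_funM => //; exact: mZ.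
Qed.

Lemma level_exponent p t : 0 < p -> 0 <= t ->
  (\int[P]_w (expR (- (p * Z t w)))%:E = (expR (- (p * x) + t * Ps p))%:E)%E.
Proof.
move=> p0 t0; rewrite expRD EFinM -(levy_exponent HL (ltW p0) t0) -ge0_integralZl_EFin ?expR_ge0//.
- by apply: eq_integral => w _; rewrite -EFinM -expRD; congr (expR _)%:E; ring.
- apply/measurable_EFinP; apply: measurableT_comp => //; apply: measurableT_comp => //.
  by apply: measurable_funM => //; exact: levy_measurable HL t.
Qed.

(** The martingale property of exp (- p Z_t - t Ps p), tested against a weight from the past at
    [g]. *)
Lemma past_exponent p g t Y : 0 < p -> 0 <= g -> g <= t -> past_measurable L g Y ->
  (forall w, 0 <= Y w) ->
  (\int[P]_w (Y w * expR (- (p * Z t w)))%:E =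
   \int[P]_w (Y w * expR (- (p * Z g w) + (t - g) * Ps p))%:E)%E.
Proof.
move=> p0 g0 gt_ mY Y0.
have tg0 : 0 <= t - g by rewrite subr_ge0.
pose X w := Y w * expR (- (p * Z g w)).
have mX : past_measurable L g X.
  apply: past_measurableM => //.
  apply: measurableT_comp => //; apply: measurableT_comp => //; apply: measurable_funM => //.
  by apply: level_past; rewrite g0 lexx.
have X0 w : 0 <= X w by rewrite !mulr_ge0 ?expR_ge0.
pose e (y : R) := (expR (- (p * y)))%:E.
have me : measurable_fun setT e.
  by apply/measurable_EFinP; apply: measurableT_comp => //; apply: measurableT_comp.
have e0 y : (0 <= e y)%E by rewrite lee_fin expR_ge0.
have := levy_indep_integral HL g0 tg0 mX X0 me e0.
rewrite [g + (t - g)]addrC subrK /e (levy_exponent HL (ltW p0) tg0) => H.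
transitivity (\int[P]_w ((X w)%:E * (expR (- (p * (L t w - L g w))))%:E))%E.
  apply: eq_integral => w _; rewrite -EFinM /X/=; congr EFin.
  by rewrite -[RHS]mulrA -expRD; congr (_ * expR _); ring.
rewrite H -ge0_integralZr//; last 2 first.
- by apply/measurable_EFinP; exact (past_measurableW HL mX).
- by move=> w _; rewrite lee_fin.
by apply: eq_integral => w _; rewrite -EFinM /X/=; congr EFin; rewrite -[LHS]mulrA -expRD.
Qed.

Section Grid.
Variable t : R.
Hypothesis st : s < t.

Let D n k w : bool := (Z (grid s t n k) w < b) && all (fun j => ~~ (Z (grid s t n j) w < b)) (iota 0 k).

Let D_past n k : (k < n.+2)%N -> past_measurable L (grid s t n k) (fun w => (D n k w)%:R).
Proof.
move=> kn; apply: past_measurable_natr; apply: measurable_and.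
  apply: measurable_fun_ltr; last exact: measurable_cst.
  by apply: level_past; have /andP[sg _] := grid_itv st kn; rewrite (le_trans s0 sg) lexx.
apply: measurable_fun_all => j; rewrite mem_iota add0n => /= jk; apply: measurable_neg.
apply: measurable_fun_ltr; last exact: measurable_cst.
have jn : (j < n.+2)%N by exact: ltn_trans kn.
apply: level_past; have /andP[sg _] := grid_itv st jn; rewrite (le_trans s0 sg)/=.
by rewrite /grid lerD2l ler_pM2l ?subr_gt0// ler_pM2r ?invr_gt0 ?ltr0n// ler_nat ltnW.
Qed.

Let D_measurable n k : (k < n.+2)%N -> measurable_fun setT (fun w => (D n k w)%:R : R).
Proof. by move=> kn; exact (past_measurableW HL (D_past kn)). Qed.

Lemma grid_step p n k : 0 < p -> (k < n.+2)%N ->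
  (\int[P]_w (xi w * (D n k w)%:R * expR (- (p * Z t w)))%:E =
   \int[P]_w (xi w * (D n k w)%:R * expR (- (p * Z (grid s t n k) w) + (t - grid s t n k) * Ps p))%:E)%E.
Proof.
move=> p0 kn; have /andP[sg gt_] := grid_itv st kn.
apply: past_exponent => //; first exact: le_trans sg.
- by apply: past_measurableM; [exact: past_measurable_le mxi|exact: D_past].
- by move=> w; rewrite mulr_ge0.
Qed.

Let hitE n w (F : nat -> R) : \sum_(k < n.+2) (D n k w)%:R * F k =
  if grid_hit (fun r => Z r w) b s t n then F (find (fun k => Z (grid s t n k) w < b) (iota 0 n.+2)) else 0.
Proof. exact: sum_first_hit. Qed.

(** On the event that the grid detects a passage, this is the prediction of exp (- p Z_t) at the
    first grid hit; otherwise it is 0. *)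
Let X n p w := \sum_(k < n.+2) (D n k w)%:R *
  expR (- (p * Z (grid s t n k) w) + (t - grid s t n k) * Ps p).

Let XE n p w : X n p w = if grid_hit (fun r => Z r w) b s t n
  then expR (- (p * Z (grid_time (fun r => Z r w) b s t n) w) +
    (t - grid_time (fun r => Z r w) b s t n) * Ps p) else 0.
Proof. exact: (hitE n w (fun k => expR (- (p * Z (grid s t n k) w) + (t - grid s t n k) * Ps p))). Qed.

Let X_measurable n p : measurable_fun setT (X n p).
Proof.
apply: measurable_sum => k; apply: measurable_funM; first exact: D_measurable.
apply: measurableT_comp => //; apply: measurable_funD => //; apply: measurableT_comp => //.
by apply: measurable_funM => //; exact: mZ.
Qed.

Let X_ge0 n p w : 0 <= X n p w.
Proof. by apply: sumr_ge0 => k _; rewrite mulr_ge0 ?expR_ge0. Qed.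

Let hitR n w : R := (grid_hit (fun r => Z r w) b s t n)%:R.

Let hitR_measurable n : measurable_fun setT (hitR n).
Proof.
rewrite (_ : hitR n = fun w => \sum_(k < n.+2) (D n k w)%:R * 1); last first.
  by apply/funext => w; rewrite (hitE n w (fun=> 1)) /hitR; case: ifP.
by apply: measurable_sum => k; apply: measurable_funM; [exact: D_measurable|exact: measurable_cst].
Qed.

Lemma grid_total p n : 0 < p ->
  (\int[P]_w (xi w * X n p w)%:E = \int[P]_w (xi w * hitR n w * expR (- (p * Z t w)))%:E)%E.
Proof.
move=> p0.
transitivity (\int[P]_w \sum_(k < n.+2) (xi w * (D n k w)%:R * expR (- (p * Z (grid s t n k) w) + (t - grid s t n k) * Ps p))%:E)%E.
  by apply: eq_integral => w _; rewrite sumEFin mulr_sumr; congr EFin; apply: eq_bigr => k _; rewrite mulrA.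
rewrite ge0_integral_sum//; last 2 first.
- move=> k; apply/measurable_EFinP; apply: measurable_funM.
    by apply: measurable_funM => //; exact: D_measurable.
  apply: measurableT_comp => //; apply: measurable_funD => //; apply: measurableT_comp => //.
  by apply: measurable_funM => //; exact: mZ.
- by move=> k w _; rewrite lee_fin !mulr_ge0 ?expR_ge0.
under eq_bigr => k _ do rewrite -grid_step//.
rewrite -ge0_integral_sum//; last 2 first.
- move=> k; apply/measurable_EFinP; apply: measurable_funM => //.
  by apply: measurable_funM => //; exact: D_measurable.
- by move=> k w _; rewrite lee_fin !mulr_ge0 ?expR_ge0.
apply: eq_integral => w _; rewrite sumEFin; congr EFin.
rewrite -mulr_suml -mulr_sumr; congr (_ * _ * _).
by have := hitE n w (fun=> 1); under eq_bigr do rewrite mulr1; move=> ->; rewrite /hitR; case: ifP.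
Qed.

Let tau_measurable : measurable_fun setT tau. Proof. exact: measurable_passage. Qed.

Let itau (w : T) : R := ((tau w < t%:E)%E)%:R.

Let itau_measurable : measurable_fun setT itau.
Proof.
apply: measurable_fun_natr; apply: measurable_fun_lte => //; exact: measurable_cst.
Qed.

Let Zlim q w : R :=
  if (tau w < t%:E)%E then expR (- (q * b) + (t - fine (tau w)) * Ps q) else 0.

Lemma passage_value_measurable q : measurable_fun setT (Zlim q).
Proof.
apply: measurable_fun_ifT => //; first by apply: measurable_fun_lte => //; exact: measurable_cst.
apply: measurableT_comp => //; apply: measurable_funD; first exact: measurable_cst.
apply: measurable_funM; last exact: measurable_cst.
apply: measurable_funB; first exact: measurable_cst.
by apply: (measurableT_comp (fine_measurable measurableT)).
Qed.

Let Zlim_ge0 q w : 0 <= Zlim q w.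
Proof. by rewrite /Zlim; case: ifP => // _; exact: expR_ge0. Qed.

Hypothesis M0 : 0 <= M.

Let dom_integrable p : 0 < p -> P.-integrable setT (fun w => (M * expR (- (p * Z t w)))%:E).
Proof.
move=> p0; apply/integrableP; split; first by apply/measurable_EFinP; apply: measurable_funM.
under eq_integral do rewrite gee0_abs ?lee_fin ?mulr_ge0 ?expR_ge0// EFinM.
rewrite ge0_integralZl_EFin//; last exact/measurable_EFinP.
by rewrite level_exponent// ?(le_trans s0 (ltW st))// -EFinM ltry.
Qed.

Let X_cvg q w : xi w != 0 -> X n q w @[n --> \oo] --> Zlim q w.
Proof.
move=> /xi_tau stau; have [taut|ttau] := boolP (tau w < t%:E)%E; last first.
  rewrite /Zlim (negbTE ttau); apply: cvg_near_cst; apply: nearW => n.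
  by rewrite XE (grid_no_hit (level_reg w) (level0 w))// leNgt.
have [h1 [h2 h3]] := grid_time_cvg (level_reg w) s0 st stau taut.
have tauf : tau w = (fine (tau w))%:E.
  by rewrite fineK// ge0_fin_numE ?first_below_ge0// (lt_le_trans taut)// leey.
rewrite /Zlim taut.
apply: (@cvg_trans _ ((fun n => expR (- (q * Z (grid_time (fun r => Z r w) b s t n) w) +
   (t - grid_time (fun r => Z r w) b s t n) * Ps q)) @ \oo)).
  apply: near_eq_cvg; near=> n; rewrite XE ifT//.
  by near: n.
apply: continuous_cvg; first exact: continuous_expR.
apply: cvgD.
  apply: cvgN; apply: cvgMr.
  rewrite -[X in _ --> X](first_below_attained (level_reg w) (level0 w) tauf).
  apply: (@right_continuous_cvg_seq _ (fun r => Z r w)) => //.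
  by apply: (level_reg w).1; rewrite -lee_fin -tauf first_below_ge0.
by apply: cvgMl; apply: cvgB => //; exact: cvg_cst.
Unshelve. all: by end_near. Qed.

Let hit_cvg w : xi w != 0 -> hitR n w @[n --> \oo] --> itau w.
Proof.
move=> /xi_tau stau; have [taut|ttau] := boolP (tau w < t%:E)%E; last first.
  rewrite /itau (negbTE ttau); apply: cvg_near_cst; apply: nearW => n.
  by rewrite /hitR (grid_no_hit (level_reg w) (level0 w))// leNgt.
have [h1 _] := grid_time_cvg (level_reg w) s0 st stau taut.
rewrite /itau taut; apply: cvg_near_cst; near=> n.
have hn : grid_hit (fun r => Z r w) b s t n by near: n.
by rewrite /hitR hn.
Unshelve. all: by end_near. Qed.

(** Squaring doubles the exponent, so the second moment at q is controlled by the first moment at 2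
    q, which [grid_total] bounds uniformly in n. No integrable dominating function is evident, as
    [Z] may lie far below b at a grid hit. *)
Let X_sqr q n w : 0 < q ->
  (xi w * X n q w) ^+ 2 <= M * expR (2 * (t - s) * Ps q) * (xi w * X n (2 * q) w).
Proof.
move=> q0; rewrite !XE; case: ifPn => hn; last by rewrite !mulr0 expr0n.
set g := grid_time _ _ _ _ _.
have /andP[sg gt_] := grid_time_itv st hn; rewrite -/g in sg gt_.
set v := x + L g w.
have -> : (xi w * expR (- (q * v) + (t - g) * Ps q)) ^+ 2 =
    xi w * (xi w * expR (- (2 * q * v) + 2 * (t - g) * Ps q)).
  rewrite exprMn -expRM_natl expr2 -mulrA; congr (_ * (_ * expR _)); ring.
rewrite -[leRHS]mulrA; apply: ler_pM => //; first by rewrite mulr_ge0 ?expR_ge0.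
rewrite mulrCA ler_wpM2l// -expRD ler_expR.
have P1 := Ps_gt0 q0; have P2 : 0 < Ps (2 * q) by apply: Ps_gt0; rewrite mulr_gt0.
have : 2 * (t - g) * Ps q <= 2 * (t - s) * Ps q by rewrite ler_pM2r//; lra.
have : 0 <= (t - g) * Ps (2 * q) by rewrite mulr_ge0 ?subr_ge0// ltW.
by lra.
Qed.

Let hitR01 n w : 0 <= hitR n w <= 1.
Proof. by rewrite /hitR; case: (grid_hit _ _ _ _ _); rewrite ?lexx ?ler01. Qed.

Let t0 : 0 <= t. Proof. exact: (le_trans s0 (ltW st)). Qed.

Let hit_int_le p n : 0 < p -> (\int[P]_w (xi w * hitR n w * expR (- (p * Z t w)))%:E <=
  (M * expR (- (p * x) + t * Ps p))%:E)%E.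
Proof.
move=> p0; rewrite EFinM -level_exponent// -ge0_integralZl_EFin//; last exact/measurable_EFinP.
apply: ge0_le_integral => //.
- by move=> w _; rewrite lee_fin !mulr_ge0 ?expR_ge0//; have /andP[] := hitR01 n w.
- by apply/measurable_EFinP; do 2 apply: measurable_funM => //.
- by apply: measurable_funeM; exact/measurable_EFinP.
- move=> w _; rewrite -EFinM lee_fin ler_wpM2r ?expR_ge0//.
  have /andP[h0 h1] := hitR01 n w.
  by rewrite -[leRHS]mulr1 ler_pM.
Qed.

(** Optional stopping at [tau], where [Z] equals b: the limit of [grid_total], by uniform
    integrability on the left and domination on the right. *)
Lemma passage_identity q : 0 < q ->
  (\int[P]_w (xi w * Zlim q w)%:E = \int[P]_w (xi w * itau w * expR (- (q * Z t w)))%:E)%E.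
Proof.
move=> q0; set l := (X in _ = X).
have itau01 w : 0 <= itau w <= 1 by rewrite /itau; case: (_ < _)%E; rewrite ?lexx ?ler01.
have lf : l \is a fin_num.
  rewrite ge0_fin_numE; last first.
    by apply: integral_ge0 => w _; rewrite lee_fin !mulr_ge0 ?expR_ge0.
  have /integrableP[_] := dom_integrable q0; apply: le_lt_trans.
  apply: ge0_le_integral => //.
  - by move=> w _; rewrite lee_fin !mulr_ge0 ?expR_ge0.
  - by apply/measurable_EFinP; do 2 apply: measurable_funM => //.
  - by apply: measurableT_comp => //; apply/measurable_EFinP; apply: measurable_funM.
  - move=> w _; rewrite gee0_abs ?lee_fin ?mulr_ge0 ?expR_ge0//.
    rewrite ler_wpM2r ?expR_ge0//; have /andP[h0 h1] := itau01 w.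
    by rewrite -[leRHS]mulr1 ler_pM.
rewrite -(fineK lf).
(* The constant of [X_sqr] times the bound of [hit_int_le] at 2 q. *)
pose C := M * expR (2 * (t - s) * Ps q) * (M * expR (- (2 * q * x) + t * Ps (2 * q))).
apply: (@cvg_integral_L2 _ _ _ P (fun n w => xi w * X n q w) _ C).
- by move=> n; apply: measurable_funM.
- by apply: measurable_funM => //; exact: passage_value_measurable.
- by move=> n w; rewrite mulr_ge0.
- by move=> w; rewrite mulr_ge0.
- move=> w; have [->|xiw] := eqVneq (xi w) 0.
    by rewrite mul0r; apply: cvg_near_cst; apply: nearW => n; rewrite mul0r.
  by apply: cvgMr; exact: X_cvg.
- move=> n; have q20 : 0 < 2 * q by rewrite mulr_gt0.
  apply: (@le_trans _ _ (\int[P]_w ((M * expR (2 * (t - s) * Ps q))%:E * (xi w * X n (2 * q) w)%:E))%E).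
    apply: ge0_le_integral => //.
    + by move=> w _; rewrite lee_fin sqr_ge0.
    + by apply/measurable_EFinP; apply: measurable_funX; apply: measurable_funM.
    + by apply: measurable_funeM; apply/measurable_EFinP; apply: measurable_funM.
    + by move=> w _; rewrite -EFinM lee_fin; exact: X_sqr.
  rewrite ge0_integralZl_EFin//; last 3 first.
  + by move=> w _; rewrite lee_fin mulr_ge0.
  + by apply/measurable_EFinP; apply: measurable_funM.
  + by rewrite mulr_ge0 ?expR_ge0.
  rewrite grid_total// /C [X in (_ <= X)%E]EFinM lee_wpmul2l ?lee_fin ?mulr_ge0 ?expR_ge0//.
  exact: hit_int_le.
- rewrite fineK//; under eq_fun do rewrite grid_total//.
  apply: (cvg_integral_dominated measurableT _ _ (dom_integrable q0)).
  + by move=> n; apply/measurable_EFinP; do 2 apply: measurable_funM => //.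
  + move=> w _; apply/cvg_EFin; first exact: nearW.
    rewrite /comp/=; apply: cvgMl; have [->|xiw] := eqVneq (xi w) 0.
      by rewrite mul0r; apply: cvg_near_cst; apply: nearW => n; rewrite mul0r.
    by apply: cvgMr; exact: hit_cvg.
  + move=> n w _; have /andP[h0 h1] := hitR01 n w.
    rewrite gee0_abs lee_fin ?mulr_ge0 ?expR_ge0//.
    by rewrite ler_wpM2r ?expR_ge0// -[leRHS]mulr1 ler_pM.
Qed.

End Grid.

End Passage.

(** * Potential measures *)

Section Integral_tools.
Context (R : realType).
Local Notation mu := (@lebesgue_measure R).

Lemma ge0_integral_shift (f : R -> \bar R) (c : R) :
  measurable_fun setT f -> (forall y, 0 <= f y)%E ->
  (\int[mu]_y f (y - c)%R = \int[mu]_y f y)%E.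
Proof.
move=> mf f0; have ms : measurable_fun setT (fun y : R => y - c : measurableTypeR R).
  exact: measurable_funB.
transitivity (\int[pushforward mu (fun y : R => y - c : measurableTypeR R)%R]_y f y)%E.
  by rewrite ge0_integral_pushforward.
apply: eq_measure_integral => A mA _; apply/esym/lebesgue_measure_unique => //= _ [[a b]] _ <-.
rewrite /pushforward /=.
have -> : (fun y : R => y - c) @^-1` `]a, b] = `]a + c, b + c]%classic.
  by apply/seteqP; split => y /=; rewrite !in_itv/= ltrBrDr lerBlDr.
rewrite !lebesgue_measure_itv/= !lte_fin ltrD2r; case: ifP => // _.
by rewrite -!EFinB; congr EFin; ring.
Qed.

Lemma integral_expR (a t c : R) : 0 < c -> a <= t ->
  (\int[mu]_(v in `[a, t]) (expR ((v - a) * c))%:E = ((expR ((t - a) * c) - 1) / c)%:E)%E.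
Proof.
move=> c0; rewrite le_eqVlt => /predU1P[<-|at_].
  by rewrite set_itv1 integral_set1 subrr mul0r expR0 subrr mul0r.
pose F (v : R) := c^-1 * expR ((v - a) * c).
have dF v : is_derive v (1 : R) F (expR ((v - a) * c)).
  rewrite /F.
  have d1 : is_derive v (1 : R) (fun v : R => (v - a) * c) c.
    by apply: is_derive_eq; rewrite ?scaler0 ?addr0 ?subr0 /GRing.scale/= mulr1 add0r.
  have d2 : is_derive v (1 : R) (expR \o (fun v : R => (v - a) * c)) (expR ((v - a) * c) * c).
    exact: is_derive1_comp.
  apply: is_derive_eq; rewrite /GRing.scale/=.
  by rewrite mulrCA mulVf ?gt_eqF// mulr1 //.
have cF v : {for v, continuous F}.
  by apply/differentiable_continuous/derivable1_diffP; have [] := dF v.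
rewrite (@continuous_FTC2 _ _ F)//.
- by rewrite /F subrr mul0r expR0 mulr1 -EFinB; congr EFin; field; rewrite gt_eqF.
- apply: continuous_subspaceT => v; apply: continuous_comp; last exact: continuous_expR.
  by apply: cvgMl; apply: cvgB; [exact: cvg_id|exact: cvg_cst].
- split.
  + by move=> v _; have [] := dF v.
  + by apply: cvg_at_right_filter; exact: cF.
  + by apply: cvg_at_left_filter; exact: cF.
- by move=> v _; rewrite derive1E; have [_ ->] := dF v.
Qed.

Lemma tonelli_on d (T : measurableType d) (P : probability T R) (D : set R) (F : R * T -> \bar R) :
  measurable D -> measurable_fun setT F -> (forall z, 0 <= F z)%E ->
  (\int[mu]_(v in D) \int[P]_w F (v, w) = \int[P]_w \int[mu]_(v in D) F (v, w))%E.
Proof.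
move=> mD mF F0.
pose G (z : R * T) := ((\1_D z.1)%:E * F z)%E.
have mG : measurable_fun setT G.
  apply: emeasurable_funM => //; apply/measurable_EFinP.
  exact: (measurableT_comp (measurable_indic mD) measurable_fst).
have G0 z : (0 <= G z)%E by rewrite mule_ge0// lee_fin.
transitivity (\int[mu]_v \int[P]_w G (v, w))%E.
  rewrite [LHS]integral_mkcond; apply: eq_integral => v _; rewrite patchE /G/= indicE.
  case: ifPn => vD; first by apply: eq_integral => w _; rewrite mul1e.
  by under eq_integral do rewrite mul0e; rewrite integral0.
rewrite fubini_tonelli//; apply: eq_integral => w _; rewrite [RHS]integral_mkcond.
by apply: eq_integral => v _; rewrite patchE /G/= indicE; case: ifPn => vD; rewrite ?mul1e ?mul0e.
Qed.

Lemma measurable_tonelli_F d (T : measurableType d) (P : probability T R) (F : R * T -> \bar R) :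
  measurable_fun setT F -> (forall z, 0 <= F z)%E ->
  measurable_fun setT (fun v => \int[P]_w F (v, w))%E.
Proof. by move=> mF F0; exact: measurable_fun_fubini_tonelli_F. Qed.

End Integral_tools.

(** * Almost sure finiteness of the passage time *)

Section Passage_finite.
Context d (T : measurableType d) (R : realType) (P : probability T R)
  (L : R -> T -> R) (Ps : R -> R).
Hypotheses (HL : spec_pos_levy P L Ps) (Ps_gt0 : forall q, 0 < q -> 0 < Ps q).
Variables (x b : R).
Hypothesis bx : b <= x.
Local Notation tau w := (first_below (fun r => x + L r w) b).

Lemma passage_lt_measurable (e : \bar R) : measurable [set w | (tau w < e)%E].
Proof.
rewrite -[X in measurable X]setTI; apply: emeasurable_fun_infty_o => //.
exact: measurable_passage HL _ _.
Qed.

Lemma levelZ_measurable p t : measurable_fun setT (fun w => expR (- (p * (x + L t w)))).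
Proof.
apply: measurableT_comp => //; apply: measurableT_comp => //; apply: measurable_funM => //.
by apply: measurable_funD => //; exact (levy_measurable HL t).
Qed.

(** Split the mean of exp (- q Z_t) at [tau]: if the passage has not occurred before t then Z_t >=
    b; otherwise the stopping identity applies, with at most time t left after the passage. *)
Lemma passage_estimate q t : 0 < q -> 0 < t ->
  expR (- (q * x) + t * Ps q) <=
  expR (- (q * b)) + expR (- (q * b) + t * Ps q) * fine (P [set w | (tau w < +oo)%E]).
Proof.
move=> q0 t0.
pose xi (w : T) : R := 1.
have mxi : past_measurable L 0 xi by exact: measurable_cst.
have H := passage_identity HL Ps_gt0 bx (lexx 0) mxi (fun=> ler01) (fun=> lexx 1)
  (fun w _ => first_below_ge0 _ _) t0 ler01 q0.
have mi : measurable_fun setT (fun w => ((tau w < t%:E)%E)%:R : R).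
  apply: measurable_fun_natr; apply: measurable_fun_lte; last exact: measurable_cst.
  exact: measurable_passage HL _ _.
have mj : measurable_fun setT (fun w => ((t%:E <= tau w)%E)%:R : R).
  apply: measurable_fun_natr; apply: measurable_fun_lee; first exact: measurable_cst.
  exact: measurable_passage HL _ _.
have mq := levelZ_measurable q t.
have E : ((expR (- (q * x) + t * Ps q))%:E =
   \int[P]_w (((t%:E <= tau w)%E)%:R * expR (- (q * (x + L t w))))%:E +
   \int[P]_w (((tau w < t%:E)%E)%:R * expR (- (q * (x + L t w))))%:E)%E.
  rewrite -(level_exponent HL x q0 (ltW t0)) -ge0_integralD//; last 2 first.
  - by apply/measurable_EFinP; exact: measurable_funM.
  - by apply/measurable_EFinP; exact: measurable_funM.
  apply: eq_integral => w _; rewrite -EFinD -mulrDl; congr EFin.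
  by rewrite leNgt; case: (_ < _)%E; rewrite /= ?add0r ?addr0 mul1r.
have Pf : P [set w | (tau w < +oo)%E] \is a fin_num by rewrite fin_num_measure//; exact: passage_lt_measurable.
rewrite -lee_fin E EFinD EFinM fineK//; apply: leeD.
  apply: (@le_trans _ _ (\int[P]_w (cst (expR (- (q * b)))%:E w))%E); last first.
    by rewrite integral_cst//= probability_setT mule1.
  apply: ge0_le_integral => //.
  - by apply/measurable_EFinP; exact: measurable_funM.
  - move=> w _; rewrite lee_fin; case: (boolP (t%:E <= tau w)%E) => [tt|_]; last by rewrite mul0r expR_ge0.
    rewrite mul1r ler_expR lerN2 ler_pM2l//.
    apply: (le_first_below_ge (level_reg HL x w) (level0 HL bx w) (ltW t0) tt).
move: H; rewrite /xi; under eq_integral do rewrite mul1r.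
under [in X in _ = X -> _]eq_integral do rewrite mul1r.
move=> <-.
rewrite -[P _]mul1e -[X in (_ * (X * _) )%E](mule1).
apply: (@le_trans _ _ (\int[P]_w ((expR (- (q * b) + t * Ps q))%:E * (\1_[set w | (tau w < +oo)%E] w)%:E))%E).
  apply: ge0_le_integral => //.
  - by move=> w _; rewrite lee_fin; case: ifP => // _; rewrite expR_ge0.
  - by apply/measurable_EFinP; exact: (passage_value_measurable HL).
  - apply: measurable_funeM; apply/measurable_EFinP; apply: measurable_indic.
    exact: passage_lt_measurable.
  - move=> w _; rewrite -EFinM lee_fin; case: ifPn => [tt|_]; last by rewrite mulr_ge0 ?expR_ge0.
    rewrite indicE mem_set/= ?(lt_le_trans tt) ?leey// mulr1 ler_expR lerD2l.
    rewrite ler_pM2r ?Ps_gt0// lerBlDr lerDl fine_ge0// first_below_ge0//.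
rewrite ge0_integralZl_EFin ?expR_ge0//; last first.
  by apply/measurable_EFinP; apply: measurable_indic; exact: passage_lt_measurable.
by rewrite integral_indic ?setIT ?mule1 ?mul1e//; exact: passage_lt_measurable.
Qed.

(** Dividing the estimate by exp (- q b + t Ps q) gives exp (- q (x - b)) <= exp (- t Ps q) + a,
    with [a] the probability. Positivity of [Ps] lets t grow, and then q tends to 0. *)
Lemma passage_finite : P [set w | (tau w < +oo)%E] = 1%E.
Proof.
have Pf : P [set w | (tau w < +oo)%E] \is a fin_num by rewrite fin_num_measure//; exact: passage_lt_measurable.
have m1 := passage_lt_measurable +oo%E.
apply/eqP; rewrite eq_le (probability_le1 P m1)/=.
rewrite -(fineK Pf) lee_fin; set a := fine _.
rewrite leNgt; apply/negP => a1.
(* q makes the left side at least 1 - e and t makes exp (- t Ps q) less than e, so 1 - a < 2 e, a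
   contradiction. The 1 in the denominator of q covers x = b. *)
pose e := (1 - a) / 2; have e0 : 0 < e by rewrite divr_gt0 ?subr_gt0.
have xb : 0 <= x - b by rewrite subr_ge0.
pose q := e / (x - b + 1); have q0 : 0 < q by rewrite divr_gt0// ltr_wpDl.
have P0 := Ps_gt0 q0.
pose t := (2 / e) / Ps q; have t0 : 0 < t by rewrite /t divr_gt0// divr_gt0.
have := passage_estimate q0 t0; rewrite -/a.
have -> : expR (- (q * x) + t * Ps q) = expR (- (q * b) + t * Ps q) * expR (- (q * (x - b))).
  by rewrite -expRD; congr expR; ring.
have -> : expR (- (q * b)) = expR (- (q * b) + t * Ps q) * expR (- (t * Ps q)).
  by rewrite -expRD; congr expR; ring.
rewrite -mulrDr ler_pM2l ?expR_gt0// => h.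
have h1 := expR_ge1Dx (- (q * (x - b))).
have tP : t * Ps q = 2 / e by rewrite /t divfK// gt_eqF.
have h2 : expR (- (t * Ps q)) < e.
  rewrite tP expRN; apply: (@le_lt_trans _ _ (1 + 2 / e)^-1).
    by rewrite lef_pV2 ?posrE ?expR_gt0 ?expR_ge1Dx// addr_gt0// divr_gt0.
  have -> : (1 + 2 / e)^-1 = e / (e + 2) by field; rewrite !gt_eqF//; lra.
  by rewrite ltr_pdivrMr; [nra|lra].
have h3 : q * (x - b) <= e.
  rewrite /q mulrAC ler_pdivrMr; last by lra.
  by have := ltW e0; nra.
have : e + e = 1 - a by rewrite /e; field.
by lra.
Qed.

End Passage_finite.

Section Potential.
Context d (T : measurableType d) (R : realType) (P : probability T R)
  (L : R -> T -> R) (Ps : R -> R).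
Hypotheses (HL : spec_pos_levy P L Ps) (Ps_gt0 : forall q, 0 < q -> 0 < Ps q).
Variables (x b : R).
Hypothesis bx : b <= x.
Local Notation tau w := (first_below (fun r => x + L r w) b).
Variables (s M : R) (xi : T -> R).
Hypotheses (s0 : 0 <= s) (mxi : past_measurable L s xi) (xi0 : forall w, 0 <= xi w)
  (xiM : forall w, xi w <= M) (xi_tau : forall w, xi w != 0 -> (s%:E <= tau w)%E) (M0 : 0 <= M).

Local Notation mu := (@lebesgue_measure R).

Let mxi' : measurable_fun setT xi. Proof. exact (past_measurableW HL mxi). Qed.
Let mtau : measurable_fun setT (fun w => tau w).
Proof. exact: (measurable_passage HL). Qed.

(* Times are clamped to [[0, +oo[], the domain on which the process is prescribed. *)
Definition alive_weight (q : R) (z : R * T) : R :=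
  xi z.2 * ((z.1%:E <= tau z.2)%E)%:R * expR (- (q * (x + L (Num.max z.1 0) z.2))).

Definition exit_weight (q : R) (z : R * T) : R :=
  xi z.2 * (if (tau z.2 < z.1%:E)%E then expR (- (q * b) + (z.1 - fine (tau z.2)) * Ps q) else 0).

Let mtau2 : measurable_fun setT (fun z : R * T => tau z.2).
Proof. exact: (measurableT_comp mtau measurable_snd). Qed.

Lemma alive_measurable : measurable_fun setT (fun z : R * T => ((z.1%:E <= tau z.2)%E)%:R : R).
Proof.
apply: measurable_fun_natr; apply: measurable_fun_lee => //.
by apply/measurable_EFinP; exact: measurable_fst.
Qed.

Lemma clamped_level_measurable : measurable_fun setT (fun z : R * T => x + L (Num.max z.1 0) z.2).
Proof. by apply: measurable_funD => //; exact (levy_joint_measurable HL). Qed.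

Lemma alive_weight_measurable q : measurable_fun setT (alive_weight q).
Proof.
apply: measurable_funM.
  by apply: measurable_funM alive_measurable; exact: (measurableT_comp mxi' measurable_snd).
apply: measurableT_comp => //; apply: measurableT_comp => //; apply: measurable_funM => //.
exact: clamped_level_measurable.
Qed.

Lemma exit_weight_measurable q : measurable_fun setT (exit_weight q).
Proof.
apply: measurable_funM; first exact: (measurableT_comp mxi' measurable_snd).
apply: measurable_fun_ifT => //.
  by apply: measurable_fun_lte => //; apply/measurable_EFinP; exact: measurable_fst.
apply: measurableT_comp => //; apply: measurable_funD => //.
apply: measurable_funM => //; apply: measurable_funB; first exact: measurable_fst.
exact: (measurableT_comp (fine_measurable measurableT)).
Qed.

Lemma alive_weight_ge0 q z : 0 <= alive_weight q z.
Proof. by rewrite !mulr_ge0 ?expR_ge0. Qed.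

Lemma exit_weight_ge0 q z : 0 <= exit_weight q z.
Proof. by rewrite mulr_ge0//; case: ifP => // _; exact: expR_ge0. Qed.

Let u q v := (\int[P]_w (alive_weight q (v, w))%:E)%E.
Let A q v := (\int[P]_w (exit_weight q (v, w))%:E)%E.
Let K q := (\int[P]_w (xi w * expR (- (q * (x + L s w))))%:E)%E.
Let F v := (\int[P]_w (xi w * ((tau w < v%:E)%E)%:R)%:E)%E.

Let mpair (g : R * T -> R) v : measurable_fun setT g -> measurable_fun setT (fun w => (g (v, w))%:E).
Proof.
by move=> mg; apply/measurable_EFinP; apply: (measurableT_comp mg); exact: pair1_measurable.
Qed.

Let mu_u q : measurable_fun setT (u q).
Proof.
apply: (@measurable_tonelli_F _ _ _ P (fun z => (alive_weight q z)%:E)).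
- by apply/measurable_EFinP; exact: alive_weight_measurable.
- by move=> z; rewrite lee_fin alive_weight_ge0.
Qed.

Let mu_A q : measurable_fun setT (A q).
Proof.
apply: (@measurable_tonelli_F _ _ _ P (fun z => (exit_weight q z)%:E)).
- by apply/measurable_EFinP; exact: exit_weight_measurable.
- by move=> z; rewrite lee_fin exit_weight_ge0.
Qed.

Let u_ge0 q v : (0 <= u q v)%E.
Proof. by apply: integral_ge0 => w _; rewrite lee_fin alive_weight_ge0. Qed.
Let A_ge0 q v : (0 <= A q v)%E.
Proof. by apply: integral_ge0 => w _; rewrite lee_fin exit_weight_ge0. Qed.

Let alive_ge v w : 0 <= v -> (v%:E <= tau w)%E -> b <= x + L v w.
Proof. exact: (le_first_below_ge (level_reg HL x w) (level0 HL bx w)). Qed.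

Let mZ q t : measurable_fun setT (fun w => expR (- (q * (x + L t w)))).
Proof. exact: (levelZ_measurable HL). Qed.

(** The martingale property from [s] to [v], with paths that have already passed b replaced by their
    prediction at the passage. *)
Let uA q v : 0 < q -> s <= v -> (u q v + A q v = (expR ((v - s) * Ps q))%:E * K q)%E.
Proof.
move=> q0; rewrite le_eqVlt => /predU1P[<-|sv].
  rewrite subrr mul0r expR0 mul1e.
  have -> : A q s = 0%E.
    apply: integral0_eq => w _; rewrite /exit_weight/=; have [->|xiw] := eqVneq (xi w) 0.
      by rewrite mul0r.
    by rewrite ltNge xi_tau//= mulr0.
  rewrite adde0; apply: eq_integral => w _; rewrite /alive_weight/= max_l//.
  have [->|xiw] := eqVneq (xi w) 0; first by rewrite !mul0r.
  by rewrite xi_tau// mulr1.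
have v0 : 0 <= v by exact: le_trans (ltW sv).
have := passage_identity HL Ps_gt0 bx s0 mxi xi0 xiM xi_tau sv M0 q0.
rewrite -/(A q v) => ->.
have mi : measurable_fun setT (fun w => ((tau w < v%:E)%E)%:R : R).
  by apply: measurable_fun_natr; apply: measurable_fun_lte => //; exact: measurable_cst.
rewrite -ge0_integralD//; last 4 first.
- by move=> w _; rewrite lee_fin alive_weight_ge0.
- by apply: mpair; exact: alive_weight_measurable.
- by move=> w _; rewrite lee_fin !mulr_ge0 ?expR_ge0.
- by apply/measurable_EFinP; do 2 apply: measurable_funM => //.
rewrite -ge0_integralZl_EFin ?expR_ge0//; last 2 first.
- by move=> w _; rewrite lee_fin mulr_ge0 ?expR_ge0.
- by apply/measurable_EFinP; apply: measurable_funM.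
transitivity (\int[P]_w (xi w * expR (- (q * (x + L v w))))%:E)%E.
  apply: eq_integral => w _; rewrite /alive_weight/= max_l// -EFinD leNgt.
  by case: (_ < _)%E; rewrite /= ?mulr0 ?mulr1 ?mul0r ?add0r ?addr0.
rewrite (past_exponent HL x q0 s0 (ltW sv) mxi xi0); apply: eq_integral => w _.
by rewrite expRD -EFinM; congr EFin; ring.
Qed.

Let K_lty q : 0 < q -> (K q < +oo)%E.
Proof.
move=> q0; apply: (@le_lt_trans _ _ (\int[P]_w (cst (M * expR (- (q * b)))%:E w))%E).
  apply: ge0_le_integral => //.
  - by move=> w _; rewrite lee_fin mulr_ge0 ?expR_ge0.
  - by apply/measurable_EFinP; apply: measurable_funM.
  - move=> w _; rewrite lee_fin; have [->|xiw] := eqVneq (xi w) 0.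
      by rewrite mul0r mulr_ge0 ?expR_ge0.
    rewrite ler_pM ?expR_ge0// ler_expR lerN2 ler_pM2l//.
    by apply: alive_ge => //; exact: xi_tau.
by rewrite integral_cst//= probability_setT mule1 ltry.
Qed.

(** Along one path the exit weight starts at the passage time with value [xi] times exp (- q b) and
    then grows at rate Ps q; this is its integral equation. *)
Let exit_time_integral q t w : 0 < q -> s <= t -> xi w != 0 ->
  ((Ps q)%:E * \int[mu]_(v in `[s, t]) (exit_weight q (v, w))%:E +
    (expR (- (q * b)) * (xi w * ((tau w < t%:E)%E)%:R))%:E = (exit_weight q (t, w))%:E)%E.
Proof.
move=> q0 st xiw; have stau := xi_tau xiw.
have [taut|ttau] := boolP (tau w < t%:E)%E; last first.
  rewrite {2}/exit_weight/= (negbTE ttau) !mulr0 adde0 integral0_eq ?mule0//.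
  move=> v /=; rewrite in_itv/= => /andP[sv vt]; rewrite /exit_weight/= ifF ?mulr0//.
  by apply/negbTE; rewrite -leNgt; apply: le_trans (_ : t%:E <= _)%E; rewrite ?lee_fin// leNgt.
have tauf : tau w = (fine (tau w))%:E.
  by rewrite fineK// ge0_fin_numE ?first_below_ge0// (lt_le_trans taut)// leey.
rewrite {2}/exit_weight/= taut; set th := fine (tau w) in tauf *.
have sth : s <= th by rewrite -lee_fin -tauf.
have tht : th < t by rewrite -lte_fin -tauf.
pose g (v : R) := ((xi w * expR (- (q * b)))%:E * (expR ((v - th) * Ps q))%:E)%E.
have mg : measurable_fun setT g.
  apply: measurable_funeM; apply/measurable_EFinP; apply: measurableT_comp => //.
  by apply: measurable_funM => //; exact: measurable_funB.
have -> : (\int[mu]_(v in `[s, t]) (exit_weight q (v, w))%:E = \int[mu]_(v in `]th, t]) g v)%E.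
  rewrite integral_mkcond [RHS]integral_mkcond; apply: eq_integral => v _; rewrite !patchE.
  rewrite !mem_setE !in_itv/= /exit_weight/= tauf lte_fin.
  have [thv|vth] /= := ltP th v; last by case: ifP; rewrite ?mulr0.
  rewrite (le_trans sth (ltW thv))/=; case: ifP => // _.
  by rewrite /g -EFinM expRD mulrA.
rewrite integral_itv_obnd_cbnd; last exact: measurable_funTS.
have Pq := Ps_gt0 q0.
rewrite /g ge0_integralZl_EFin//; last 2 first.
- apply: measurable_funTS; apply/measurable_EFinP; apply: measurableT_comp => //.
  by apply: measurable_funM => //; exact: measurable_funB.
- by rewrite mulr_ge0 ?expR_ge0.
rewrite integral_expR ?(ltW tht)// -!EFinM -EFinD; congr EFin.
by rewrite mulr1 expRD; field; rewrite gt_eqF.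
Qed.

Let F_ge0 v : (0 <= F v)%E.
Proof. by apply: integral_ge0 => w _; rewrite lee_fin mulr_ge0. Qed.

Let mi v : measurable_fun setT (fun w => ((tau w < v%:E)%E)%:R : R).
Proof. by apply: measurable_fun_natr; apply: measurable_fun_lte => //; exact: measurable_cst. Qed.

Let exit_integral q t : 0 < q -> s <= t ->
  ((Ps q)%:E * \int[mu]_(v in `[s, t]) A q v + (expR (- (q * b)))%:E * F t = A q t)%E.
Proof.
move=> q0 st.
have mE : measurable_fun setT (fun z : R * T => (exit_weight q z)%:E).
  by apply/measurable_EFinP; exact: exit_weight_measurable.
have E0 z : (0 <= (exit_weight q z)%:E)%E by rewrite lee_fin exit_weight_ge0.
rewrite (tonelli_on P (measurable_itv `[s, t]) mE E0).
have Pq := Ps_gt0 q0.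
pose G w := (\int[mu]_(v in `[s, t]) (exit_weight q (v, w))%:E)%E.
have mG : measurable_fun setT G.
  pose H (z : R * T) := ((\1_(`[s, t]%classic) z.1)%:E * (exit_weight q z)%:E)%E.
  rewrite (_ : G = fun w => \int[mu]_v H (v, w))%E; last first.
    apply/funext => w; rewrite /G [LHS]integral_mkcond; apply: eq_integral => v _.
    by rewrite patchE /H/= indicE; case: ifP => _; rewrite ?mul1e ?mul0e.
  apply: (measurable_fun_fubini_tonelli_G (m1 := mu)).
    apply: emeasurable_funM => //; apply/measurable_EFinP.
    exact: (measurableT_comp (measurable_indic (measurable_itv `[s, t])) measurable_fst).
  by move=> z; rewrite mule_ge0.
have G0 w : (0 <= G w)%E by apply: integral_ge0.
have H1 : ((Ps q)%:E * \int[P]_w G w = \int[P]_w ((Ps q)%:E * G w))%E.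
  by rewrite ge0_integralZl_EFin// ltW.
have H2 : ((expR (- (q * b)))%:E * F t =
    \int[P]_w ((expR (- (q * b)))%:E * (xi w * ((tau w < t%:E)%E)%:R)%:E))%E.
  rewrite ge0_integralZl_EFin ?expR_ge0//.
  - by move=> w _; rewrite lee_fin mulr_ge0.
  - by apply/measurable_EFinP; exact: measurable_funM.
rewrite H1 H2.
rewrite -ge0_integralD//; last 4 first.
- by move=> w _; rewrite mule_ge0// lee_fin ltW.
- exact: measurable_funeM.
- by move=> w _; rewrite -EFinM lee_fin !mulr_ge0 ?expR_ge0.
- by apply: measurable_funeM; apply/measurable_EFinP; exact: measurable_funM.
apply: eq_integral => w _; have [xiw|xiw] := eqVneq (xi w) 0; last first.
  by rewrite -exit_time_integral.
rewrite /G /exit_weight/= xiw; under eq_integral do rewrite mul0r.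
by rewrite integral0 !mul0r !mule0 adde0.
Qed.

Let fin_of (y z : \bar R) : (0 <= y)%E -> (y <= z)%E -> (z < +oo)%E -> y \is a fin_num.
Proof. by move=> y0 yz zoo; rewrite ge0_fin_numE// (le_lt_trans yz). Qed.

(** Integrate [uA] over [s, t], multiply by Ps q and subtract [exit_integral]. All terms are first
    shown finite, so the computation takes place in the reals. *)
Lemma horizon q t : 0 < q -> s <= t ->
  ((Ps q)%:E * \int[mu]_(v in `[s, t]) u q v + K q = u q t + (expR (- (q * b)))%:E * F t)%E.
Proof.
move=> q0 st; have Pq := Ps_gt0 q0.
have K0 : (0 <= K q)%E by apply: integral_ge0 => w _; rewrite lee_fin mulr_ge0 ?expR_ge0.
have Kf : K q \is a fin_num by rewrite ge0_fin_numE// K_lty.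
have EX v : s <= v -> (u q v + A q v < +oo)%E.
  by move=> sv; rewrite uA// -(fineK Kf) -EFinM ltry.
have SUM : (\int[mu]_(v in `[s, t]) u q v + \int[mu]_(v in `[s, t]) A q v =
    ((expR ((t - s) * Ps q) - 1) / Ps q)%:E * K q)%E.
  rewrite -ge0_integralD//; last 2 first.
  - by apply: measurable_funTS; exact: mu_u.
  - by apply: measurable_funTS; exact: mu_A.
  transitivity (\int[mu]_(v in `[s, t]) (K q * (expR ((v - s) * Ps q)%R)%:E))%E.
    by apply: eq_integral => v; rewrite inE/= in_itv/= => /andP[sv _]; rewrite uA// muleC.
  rewrite ge0_integralZl//; last first.
    apply: measurable_funTS; apply/measurable_EFinP; apply: measurableT_comp => //.
    by apply: measurable_funM => //; exact: measurable_funB.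
  by rewrite integral_expR// muleC.
have IU0 : (0 <= \int[mu]_(v in `[s, t]) u q v)%E by apply: integral_ge0.
have IA0 : (0 <= \int[mu]_(v in `[s, t]) A q v)%E by apply: integral_ge0.
have SUMoo : (\int[mu]_(v in `[s, t]) u q v + \int[mu]_(v in `[s, t]) A q v < +oo)%E.
  by rewrite SUM -(fineK Kf) -EFinM ltry.
have IUf := fin_of IU0 (leeDl _ IA0) SUMoo.
have IAf := fin_of IA0 (leeDr _ IU0) SUMoo.
have uf := fin_of (u_ge0 q t) (leeDl _ (A_ge0 q t)) (EX t st).
have Af := fin_of (A_ge0 q t) (leeDr _ (u_ge0 q t)) (EX t st).
have Ff : F t \is a fin_num.
  rewrite ge0_fin_numE//; apply: (@le_lt_trans _ _ (\int[P]_w (cst M%:E w))%E); last first.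
    by rewrite integral_cst//= probability_setT mule1 ltry.
  apply: ge0_le_integral => //.
  - by move=> w _; rewrite lee_fin mulr_ge0.
  - by apply/measurable_EFinP; exact: measurable_funM.
  - move=> w _; rewrite lee_fin; case: (_ < _)%E; rewrite ?mulr1 ?mulr0//.
have E1 := uA q0 st; have E2 := exit_integral q0 st.
move: SUM E1 E2; rewrite -(fineK Kf) -(fineK IUf) -(fineK IAf) -(fineK uf) -(fineK Af) -(fineK Ff).
rewrite -!EFinM -!EFinD => -[SUM] -[E1] -[E2]; congr EFin.
set IU := fine (\int[mu]_(v in _) u q v)%E in SUM *; set IA := fine _ in SUM E2 *.
have {}SUM : Ps q * (IU + IA) = (expR ((t - s) * Ps q) - 1) * fine (K q).
  by rewrite SUM; field; rewrite gt_eqF.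
by nra.
Qed.

End Potential.

Section Potential_laplace.
Context d (T : measurableType d) (R : realType) (P : probability T R)
  (L : R -> T -> R) (Ps : R -> R).
Hypotheses (HL : spec_pos_levy P L Ps) (Ps_gt0 : forall q, 0 < q -> 0 < Ps q).
Variables (x b : R).
Hypothesis bx : b <= x.
Local Notation tau w := (first_below (fun r => x + L r w) b).
Variables (s M : R) (xi : T -> R).
Hypotheses (s0 : 0 <= s) (mxi : past_measurable L s xi) (xi0 : forall w, 0 <= xi w)
  (xiM : forall w, xi w <= M) (xi_tau : forall w, xi w != 0 -> (s%:E <= tau w)%E) (M0 : 0 <= M).

Local Notation mu := (@lebesgue_measure R).
Local Notation u q v := (\int[P]_w (alive_weight L x b xi q (v, w))%:E)%E.
Local Notation F v := (\int[P]_w (xi w * ((tau w < v%:E)%E)%:R)%:E)%E.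

Let mxi' : measurable_fun setT xi. Proof. exact (past_measurableW HL mxi). Qed.
Let mtau : measurable_fun setT (fun w => tau w).
Proof. exact: (measurable_passage HL). Qed.
Let mi (v : \bar R) : measurable_fun setT (fun w => ((tau w < v)%E)%:R : R).
Proof. by apply: measurable_fun_natr; apply: measurable_fun_lte => //; exact: measurable_cst. Qed.

Let xi_finite : (\int[P]_w (xi w * ((tau w < +oo)%E)%:R)%:E = \int[P]_w (xi w)%:E)%E.
Proof.
apply: ae_eq_integral => //.
- by apply/measurable_EFinP; exact: measurable_funM.
- by apply/measurable_EFinP.
have mt := passage_lt_measurable HL x b +oo%E.
exists (~` [set w | (tau w < +oo)%E]); split; first exact: measurableC.
  have := probability_setC P mt; rewrite (passage_finite HL Ps_gt0 bx) subee//; exact.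
move=> w /= H; apply: contra_not H => tw _; rewrite tw mulr1//.
Qed.

Let cvgF : F (s + n%:R) @[n --> \oo] --> (\int[P]_w (xi w)%:E)%E.
Proof.
rewrite -xi_finite.
apply: (@cvg_integral_dominated _ _ _ P setT _ _ (cst M%:E)) => //.
- by move=> n; apply/measurable_EFinP; exact: measurable_funM.
- move=> w _; apply: cvg_near_cst.
  have [tw|tw] := boolP (tau w < +oo)%E.
    have tf : tau w = (fine (tau w))%:E by rewrite fineK// ge0_fin_numE ?first_below_ge0.
    exists (Num.truncn (fine (tau w))).+1 => // n /= nt.
    rewrite tf lte_fin (_ : (_ < _) = true) ?tw//.
    rewrite (lt_le_trans (truncnS_gt _))// (@le_trans _ _ n%:R) ?ler_nat// lerDr//.
  by apply: nearW => n; rewrite (_ : (_ < (_ + _)%:E)%E = false) ?(negbTE tw)//; apply/negbTE; apply: contra tw => /lt_le_trans; apply; rewrite leey.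
- exact: finite_measure_integrable_cst.
- move=> n w _; rewrite gee0_abs ?lee_fin ?mulr_ge0//.
  by case: (_ < _)%E; rewrite ?mulr1 ?mulr0.
Qed.

Let cvgU q : (\int[mu]_(v in `[s, (s + n%:R)%R]) u q v)%E @[n --> \oo] -->
  (\int[mu]_(v in `[s, +oo[) u q v)%E.
Proof.
have -> : `[s, +oo[%classic = \bigcup_n `[s, s + n%:R]%classic.
  apply/seteqP; split => v /=; rewrite in_itv/=.
    rewrite andbT => sv; exists (Num.truncn (v - s)).+1 => //=.
    by rewrite in_itv/= sv/= -lerBlDl ltW// truncnS_gt.
  by move=> [n _ /=]; rewrite in_itv/= => /andP[-> _].
apply: ge0_nondecreasing_set_cvg_integral.
- move=> m n mn; rewrite subsetEset => v /=; rewrite !in_itv/= => /andP[-> vm]/=.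
  by rewrite (le_trans vm)// lerD2l ler_nat.
- by move=> i; exact: measurable_itv.
- move=> i; apply: measurable_funTS.
  apply: (@measurable_tonelli_F _ _ _ P (fun z => (alive_weight L x b xi q z)%:E)).
    by apply/measurable_EFinP; exact: (alive_weight_measurable HL x b mxi).
  by move=> z; rewrite lee_fin alive_weight_ge0.
- by move=> i v _; apply: integral_ge0 => w _; rewrite lee_fin alive_weight_ge0.
Qed.

(** Let the horizon tend to infinity. The surviving part does not have to be estimated alone: [Z] is
    at least b while alive, so the right side of [horizon] is squeezed between exp (- q b) times the
    mass already passed and exp (- q b) times the total mass. *)
Lemma potential_laplace q : 0 < q ->
  ((Ps q)%:E * \int[mu]_(v in `[s, +oo[) u q v +
    \int[P]_w (xi w * expR (- (q * (x + L s w))))%:E =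
   (expR (- (q * b)))%:E * \int[P]_w (xi w)%:E)%E.
Proof.
move=> q0; set K := (\int[P]_w (xi w * expR _)%:E)%E.
have Kf : K \is a fin_num.
  have K0 : (0 <= K)%E by apply: integral_ge0 => w _; rewrite lee_fin mulr_ge0 ?expR_ge0.
  rewrite ge0_fin_numE//; apply: (@le_lt_trans _ _ (\int[P]_w (cst (M * expR (- (q * b)))%:E w))%E).
    apply: ge0_le_integral => //.
    - by move=> w _; rewrite lee_fin mulr_ge0 ?expR_ge0.
    - by apply/measurable_EFinP; apply: measurable_funM => //; exact: (levelZ_measurable HL).
    - move=> w _; rewrite lee_fin; have [->|xiw] := eqVneq (xi w) 0.
        by rewrite mul0r mulr_ge0 ?expR_ge0.
      rewrite ler_pM ?expR_ge0// ler_expR lerN2 ler_pM2l//.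
      by apply: (le_first_below_ge (level_reg HL x w) (level0 HL bx w)) => //; exact: xi_tau.
  by rewrite integral_cst//= probability_setT mule1 ltry.
have hor : (fun n : nat => (Ps q)%:E * \int[mu]_(v in `[s, (s + n%:R)%R]) u q v + K)%E =
    (fun n : nat => u q (s + n%:R) + (expR (- (q * b)))%:E * F (s + n%:R))%E.
  apply/funext => n.
  by apply: (horizon HL Ps_gt0 bx s0 mxi xi0 xiM xi_tau M0 q0); rewrite lerDl.
have cl : (fun n : nat => (Ps q)%:E * \int[mu]_(v in `[s, (s + n%:R)%R]) u q v + K)%E @ \oo -->
    ((Ps q)%:E * \int[mu]_(v in `[s, +oo[) u q v + K)%E.
  apply: cvgeD; [by rewrite fin_num_adde_defl| |exact: cvg_cst].
  by apply: cvgeZl => //; exact: cvgU.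
rewrite hor in cl.
apply: (cvg_unique (@ereal_hausdorff R) cl).
apply: (@squeeze_cvge _ _ _ _ (fun n : nat => (expR (- (q * b)))%:E * F (s + n%:R))%E _ (fun=> (expR (- (q * b)))%:E * \int[P]_w (xi w)%:E)%E); last 2 first.
- by apply: cvgeZl => //; exact: cvgF.
- exact: cvg_cst.
apply: nearW => n.
have u0 : (0 <= u q (s + n%:R))%E by apply: integral_ge0 => w _; rewrite lee_fin alive_weight_ge0.
rewrite leeDr//=.
have -> : ((expR (- (q * b)))%:E * F (s + n%:R) =
    \int[P]_w ((expR (- (q * b)))%:E * (xi w * ((tau w < (s + n%:R)%:E)%E)%:R)%:E))%E.
  rewrite ge0_integralZl_EFin ?expR_ge0//.
  - by move=> w _; rewrite lee_fin mulr_ge0.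
  - by apply/measurable_EFinP; exact: measurable_funM.
have -> : ((expR (- (q * b)))%:E * \int[P]_w (xi w)%:E =
    \int[P]_w ((expR (- (q * b)))%:E * (xi w)%:E))%E.
  rewrite ge0_integralZl_EFin ?expR_ge0//.
  - by move=> w _; rewrite lee_fin.
  - by apply/measurable_EFinP.
rewrite -ge0_integralD//; last 4 first.
- by move=> w _; rewrite lee_fin alive_weight_ge0.
- apply/measurable_EFinP; apply: measurableT_comp (pair1_measurable _).
  exact: (alive_weight_measurable HL x b mxi).
- by move=> w _; rewrite -EFinM lee_fin !mulr_ge0 ?expR_ge0.
- by apply: measurable_funeM; apply/measurable_EFinP; exact: measurable_funM.
apply: ge0_le_integral => //.
- by move=> w _; rewrite adde_ge0// ?lee_fin ?alive_weight_ge0 ?mulr_ge0 ?expR_ge0.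
- apply: emeasurable_funD.
    apply/measurable_EFinP; apply: measurableT_comp (pair1_measurable _).
    exact: (alive_weight_measurable HL x b mxi).
  by apply: measurable_funeM; apply/measurable_EFinP; exact: measurable_funM.
- by apply: measurable_funeM; apply/measurable_EFinP.
move=> w _; rewrite -!EFinM -EFinD lee_fin /alive_weight/= max_l; last by rewrite addr_ge0.
have [tt|tt] := ltP (tau w) (s + n%:R)%:E; rewrite /= ?mulr0 ?mulr1 ?mul0r ?addr0 ?add0r// mulrC.
rewrite ler_wpM2r// ler_expR lerN2 ler_pM2l//.
by apply: (le_first_below_ge (level_reg HL x w) (level0 HL bx w) _ tt); rewrite addr_ge0.
Qed.

End Potential_laplace.

(** * The potential in terms of the scale function *)

Section Potential_formula.
Context d (T : measurableType d) (R : realType) (P : probability T R)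
  (L : R -> T -> R) (Ps W : R -> R).
Hypotheses (HL : spec_pos_levy P L Ps) (scW : scale_function Ps W)
  (Ps_ge0 : forall q, 0 < q -> 0 <= Ps q).
Variables (x b : R).
Hypothesis bx : b <= x.
Local Notation tau w := (first_below (fun r => x + L r w) b).
Variables (s M : R) (xi : T -> R).
Hypotheses (s0 : 0 <= s) (mxi : past_measurable L s xi) (xi0 : forall w, 0 <= xi w)
  (xiM : forall w, xi w <= M) (xi_tau : forall w, xi w != 0 -> (s%:E <= tau w)%E) (M0 : 0 <= M).
Local Notation mu := (@lebesgue_measure R).

Let Ps_gt0 q : 0 < q -> 0 < Ps q. Proof. exact: (scale_exponent_gt0 scW Ps_ge0). Qed.
Let mxi' : measurable_fun setT xi. Proof. exact (past_measurableW HL mxi). Qed.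
Let mtau : measurable_fun setT (fun w => tau w).
Proof. exact: (measurable_passage HL). Qed.
Let mW : measurable_fun setT W. Proof. exact: (scale_measurable scW). Qed.
Let W0 y : 0 <= W y. Proof. exact: (scale_ge0 scW Ps_ge0). Qed.

Let mxi2 : measurable_fun setT (fun z : R * T => xi z.2).
Proof. exact: (measurableT_comp mxi' measurable_snd). Qed.

(** Three measures on the half line, with levels shifted by b: [w1] yields the occupation after [s],
    [w2] the scale measure issued from b, [w3] the scale measure issued from the level at time
    [s]. *)
Let w1 (z : R * T) : \bar R :=
  (xi z.2 * ((z.1%:E <= tau z.2)%E)%:R * \1_(`[s, +oo[%classic) z.1)%:E.
Let Y1 (z : R * T) : R := x + L (Num.max z.1 0) z.2 - b.
Let w2 (z : R * T) : \bar R := (xi z.2 * W (z.1 - b))%:E.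
Let w3 (z : R * T) : \bar R := (xi z.2 * W (z.1 - (x + L s z.2)))%:E.
Let Y2 (z : R * T) : R := z.1 - b.

Let mw1 : measurable_fun setT w1.
Proof.
apply/measurable_EFinP; apply: measurable_funM.
  by apply: measurable_funM => //; exact (alive_measurable HL x b).
exact: (measurableT_comp (measurable_indic (measurable_itv `[s, +oo[)) measurable_fst).
Qed.
Let mY1 : measurable_fun setT Y1.
Proof. by apply: measurable_funB => //; exact (clamped_level_measurable HL x). Qed.
Let mY2 : measurable_fun setT Y2.
Proof. by apply: measurable_funB => //; exact: measurable_fst. Qed.
Let mw2 : measurable_fun setT w2.
Proof. by apply/measurable_EFinP; apply: measurable_funM => //; exact: (measurableT_comp mW). Qed.
Let mw3 : measurable_fun setT w3.
Proof.
apply/measurable_EFinP; apply: measurable_funM => //; apply: measurableT_comp => //.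
apply: measurable_funB; first exact: measurable_fst.
apply: measurable_funD => //; apply: (measurableT_comp _ measurable_snd).
exact (levy_measurable HL s).
Qed.
Let w1_ge0 z : (0 <= w1 z)%E. Proof. by rewrite lee_fin !mulr_ge0. Qed.
Let w2_ge0 z : (0 <= w2 z)%E. Proof. by rewrite lee_fin mulr_ge0. Qed.
Let w3_ge0 z : (0 <= w3 z)%E. Proof. by rewrite lee_fin mulr_ge0. Qed.

Let xi_level w : xi w != 0 -> b <= x + L s w.
Proof.
move=> xiw; apply: (le_first_below_ge (level_reg HL x w) (level0 HL bx w)) => //; exact: xi_tau.
Qed.

Let Y1_ge0 z : w1 z != 0%E -> 0 <= Y1 z.
Proof.
rewrite /w1 /Y1 eqe !mulf_eq0 !negb_or indicE => /andP[/andP[_]].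
have [t1 _|] := boolP (_ <= _)%E; last by rewrite eqxx.
have [] := boolP (z.1 \in _); last by rewrite eqxx.
rewrite inE/= in_itv/= andbT => sz _; rewrite max_l ?subr_ge0 ?(le_trans s0)//.
by apply: (le_first_below_ge (level_reg HL x z.2) (level0 HL bx z.2) _ t1); exact: le_trans sz.
Qed.

Let Y2_ge0 z : w2 z != 0%E -> 0 <= Y2 z.
Proof.
by apply: contraNle => Y; rewrite /w2 (scale_lt0 scW) ?mulr0.
Qed.

Let Y3_ge0 z : w3 z != 0%E -> 0 <= Y2 z.
Proof.
move=> h; rewrite subr_ge0; apply: le_trans (xi_level (w := z.2) _) _.
  by apply: contraNneq h; rewrite /w3 => ->; rewrite mul0r.
by rewrite -subr_ge0; apply: contraNle h => Y; rewrite /w3 (scale_lt0 scW) ?mulr0.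
Qed.

Let image_integral (w : R * T -> \bar R) (Y : R * T -> R) (mw : measurable_fun setT w)
    (w0 : forall z, (0 <= w z)%E) (mY : measurable_fun setT Y) (g : R -> \bar R) :
  (forall z, w z != 0%E -> 0 <= Y z) ->
  measurable_fun setT g -> (forall y, 0 <= g y)%E ->
  (\int[weighted_image (mu \x P)%E mw w0 mY]_(y in `[0%R, +oo[) g y =
   \int[mu]_v \int[P]_t (w (v, t) * g (Y (v, t))))%E.
Proof.
move=> wY mg g0.
have mh : measurable_fun setT (fun y : R => ((\1_(`[0%R, +oo[%classic : set R) y)%:E * g y)%E).
  by apply: emeasurable_funM => //; apply/measurable_EFinP; exact: measurable_indic.
transitivity (\int[weighted_image (mu \x P)%E mw w0 mY]_y
   ((\1_(`[0%R, +oo[%classic : set R) y)%:E * g y))%E.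
  rewrite [LHS]integral_mkcond; apply: eq_integral => y _; rewrite patchE indicE.
  by case: ifP => _; rewrite ?mul1e ?mul0e.
rewrite ge0_integral_weighted_image//; last by move=> y; rewrite mule_ge0// lee_fin.
rewrite (@fubini_tonelli1 _ _ _ _ _ mu P (fun z => w z * ((\1_(`[0%R, +oo[%classic : set R) (Y z))%:E * g (Y z)))%E); last 2 first.
- apply: emeasurable_funM => //; exact: (measurableT_comp mh mY).
- by move=> z; rewrite !mule_ge0// lee_fin.
apply: eq_integral => v _; rewrite /fubini_F; apply: eq_integral => t _.
have [->|/wY Y0] := eqVneq (w (v, t)) 0%E; first by rewrite !mul0e.
by rewrite indicE mem_set ?mul1e//= in_itv/= Y0.
Qed.

Let m1 : {measure set R -> \bar R} := weighted_image (mu \x P)%E mw1 w1_ge0 mY1.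
Let m2 : {measure set R -> \bar R} := weighted_image (mu \x P)%E mw2 w2_ge0 mY2.
Let m3 : {measure set R -> \bar R} := weighted_image (mu \x P)%E mw3 w3_ge0 mY2.

Let m1E (g : R -> \bar R) (mg : measurable_fun setT g) (g0 : forall y, (0 <= g y)%E) :
  (\int[m1]_(y in `[0%R, +oo[) g y = \int[mu]_(v in `[s, +oo[)
  \int[P]_w ((xi w * ((v%:E <= tau w)%E)%:R)%:E * g (x + L (Num.max v 0) w - b)%R))%E.
Proof.
rewrite (image_integral mw1 w1_ge0 mY1 Y1_ge0 mg g0) [RHS]integral_mkcond.
apply: eq_integral => v _; rewrite patchE; case: ifPn => vs.
  by apply: eq_integral => w _; rewrite /w1 /Y1/= indicE vs mulr1.
by apply: integral0_eq => w _; rewrite /w1/= indicE (negbTE vs) mulr0 mul0e.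
Qed.


Let m2E (g : R -> \bar R) (mg : measurable_fun setT g) (g0 : forall y, (0 <= g y)%E) :
  (\int[m2]_(y in `[0%R, +oo[) g y =
  (\int[P]_w (xi w)%:E) * \int[mu]_y ((W (y - b)%R)%:E * g (y - b)%R))%E.
Proof.
rewrite (image_integral mw2 w2_ge0 mY2 Y2_ge0 mg g0).
have X0 : (0 <= \int[P]_w (xi w)%:E)%E by apply: integral_ge0 => w _; rewrite lee_fin.
transitivity (\int[mu]_y ((W (y - b)%R)%:E * g (y - b)%R * \int[P]_w (xi w)%:E))%E; last first.
  rewrite [RHS]muleC; apply: ge0_integralZr => //.
  - apply: emeasurable_funM; last by apply: (measurableT_comp mg); exact: measurable_funB.
    by apply/measurable_EFinP; apply: (measurableT_comp mW); exact: measurable_funB.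
  - by move=> y _; rewrite mule_ge0// lee_fin.
apply: eq_integral => v _; rewrite /w2 /Y2/= -ge0_integralZl//; last 3 first.
- by apply/measurable_EFinP.
- by move=> w _; rewrite lee_fin.
- by rewrite mule_ge0// lee_fin.
by apply: eq_integral => w _; rewrite EFinM [in RHS]muleC muleA.
Qed.

Let m3E (g : R -> \bar R) (mg : measurable_fun setT g) (g0 : forall y, (0 <= g y)%E) :
  (\int[m3]_(y in `[0%R, +oo[) g y =
  \int[P]_w ((xi w)%:E * \int[mu]_y ((W (y - (x + L s w))%R)%:E * g (y - b)%R)))%E.
Proof.
rewrite (image_integral mw3 w3_ge0 mY2 Y3_ge0 mg g0).
rewrite (@fubini_tonelli _ _ _ _ _ mu P (fun z => w3 z * g (Y2 z))%E); last 2 first.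
- by apply: emeasurable_funM => //; exact: (measurableT_comp mg mY2).
- by move=> z; rewrite mule_ge0.
apply: eq_integral => w _; rewrite -ge0_integralZl//; last 3 first.
- apply: emeasurable_funM; last by apply: (measurableT_comp mg); exact: measurable_funB.
  by apply/measurable_EFinP; apply: (measurableT_comp mW); exact: measurable_funB.
- by move=> y _; rewrite mule_ge0// lee_fin.
- by rewrite lee_fin.
by apply: eq_integral => v _; rewrite /w3 /Y2/= EFinM muleA.
Qed.

(** [W] vanishes on the negative axis, so translating it multiplies its Laplace transform by an
    exponential. *)
Let shift_laplace q c : 0 < q ->
  (\int[mu]_y ((W (y - c)%R)%:E * (expR (- (q * (y - b))))%:E) =
   (expR (- (q * (c - b))))%:E * ((Ps q)^-1)%:E)%E.
Proof.
move=> q0.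
pose h (y : R) := ((W y)%:E * (expR (- (q * (y + c - b))))%:E)%E.
have mq a : measurable_fun setT (fun y : R => (expR (- (q * (y + a))))%:E).
  apply/measurable_EFinP; apply: measurableT_comp => //; apply: measurableT_comp => //.
  by apply: measurable_funM => //; exact: measurable_funD.
have mh : measurable_fun setT h.
  apply: emeasurable_funM; first by apply/measurable_EFinP.
  by under eq_fun do rewrite -addrA; exact: mq.
transitivity (\int[mu]_y h (y - c)%R)%E.
  by apply: eq_integral => y _; rewrite /h subrK.
rewrite ge0_integral_shift//; last by move=> y; rewrite mule_ge0// lee_fin// expR_ge0.
rewrite -(scale_laplace scW q0) -ge0_integralZl_EFin ?expR_ge0//; last 2 first.
- by move=> y _; rewrite lee_fin mulr_ge0// expR_ge0.
- apply: measurable_funTS; apply/measurable_EFinP; apply: measurable_funM => //.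
  apply/measurable_EFinP; have := mq 0; by under eq_fun do rewrite addr0.
rewrite [RHS]integral_mkcond; apply: eq_integral => y _; rewrite patchE.
case: ifPn => yD.
  by rewrite /h -!EFinM mulrA -expRD mulrC; congr (_ * _)%:E; congr expR; ring.
rewrite /h (scale_lt0 scW) ?mul0e//; move: yD; rewrite mem_setE in_itv/= andbT.
by rewrite -ltNge.
Qed.

(** Multiplying [potential_laplace] by exp (q b) / Ps q says that m1 + m3 and m2 have the same
    Laplace transform, hence the same integrals. *)
Lemma potential_formula (f : R -> \bar R) :
  measurable_fun setT f -> (forall y, 0 <= f y)%E ->
  (\int[mu]_(v in `[s, +oo[)
      \int[P]_w ((xi w * ((v%:E <= tau w)%E)%:R)%:E * f (x + L (Num.max v 0) w)%R) +
    \int[P]_w ((xi w)%:E * \int[mu]_y ((W (y - (x + L s w))%R)%:E * f y)) =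
   (\int[P]_w (xi w)%:E) * \int[mu]_y ((W (y - b)%R)%:E * f y))%E.
Proof.
move=> mf f0.
pose g y := f (y + b).
have mg : measurable_fun setT g by apply: (measurableT_comp mf); exact: measurable_funD.
have g0 y : (0 <= g y)%E by exact: f0.
have gb y : g (y - b) = f y by rewrite /g subrK.
have E1 : (\int[m1]_(y in `[0%R, +oo[) g y = \int[mu]_(v in `[s, +oo[)
    \int[P]_w ((xi w * ((v%:E <= tau w)%E)%:R)%:E * f (x + L (Num.max v 0) w)%R))%E.
  by rewrite (m1E mg g0); apply: eq_integral => v _; apply: eq_integral => w _; rewrite gb.
have E2 : (\int[m2]_(y in `[0%R, +oo[) g y =
    (\int[P]_w (xi w)%:E) * \int[mu]_y ((W (y - b)%R)%:E * f y))%E.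
  by rewrite (m2E mg g0); congr (_ * _)%E; apply: eq_integral => y _; rewrite gb.
have E3 : (\int[m3]_(y in `[0%R, +oo[) g y =
    \int[P]_w ((xi w)%:E * \int[mu]_y ((W (y - (x + L s w))%R)%:E * f y)))%E.
  rewrite (m3E mg g0); apply: eq_integral => w _; congr (_ * _)%E.
  by apply: eq_integral => y _; rewrite gb.
rewrite -E1 -E2 -E3.
rewrite -ge0_integral_measure_add//; last exact: measurable_funTS.
have Xlty : (\int[P]_w (xi w)%:E < +oo)%E.
  apply: (@le_lt_trans _ _ (\int[P]_w (cst M%:E w))%E).
    apply: ge0_le_integral => //.
    - by move=> w _; rewrite lee_fin.
    - by apply/measurable_EFinP.
    - by move=> w _; rewrite lee_fin.
  by rewrite integral_cst//= probability_setT mule1 ltry.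
have me (q : R) : measurable_fun setT (fun y : R => (expR (- (q * y)))%:E).
  apply/measurable_EFinP; apply: measurableT_comp => //.
  by apply: (measurableT_comp (@oppr_measurable R _)); exact: mulrl_measurable.
have e0 (q y : R) : (0 <= (expR (- (q * y)))%:E)%E by rewrite lee_fin expR_ge0.
have L2 q : 0 < q -> (\int[m2]_(y in `[0%R, +oo[) (expR (- (q * y)))%:E =
    (\int[P]_w (xi w)%:E) * ((Ps q)^-1)%:E)%E.
  by move=> q0; rewrite (m2E (me q) (e0 q)) shift_laplace// subrr mulr0 oppr0 expR0 mul1e.
have EQ q : 0 < q -> (\int[measure_add m1 m3]_(y in `[0%R, +oo[) (expR (- (q * y)))%:E =
    \int[m2]_(y in `[0%R, +oo[) (expR (- (q * y)))%:E)%E.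
  move=> q0; rewrite ge0_integral_measure_add//; last exact: measurable_funTS.
  rewrite L2// (m1E (me q) (e0 q)) (m3E (me q) (e0 q)).
  have eb0 : 0 <= expR (q * b) by exact: expR_ge0.
  set X := (\int[P]_w (xi w)%:E)%E.
  pose U := (\int[mu]_(v in `[s, +oo[) \int[P]_w (alive_weight L x b xi q (v, w))%:E)%E.
  pose K := (\int[P]_w (xi w * expR (- (q * (x + L s w))))%:E)%E.
  have PL : ((Ps q)%:E * U + K = (expR (- (q * b)))%:E * X)%E.
    exact: (potential_laplace HL Ps_gt0 bx s0 mxi xi0 xiM xi_tau M0 q0).
  have malive : measurable_fun setT (fun z => (alive_weight L x b xi q z)%:E).
    by apply/measurable_EFinP; exact (alive_weight_measurable HL x b mxi q).
  have U0 : (0 <= U)%E.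
    by apply: integral_ge0 => v _; apply: integral_ge0 => w _; rewrite lee_fin alive_weight_ge0.
  have K0 : (0 <= K)%E by apply: integral_ge0 => w _; rewrite lee_fin mulr_ge0 ?expR_ge0.
  have Pq := Ps_gt0 q0.
  transitivity ((expR (q * b))%:E * U + (expR (q * b) / Ps q)%:E * K)%E.
    congr (_ + _)%E.
      rewrite /U -ge0_integralZl_EFin//; last 2 first.
      - by move=> v _; apply: integral_ge0 => w _; rewrite lee_fin alive_weight_ge0.
      - apply: measurable_funTS; apply: (@measurable_tonelli_F _ _ _ P (fun z => (alive_weight L x b xi q z)%:E)) => // z.
        by rewrite lee_fin alive_weight_ge0.
      apply: eq_integral => v _; rewrite -ge0_integralZl_EFin//; last 2 first.
      - by move=> w _; rewrite lee_fin alive_weight_ge0.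
      - exact: (measurableT_comp malive (pair1_measurable v)).
      apply: eq_integral => w _; rewrite /alive_weight/= -!EFinM; congr EFin.
      rewrite [RHS]mulrC -[RHS]mulrA -expRD; congr (_ * expR _); ring.
    rewrite /K -ge0_integralZl_EFin//; last 3 first.
    - by move=> w _; rewrite lee_fin mulr_ge0 ?expR_ge0.
    - by apply/measurable_EFinP; apply: measurable_funM => //; exact: (levelZ_measurable HL).
    - by rewrite divr_ge0// ltW.
    apply: eq_integral => w _; rewrite shift_laplace// -!EFinM; congr EFin.
    rewrite (_ : - (q * (x + L s w - b)) = q * b + - (q * (x + L s w))); last by ring.
    by rewrite expRD; ring.
  rewrite (_ : (expR (q * b))%:E * U = (expR (q * b) / Ps q)%:E * ((Ps q)%:E * U))%E; last first.
    by rewrite muleA -EFinM divfK ?gt_eqF.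
  rewrite -muleDr//; last by rewrite ge0_adde_def// inE ?mule_ge0// lee_fin ltW.
  by rewrite PL muleA -EFinM mulrAC -expRD subrr expR0 mul1r muleC.
apply: laplace_transform_unique mg g0 => [n|]; first exact: EQ.
under eq_integral do rewrite -[X in expR (- X)]mul1r.
rewrite EQ// L2//; apply: lte_mul_pinfty => //.
- by apply: integral_ge0 => w _; rewrite lee_fin.
- rewrite ge0_fin_numE//; apply: integral_ge0 => w _; rewrite lee_fin//.
- by rewrite ltry.
Qed.

End Potential_formula.

(** * Second moment of the occupation *)

Section Second_moment_tools.
Context (R : realType).
Local Notation mu := (@lebesgue_measure R).
Local Open Scope ereal_scope.

(** The regions s <= v and v <= s cover the plane and are exchanged by swapping the variables. *)
Lemma square_integral_le (g : R -> \bar R) :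
  measurable_fun setT g -> (forall v, 0 <= g v) ->
  (\int[mu]_v g v) * (\int[mu]_v g v) <=
  2%:E * \int[mu]_s \int[mu]_v (((s <= v)%R%:R)%:E * (g s * g v)).
Proof.
move=> mg g0.
pose H (z : R * R) := ((z.1 <= z.2)%R%:R)%:E * (g z.1 * g z.2).
pose H' (z : R * R) := ((z.2 <= z.1)%R%:R)%:E * (g z.1 * g z.2).
have m1 : measurable_fun setT (fun z : R * R => g z.1) by exact: (measurableT_comp mg measurable_fst).
have m2 : measurable_fun setT (fun z : R * R => g z.2) by exact: (measurableT_comp mg measurable_snd).
have mH : measurable_fun setT H.
  apply: emeasurable_funM; last exact: emeasurable_funM.
  by apply/measurable_EFinP; apply: measurable_fun_natr; apply: measurable_fun_ler; [exact: measurable_fst|exact: measurable_snd].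
have mH' : measurable_fun setT H'.
  apply: emeasurable_funM; last exact: emeasurable_funM.
  by apply/measurable_EFinP; apply: measurable_fun_natr; apply: measurable_fun_ler; [exact: measurable_snd|exact: measurable_fst].
have H0 z : 0 <= H z by rewrite mule_ge0// ?mule_ge0// lee_fin.
have H'0 z : 0 <= H' z by rewrite mule_ge0// ?mule_ge0// lee_fin.
have -> : (\int[mu]_v g v) * (\int[mu]_v g v) = \int[mu]_s \int[mu]_v (g s * g v).
  rewrite -ge0_integralZr//; last exact: integral_ge0.
  by apply: eq_integral => s _; rewrite ge0_integralZl.
apply: (@le_trans _ _ (\int[mu]_s \int[mu]_v H (s, v) + \int[mu]_s \int[mu]_v H' (s, v))).
  rewrite -ge0_integralD//; last 4 first.
  - by move=> s _; exact: integral_ge0.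
  - exact: measurable_fun_fubini_tonelli_F.
  - by move=> s _; exact: integral_ge0.
  - exact: measurable_fun_fubini_tonelli_F.
  apply: ge0_le_integral => //.
  - by move=> s _; apply: integral_ge0 => v _; rewrite mule_ge0.
  - apply: (@measurable_fun_fubini_tonelli_F _ _ _ _ _ mu (fun z : R * R => g z.1 * g z.2)).
      exact: emeasurable_funM.
    by move=> z; rewrite mule_ge0.
  - by apply: emeasurable_funD; exact: measurable_fun_fubini_tonelli_F.
  move=> s _; rewrite -ge0_integralD//; last 2 first.
  - exact: (measurableT_comp mH (pair1_measurable s)).
  - exact: (measurableT_comp mH' (pair1_measurable s)).
  apply: ge0_le_integral => //.
  - by move=> v _; rewrite mule_ge0.
  - exact: measurable_funeM.
  - by apply: emeasurable_funD; [exact: (measurableT_comp mH (pair1_measurable s))|exact: (measurableT_comp mH' (pair1_measurable s))].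
  move=> v _; rewrite /H /H'/=; have [sv|/ltW vs] := leP s v.
    by rewrite mul1e leeDl// mule_ge0// ?mule_ge0// lee_fin.
  by rewrite vs mul1e leeDr// mule_ge0// ?mule_ge0// lee_fin.
have -> : \int[mu]_s \int[mu]_v H' (s, v) = \int[mu]_s \int[mu]_v H (s, v).
  transitivity (\int[mu]_v \int[mu]_s H' (s, v)); first exact: (@fubini_tonelli _ _ _ _ _ mu mu H' mH' H'0).
  apply: eq_integral => v _; apply: eq_integral => s _.
  by rewrite /H /H'/= [g s * _]muleC.
by rewrite -mule2n mule_natl.
Qed.

Context d (T : measurableType d) (P : probability T R).

(** Paley-Zygmund from a pointwise bound: a <= m / 2 + a^2 / (8 m) + 2 m 1(a > m / 2), because (a -
    4 m)^2 >= 0. Integration gives m <= m / 2 + m / 4 + 2 m P, hence the 1 / 8. *)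
Lemma second_moment_bound (A : T -> \bar R) (m : R) : (0 < m)%R ->
  measurable_fun setT A -> (forall w, 0 <= A w) ->
  \int[P]_w A w = m%:E -> \int[P]_w (A w * A w) <= (2 * m ^+ 2)%:E ->
  (8^-1)%:E <= P [set w | (m / 2)%:E < A w].
Proof.
move=> m0 mA A0 EA EA2.
have mE : measurable [set w | (m / 2)%:E < A w].
  by rewrite -[X in measurable X]setTI; exact: emeasurable_fun_o_infty.
set E := [set w | _] in mE *.
have Pf : P E \is a fin_num by rewrite fin_num_measure.
have AA0 w : 0 <= A w * A w by rewrite mule_ge0.
have c0 : (0 <= (8 * m)^-1)%R by rewrite invr_ge0 mulr_ge0// ltW.
have pointwise w : A w <= (m / 2)%:E + (((8 * m)^-1)%:E * (A w * A w) + (2 * m)%:E * (\1_E w)%:E).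
  have [wE|wE] := boolP ((m / 2)%:E < A w); last first.
    rewrite -leNgt in wE; apply: (le_trans wE); rewrite leeDl// adde_ge0// mule_ge0// lee_fin.
    by rewrite mulr_ge0// ltW.
  rewrite indicE mem_set// mule1; move: wE (A0 w); case: (A w) => [a| |]//; last first.
    by rewrite mulyy gt0_muley ?lte_fin ?invr_gt0 ?mulr_gt0.
  rewrite -!EFinM -!EFinD lte_fin !lee_fin => am a0.
  have -> : ((8 * m)^-1 * (a * a) = (a - 4 * m) ^+ 2 / (8 * m) + a - 2 * m)%R by field; rewrite gt_eqF.
  have : (0 <= (a - 4 * m) ^+ 2 / (8 * m))%R by rewrite divr_ge0 ?sqr_ge0// mulr_ge0// ltW.
  by lra.
have mAA : measurable_fun setT (fun w => A w * A w) by exact: emeasurable_funM.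
have mI : measurable_fun setT (fun w => (\1_E w)%:E : \bar R).
  by apply/measurable_EFinP; exact: measurable_indic.
have : \int[P]_w A w <= \int[P]_w ((m / 2)%:E + (((8 * m)^-1)%:E * (A w * A w) + (2 * m)%:E * (\1_E w)%:E)).
  apply: ge0_le_integral => //.
  by apply: emeasurable_funD => //; apply: emeasurable_funD; exact: measurable_funeM.
have m20 : (0 <= m / 2)%R by rewrite divr_ge0// ltW.
have m2m : (0 <= 2 * m)%R by rewrite mulr_ge0// ltW.
rewrite ge0_integralD//; last 2 first.
- by move=> w _; rewrite adde_ge0// mule_ge0// lee_fin.
- by apply: emeasurable_funD; exact: measurable_funeM.
rewrite ge0_integralD//; last 4 first.
- by move=> w _; rewrite mule_ge0.
- exact: measurable_funeM.
- by move=> w _; rewrite mule_ge0// lee_fin.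
- exact: measurable_funeM.
rewrite integral_cst//= probability_setT mule1 !ge0_integralZl_EFin//.
rewrite integral_indic// setIT EA => h.
have {h} : m%:E <= (m / 2)%:E + (((8 * m)^-1)%:E * (2 * m ^+ 2)%:E + (2 * m)%:E * P E).
  apply: (le_trans h); rewrite leeD2l// leeD2r// lee_wpmul2l// lee_fin//.
rewrite -(fineK Pf) -!EFinM -!EFinD !lee_fin.
rewrite (_ : (8 * m)^-1 * (2 * m ^+ 2) = m / 4)%R; last by field; rewrite gt_eqF.
move=> h; rewrite -(ler_pM2l m0); nra.
Qed.

End Second_moment_tools.

Section Occupation.
Context d (T : measurableType d) (R : realType) (P : probability T R)
  (L : R -> T -> R) (Ps W : R -> R).
Hypotheses (HL : spec_pos_levy P L Ps) (scW : scale_function Ps W)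
  (Ps_ge0 : forall q, 0 < q -> 0 <= Ps q).
Variables (x b : R).
Hypothesis bx : b <= x.
Local Notation tau w := (first_below (fun r => x + L r w) b).
Local Notation mu := (@lebesgue_measure R).
Variable h : R -> R.
Hypotheses (mh : measurable_fun setT h) (h0 : forall y, 0 <= h y).

Definition alive_reward (z : R * T) : R :=
  \1_(`[0, +oo[%classic : set R) z.1 * (((z.1%:E <= tau z.2)%E)%:R * h (x + L (Num.max z.1 0) z.2)).

Definition occupation (w : T) : \bar R := (\int[mu]_v (alive_reward (v, w))%:E)%E.

Local Notation mean := (\int[mu]_y ((W (y - b))%:E * (h y)%:E))%E.

Let mW : measurable_fun setT W. Proof. exact: (scale_measurable scW). Qed.
Let W0 y : 0 <= W y. Proof. exact: (scale_ge0 scW Ps_ge0). Qed.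

Lemma alive_reward_ge0 z : 0 <= alive_reward z.
Proof. by rewrite !mulr_ge0. Qed.

Lemma alive_rewardE v w : 0 <= v ->
  alive_reward (v, w) = ((v%:E <= tau w)%E)%:R * h (x + L v w).
Proof. by move=> v0; rewrite /alive_reward/= indicE mem_set/= ?in_itv/= ?v0// mul1r max_l. Qed.

Lemma alive_reward_measurable : measurable_fun setT alive_reward.
Proof.
apply: measurable_funM.
  exact: (measurableT_comp (measurable_indic (measurable_itv `[0%R, +oo[)) measurable_fst).
apply: measurable_funM; first exact (alive_measurable HL x b).
by apply: measurableT_comp => //; exact (clamped_level_measurable HL x).
Qed.

Let mE : measurable_fun setT (fun z => (alive_reward z)%:E).
Proof. by apply/measurable_EFinP; exact: alive_reward_measurable. Qed.
Let E0 z : (0 <= (alive_reward z)%:E)%E. Proof. by rewrite lee_fin alive_reward_ge0. Qed.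

Lemma occupation_ge0 w : (0 <= occupation w)%E.
Proof. by apply: integral_ge0. Qed.

Lemma occupation_measurable : measurable_fun setT occupation.
Proof. exact: (@measurable_fun_fubini_tonelli_G _ _ _ _ _ mu (fun z => (alive_reward z)%:E) mE E0). Qed.

Let occupation_formula :
  (\int[P]_w occupation w + \int[mu]_y ((W (y - x))%:E * (h y)%:E) = mean)%E.
Proof.
have m1 : past_measurable L 0 (cst (1 : R) : T -> R) by exact: measurable_cst.
have st w : (cst (1 : R) : T -> R) w != 0 -> (0%:E <= tau w)%E by move=> _; exact: first_below_ge0.
have := potential_formula HL scW Ps_ge0 bx (lexx 0) m1 (fun=> ler01) (fun=> lexx 1) st ler01.
move=> /(_ (fun y => (h y)%:E)).
have mh' : measurable_fun setT (fun y => (h y)%:E) by apply/measurable_EFinP.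
move=> /(_ mh') PF; have {PF} := PF (fun y => h0 y).
have -> : (\int[P]_w ((cst (1 : R) : T -> R) w)%:E = 1)%E.
  by rewrite -[RHS](@probability_setT _ _ _ P) -[RHS]mul1e -(@integral_cst _ _ _ P).
rewrite !mul1e => <-; congr (_ + _)%E.
  rewrite -(@fubini_tonelli _ _ _ _ _ mu P (fun z => (alive_reward z)%:E) mE E0).
  rewrite [RHS]integral_mkcond; apply: eq_integral => v _; rewrite patchE.
  case: ifPn => vD.
    apply: eq_integral => w _; rewrite /alive_reward/= indicE vD -EFinM !mul1r//.
  by apply: integral0_eq => w _; rewrite /alive_reward/= indicE (negbTE vD) mul0r.
set C := LHS.
transitivity (\int[P]_w cst C w)%E; last first.
  by apply: eq_integral => w _; rewrite mul1e (levy0 HL) addr0.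
by rewrite integral_cst//= probability_setT mule1.
Qed.

Lemma occupation_mean_le : (\int[P]_w occupation w <= mean)%E.
Proof.
rewrite -occupation_formula leeDl//; apply: integral_ge0 => y _.
by rewrite mule_ge0// lee_fin.
Qed.

(** The correction term pairs [W (y - x)], zero for y < x, with a reward that is zero for y >= x. *)
Lemma occupation_mean : (forall y, x <= y -> h y = 0) -> (\int[P]_w occupation w = mean)%E.
Proof.
move=> hx; rewrite -occupation_formula [X in (_ + X)%E]integral0_eq ?adde0// => y _.
have [xy|yx] := leP x y; first by rewrite hx// mule0.
by rewrite (scale_lt0 scW) ?mul0e// subr_lt0.
Qed.

Lemma alive_reward_past s : 0 <= s -> past_measurable L s (fun w => alive_reward (s, w)).
Proof.
move=> s0; have -> : (fun w => alive_reward (s, w)) =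
    (fun w => ((s%:E <= tau w)%E)%:R * h (x + L s w)).
  by apply/funext => w; exact: alive_rewardE.
apply: past_measurableM; last first.
  have ss : 0 <= s <= s by rewrite s0 lexx.
  by apply: (measurableT_comp mh); exact (level_past x ss).
apply: past_measurable_natr; apply: (measurable_fun_bool true).
rewrite setTI (_ : _ @^-1` _ = ~` [set w | (tau w < s%:E)%E]).
  by apply: measurableC; exact: (passage_lt_past HL).
by apply/seteqP; split => w /=; [move=> /= t1; apply/negP|move=> /negP]; rewrite -leNgt.
Qed.

Variable H : R.
Hypothesis hH : forall y, h y <= H.

(** Order the two times. For the earlier time s take the reward at s as the weight: the potential
    formula bounds the weighted occupation after s by [mean] times the expected weight, whatever the
    level at s. The bound [H] makes the weight admissible and does not enter the result. *)
Lemma occupation_square_le :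
  (\int[P]_w (occupation w * occupation w) <= 2%:E * (mean * \int[P]_w occupation w))%E.
Proof.
pose K (z : R * T * R) := ((z.1.1 <= z.2)%R%:R * (alive_reward z.1 * alive_reward (z.2, z.1.2)))%:E.
have mK : measurable_fun setT K.
  apply/measurable_EFinP; apply: measurable_funM.
    apply: measurable_fun_natr; apply: measurable_fun_ler; last exact: measurable_snd.
    exact: (measurableT_comp measurable_fst measurable_fst).
  apply: measurable_funM.
    exact: (measurableT_comp alive_reward_measurable measurable_fst).
  apply: (measurableT_comp alive_reward_measurable); apply: measurable_fun_pair.
    exact: measurable_snd.
  exact: (measurableT_comp measurable_snd measurable_fst).
have K0 z : (0 <= K z)%E by rewrite lee_fin !mulr_ge0// alive_reward_ge0.
pose J (z : R * T) := (\int[mu]_v K (z, v))%E.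
have mJ : measurable_fun setT J by exact: (@measurable_fun_fubini_tonelli_F _ _ _ _ _ mu K mK K0).
have J0 z : (0 <= J z)%E by apply: integral_ge0.
have sq w : (occupation w * occupation w <= 2%:E * \int[mu]_s J (s, w))%E.
  have := @square_integral_le R (fun v => (alive_reward (v, w))%:E).
  rewrite /J/K/=; apply; last by move=> v; exact: E0.
  exact: (measurableT_comp mE (pair2_measurable w)).
apply: (@le_trans _ _ (\int[P]_w (2%:E * \int[mu]_s J (s, w)))%E).
  apply: ge0_le_integral => //.
  - by move=> w _; rewrite mule_ge0// occupation_ge0.
  - by apply: emeasurable_funM; exact: occupation_measurable.
  - apply: measurable_funeM.
    exact: (@measurable_fun_fubini_tonelli_G _ _ _ _ _ mu J mJ J0).
rewrite ge0_integralZl_EFin//; last 2 first.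
- by move=> w _; exact: integral_ge0.
- exact: (@measurable_fun_fubini_tonelli_G _ _ _ _ _ mu J mJ J0).
rewrite lee_wpmul2l//.
rewrite -(@fubini_tonelli _ _ _ _ _ mu P J mJ J0).
rewrite -(@fubini_tonelli _ _ _ _ _ mu P (fun z => (alive_reward z)%:E) mE E0).
have mean0 : (0 <= mean)%E by apply: integral_ge0 => y _; rewrite mule_ge0// lee_fin.
have mR : measurable_fun setT (fun v => \int[P]_w (alive_reward (v, w))%:E)%E.
  exact: (@measurable_tonelli_F _ _ _ P (fun z => (alive_reward z)%:E)).
rewrite -ge0_integralZl//; last by move=> v _; exact: integral_ge0.
apply: ge0_le_integral => //.
- by move=> s _; exact: integral_ge0.
- exact: (@measurable_tonelli_F _ _ _ P J).
- exact: measurable_funeM.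
move=> s _; have [s0|s0] := leP 0 s; last first.
  rewrite (_ : (\int[P]_w J (s, w) = 0)%E).
    by rewrite mule_ge0//; apply: integral_ge0.
  apply: integral0_eq => w _; apply: integral0_eq => v _.
  by rewrite /K/= {1}/alive_reward/= indicE memNset/= ?in_itv/= ?leNgt ?s0// !mul0r mulr0.
pose xi w := alive_reward (s, w).
have H0 : 0 <= H by exact: le_trans (h0 0) (hH 0).
have xi0 w : 0 <= xi w by exact: alive_reward_ge0.
have xiE w : xi w = ((s%:E <= tau w)%E)%:R * h (x + L s w).
  exact: alive_rewardE.
have xiH w : xi w <= H.
  by rewrite xiE; case: (_ <= _)%E; rewrite ?mul1r ?mul0r.
have xi_tau w : xi w != 0 -> (s%:E <= tau w)%E.
  by rewrite xiE; case: (_ <= _)%E => //; rewrite mul0r eqxx.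
have mh' : measurable_fun setT (fun y => (h y)%:E) by apply/measurable_EFinP.
have PF := potential_formula HL scW Ps_ge0 bx s0 (alive_reward_past s0) xi0 xiH xi_tau H0 mh' h0.
rewrite [leRHS]muleC -PF.
apply: (@le_trans _ _ (\int[mu]_(v in `[s, +oo[)
    \int[P]_w ((xi w * ((v%:E <= tau w)%E)%:R)%:E * (h (x + L (Num.max v 0) w)%R)%:E))%E); last first.
  rewrite leeDl//; apply: integral_ge0 => w _; rewrite mule_ge0// ?lee_fin//.
  by apply: integral_ge0 => y _; rewrite mule_ge0// lee_fin.
pose Ks (z : R * T) := K (s, z.2, z.1).
have mKs : measurable_fun setT Ks.
  apply: (measurableT_comp mK); apply: measurable_fun_pair; last exact: measurable_fst.
  by apply: measurable_fun_pair; [exact: measurable_cst|exact: measurable_snd].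
have Ks0 z : (0 <= Ks z)%E by exact: K0.
rewrite -(@fubini_tonelli _ _ _ _ _ mu P Ks mKs Ks0).
rewrite [leRHS]integral_mkcond le_eqVlt; apply/orP; left; apply/eqP.
apply: eq_integral => v _; rewrite patchE mem_setE in_itv/= andbT.
case: ifPn => [sv|]; last first.
  rewrite -ltNge => vs; apply: integral0_eq => w _.
  by rewrite /Ks /K/= leNgt vs mul0r.
apply: eq_integral => w _; rewrite /Ks /K/= sv mul1r -EFinM.
by rewrite -/(xi w) (alive_rewardE w (le_trans s0 sv)) (max_l (le_trans s0 sv)) mulrA.
Qed.

End Occupation.

(** * The time change *)

Section Inverse.
Context (R : realType).

(** [eta_tc] uses the extended inverse, which is +oo at 0; this matters because the rate may vanish
    at level 0. *)
Lemma measurable_inve : measurable_fun setT (fun y : R => (y%:E)^-1%E).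
Proof.
rewrite (_ : (fun y : R => (y%:E)^-1%E) = fun y => if y == 0 then +oo%E else (y^-1)%:E); last first.
  by apply/funext => y; rewrite inver.
apply: measurable_fun_ifT => //.
- by apply: measurable_fun_eqr => //; exact: measurable_id.
- by apply/measurable_EFinP; exact: measurable_invr.
Qed.

Lemma inve_le_fin (c y : R) : 0 < c -> c <= y -> ((y%:E)^-1 <= (c^-1)%:E)%E.
Proof.
move=> c0 cy; have y0 := lt_le_trans c0 cy.
by rewrite inver gt_eqF// lee_fin lef_pV2.
Qed.

Lemma inve_ge_fin (C y : R) : 0 < C -> 0 <= y -> y <= C -> ((C^-1)%:E <= (y%:E)^-1)%E.
Proof.
move=> C0 y0 yC; rewrite inver; case: eqVneq => [_|yn0]; first exact: leey.
by rewrite lee_fin lef_pV2// posrE lt_neqAle eq_sym yn0.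
Qed.

End Inverse.

Section Rate.
Context (R : realType).
Variable Rt : R -> R.
Hypotheses (Rt_cont : {within `[(0:R), +oo[, continuous Rt}) (Rt_gt0 : forall x, 0 < x -> 0 < Rt x).

Lemma rate_near y e : 0 <= y -> 0 < e ->
  exists2 a, 0 < a & forall v, 0 <= v -> `|v - y| < a -> `|Rt v - Rt y| < e.
Proof.
move=> y0 e0; have [Rc Rc0] := (continuous_within_itvcyP _ _).1 Rt_cont.
move: y0; rewrite le_eqVlt => /predU1P[<-|y0].
  move/cvgrPdist_lt : Rc0 => /(_ _ e0) [a/= a0 ha]; exists a => // v.
  rewrite le_eqVlt subr0 => /predU1P[<- _|v0 va]; first by rewrite subrr normr0.
  by rewrite distrC; apply: ha => //=; rewrite sub0r normrN.
have := Rc y; rewrite in_itv/= y0 => /(_ isT) /cvgrPdist_lt /(_ _ e0) [a/= a0 ha].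
by exists a => // v _ va; rewrite distrC; apply: ha; rewrite /= distrC.
Qed.

Lemma rate_ge0 y : 0 <= y -> 0 <= Rt y.
Proof.
rewrite le_eqVlt => /predU1P[<-|/Rt_gt0/ltW//].
rewrite leNgt; apply/negP => R0; have e0 : 0 < - Rt 0 by rewrite oppr_gt0.
have [a a0 ha] := rate_near (lexx 0) e0.
have a20 : 0 < a / 2 by rewrite divr_gt0.
have := ha _ (ltW a20); rewrite subr0 gtr0_norm// ltr_pdivrMr// mulr_natr mulr2n ltrDl => /(_ a0).
by rewrite ltr_norml => /andP[_]; have := Rt_gt0 a20; lra.
Qed.

Lemma clamped_rate_measurable : measurable_fun setT (fun y : R => Rt (Num.max y 0)).
Proof.
have mR : measurable_fun `[(0:R), +oo[ Rt by apply: subspace_continuous_measurable_fun.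
have := (measurable_restrictT Rt (measurable_itv `[(0:R), +oo[)).1 mR => mR'.
rewrite (_ : (fun y : R => _) = (Rt \_ `[0, +oo[) \o Num.max^~ 0).
  by apply: measurableT_comp => //; exact: measurable_maxr.
apply/funext => y /=; rewrite patchE mem_set//= in_itv/= andbT le_max lexx orbT//.
Qed.

End Rate.

Section Time_change.
Context (R : realType).
Variables (Rt z : R -> R).
Hypotheses (Rt_cont : {within `[(0:R), +oo[, continuous Rt}) (Rt_gt0 : forall x, 0 < x -> 0 < Rt x)
  (zreg : regular_path z) (z0 : 0 <= z 0) (mz : measurable_fun setT (fun v : R => z (Num.max v 0))).
Local Notation mu := (@lebesgue_measure R).
Local Notation T0 := (first_below z 0).
Local Notation eta := (eta_tc Rt z).

(** Both clamps are inactive on the domain of [eta_tc]; they make the integrand measurable on the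
    whole line. *)
Definition time_cost (v : R) : \bar R := (((Rt (Num.max (z (Num.max v 0)) 0))%:E)^-1)%E.

Lemma time_cost_measurable : measurable_fun setT time_cost.
Proof.
apply: (measurableT_comp (@measurable_inve R)).
exact: (measurableT_comp (clamped_rate_measurable Rt_cont)).
Qed.

Lemma time_cost_ge0 v : (0 <= time_cost v)%E.
Proof. by rewrite inve_ge0 lee_fin rate_ge0// le_max lexx orbT. Qed.

Lemma time_cost_at v : 0 <= v -> 0 <= z v -> time_cost v = (((Rt (z v))%:E)^-1)%E.
Proof. by move=> v0 zv; rewrite /time_cost (max_l v0) max_l. Qed.

Local Notation dom s := (`[0, s]%classic `&` [set v : R | (v%:E <= T0)%E]).

Let mT0 : measurable [set v : R | (v%:E <= T0)%E].
Proof.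
by rewrite -[X in measurable X]setTI; apply: (@emeasurable_fun_infty_c _ _ _ _ EFin measurableT) => //; exact/measurable_EFinP.
Qed.
Let mdom s : measurable (dom s). Proof. by apply: measurableI => //; exact: measurable_itv. Qed.

Lemma eta_tcE s : eta s = (\int[mu]_(v in dom s) time_cost v)%E.
Proof.
rewrite /eta_tc (_ : [set r : R | _] = dom s); last first.
  by apply/seteqP; split => v /=; rewrite in_itv/=; [move=> [-> [-> ?]]|move=> [/andP[-> ->] ?]].
apply: eq_integral => v; rewrite inE/= in_itv/= => -[/andP[v0 _] vT].
by rewrite time_cost_at// (le_first_below_ge zreg z0 v0 vT).
Qed.

Lemma eta_ge0 s : (0 <= eta s)%E.
Proof. by rewrite eta_tcE; apply: integral_ge0 => v _; exact: time_cost_ge0. Qed.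

Lemma eta_le s s' : s <= s' -> (eta s <= eta s')%E.
Proof.
move=> ss'; rewrite !eta_tcE; apply: ge0_subset_integral; [exact: mdom|exact: mdom|..].
- by apply: measurable_funTS; exact: time_cost_measurable.
- by move=> v _; exact: time_cost_ge0.
by move=> v /=; rewrite !in_itv/= => -[/andP[-> vs] ->]; rewrite (le_trans vs ss').
Qed.

Lemma eta_split s s' : 0 <= s -> s <= s' -> (s'%:E <= T0)%E ->
  (eta s' = eta s + \int[mu]_(v in `]s, s']) time_cost v)%E.
Proof.
move=> s0 ss' s'T; rewrite !eta_tcE -ge0_integral_setU//.
- congr integral; apply/seteqP; split => v /=; rewrite !in_itv/=.
    move=> [/andP[v0 vs'] vT]; have [vs|sv] := leP v s; [left|right] => //.
    by rewrite v0.
  case => [[/andP[-> vs] ->]|/andP[sv vs']]; first by rewrite (le_trans vs ss').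
  by rewrite vs' (le_trans s0 (ltW sv)) (le_trans _ s'T)// lee_fin.
- exact: mdom.
- by apply: measurable_funTS; exact: time_cost_measurable.
- by move=> v _; exact: time_cost_ge0.
- apply/disj_setPS => v /=; rewrite !in_itv/= => -[[/andP[_ vs] _] /andP[]].
  by rewrite ltNge vs.
Qed.

Lemma rate_path_near s e : 0 <= s -> (s%:E < T0)%E -> 0 < e ->
  exists2 a, 0 < a & forall v, s <= v -> v <= s + a ->
    [/\ (v%:E < T0)%E, 0 <= z v & `|Rt (z v) - Rt (z s)| < e].
Proof.
move=> s0 sT e0; have zs := before_first_below s0 sT.
have [a a0 ha] := rate_near Rt_cont zs e0.
have zc : z @ at_right s --> z s by case: zreg => + _; exact.
have [a1 a10 h1] := @right_continuous_lt _ z (z s + a) s zc ltac:(by rewrite ltrDl).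
have [a2 a20 h2] := @right_continuous_gt _ z (z s - a) s zc ltac:(by rewrite ltrBlDr ltrDl).
have [a3 a30 h3] : exists2 a3, 0 < a3 & ((s + a3)%:E < T0)%E.
  case: T0 sT => [t| |]//; rewrite ?lte_fin => st; last by exists 1 => //; exact: ltry.
  by exists ((t - s) / 2); [rewrite divr_gt0 ?subr_gt0|rewrite lte_fin; lra].
exists (Num.min (Num.min (a1 / 2) (a2 / 2)) a3).
  by rewrite !lt_min a30 !divr_gt0.
move=> v sv; rewrite -lerBlDl !le_min -andbA => /and3P[v1 v2 v3].
have vT : (v%:E < T0)%E by rewrite (le_lt_trans _ h3)// lee_fin -lerBlDl.
have v0 := le_trans s0 sv; have zv := before_first_below v0 vT.
split => //; apply: ha => //; rewrite ltr_norml; apply/andP; split.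
  by have := h2 v sv ltac:(lra); lra.
by have := h1 v sv ltac:(lra); lra.
Qed.

(** Right after [s] the rate is bounded above, so the cost is bounded below on an interval of
    positive length. *)
Lemma eta_lt s s' : 0 <= s -> s < s' -> (s%:E < T0)%E -> (eta s < +oo)%E -> (eta s < eta s')%E.
Proof.
move=> s0 ss' sT etas; have [a a0 ha] := rate_path_near s0 sT ltr01.
pose s1 := Num.min s' (s + a); have ss1 : s < s1 by rewrite lt_min ss' ltrDl.
apply: lt_le_trans (_ : eta s1 <= _)%E; last by apply: eta_le; rewrite ge_min lexx.
have s1a : s1 <= s + a by rewrite ge_min lexx orbT.
have [s1T _ _] := ha s1 (ltW ss1) s1a.
rewrite (eta_split s0 (ltW ss1) (ltW s1T)).
have zs := before_first_below s0 sT.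
pose C := Rt (z s) + 1; have C0 : 0 < C by rewrite /C ltr_wpDl// rate_ge0.
rewrite lteDl ?ge0_fin_numE ?eta_ge0//.
apply: (@lt_le_trans _ _ (\int[mu]_(v in `]s, s1]) (cst (C^-1)%:E v))%E).
  rewrite integral_cst//= lebesgue_measure_itv/= lte_fin ss1 -EFinB -EFinM lte_fin.
  by rewrite mulr_gt0 ?invr_gt0 ?subr_gt0.
apply: ge0_le_integral => //.
- by move=> v _; rewrite lee_fin invr_ge0 ltW.
- by apply: measurable_funTS; exact: time_cost_measurable.
move=> v /=; rewrite in_itv/= => /andP[sv vs1].
have [_ zv Rv] := ha v (ltW sv) (le_trans vs1 s1a).
rewrite time_cost_at ?(le_trans s0 (ltW sv))//.
apply: inve_ge_fin => //; first exact: rate_ge0.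
by move: Rv; rewrite ltr_norml => /andP[_]; rewrite /C; lra.
Qed.

(** At a positive level the rate stays above half its value for a while, so the clock is right
    continuous there. *)
Lemma eta_right s e : 0 <= s -> 0 < z s -> (s%:E < T0)%E -> 0 < e ->
  exists2 a, 0 < a & forall s', s <= s' -> s' <= s + a ->
    (s'%:E < T0)%E /\ (eta s' <= eta s + e%:E)%E.
Proof.
move=> s0 zs sT e0; have Rs := Rt_gt0 zs.
pose c := Rt (z s) / 2; have c0 : 0 < c by rewrite divr_gt0.
have [a a0 ha] := rate_path_near s0 sT c0.
exists (Num.min a (e * c)); first by rewrite lt_min a0 mulr_gt0.
move=> s' ss'; rewrite -lerBlDl le_min => /andP[s'a s'e].
have s'a' : s' <= s + a by rewrite -lerBlDl.
have [s'T _ _] := ha s' ss' s'a'; split => //.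
rewrite (eta_split s0 ss' (ltW s'T)) leeD2l//.
apply: (@le_trans _ _ (\int[mu]_(v in `]s, s']) (cst (c^-1)%:E v))%E).
  apply: ge0_le_integral => //.
  - by move=> v _; exact: time_cost_ge0.
  - by apply: measurable_funTS; exact: time_cost_measurable.
  - move=> v /=; rewrite in_itv/= => /andP[sv vs'].
    have [_ zv Rv] := ha v (ltW sv) (le_trans vs' s'a').
    rewrite time_cost_at ?(le_trans s0 (ltW sv))//.
    by apply: inve_le_fin => //; move: Rv; rewrite ltr_norml => /andP[+ _]; rewrite /c; lra.
rewrite integral_cst//= lebesgue_measure_itv/= lte_fin; case: ifPn => _.
  by rewrite -EFinB -EFinM lee_fin mulrC ler_pdivrMr.
by rewrite mule0 lee_fin ltW.
Qed.

End Time_change.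

Section Time_changed_passage.
Context (R : realType).
Variables (Rt z : R -> R).
Hypotheses (Rt_cont : {within `[(0:R), +oo[, continuous Rt}) (Rt_gt0 : forall x, 0 < x -> 0 < Rt x)
  (zreg : regular_path z) (z0 : 0 <= z 0) (mz : measurable_fun setT (fun v : R => z (Num.max v 0))).
Local Notation T0 := (first_below z 0).
Local Notation eta := (eta_tc Rt z).
Local Notation X := (Xpath Rt z).

Lemma eta_inv_ge0 t : (0 <= eta_inv Rt z t)%E.
Proof. by apply: le_ereal_inf_tmp => _ [s [s0 _] <-]; rewrite lee_fin. Qed.

Lemma eta_inv_le s t : 0 <= s -> (t%:E < eta s)%E -> (eta_inv Rt z t <= s%:E)%E.
Proof. by move=> s0 ts; apply: ereal_inf_lbound; exists s. Qed.

Lemma eta_inv_ge s t : 0 <= s -> (eta s <= t%:E)%E -> (s%:E <= eta_inv Rt z t)%E.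
Proof.
move=> s0 st; apply: le_ereal_inf_tmp => _ [r [r0 tr] <-]; rewrite lee_fin leNgt.
apply/negP => rs; move: tr; rewrite ltNge => /negP; apply; apply: le_trans st.
exact: (eta_le Rt_cont Rt_gt0 zreg z0 mz (ltW rs)).
Qed.

Lemma XpathE r t : 0 <= r -> Order.min (eta_inv Rt z t) T0 = r%:E -> X t = (z r)%:E.
Proof. by move=> r0 h; rewrite /Xpath h. Qed.

Lemma Xpath_lt_fin b t : (X t < b%:E)%E ->
  exists r, [/\ 0 <= r, Order.min (eta_inv Rt z t) T0 = r%:E & z r < b].
Proof.
rewrite /Xpath; have : (0 <= Order.min (eta_inv Rt z t) T0)%E.
  by rewrite le_min eta_inv_ge0 first_below_ge0.
by case: (Order.min _ _) => // r; rewrite lee_fin lte_fin => r0 zr; exists r.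
Qed.

Lemma Xpath_finite t : (T0 < +oo)%E -> (X t < +oo)%E.
Proof.
move=> T0f; rewrite /Xpath.
have m0 : (0 <= Order.min (eta_inv Rt z t) T0)%E by rewrite le_min eta_inv_ge0 first_below_ge0.
have moo : (Order.min (eta_inv Rt z t) T0 < +oo)%E by rewrite gt_min T0f orbT.
by move: m0 moo; case: (Order.min _ _) => // r _ _; rewrite ltry.
Qed.

Lemma first_below_pos b t : 0 < b -> b <= z 0 -> first_below z b = t%:E -> (t%:E < T0)%E.
Proof.
move=> b0 bz tE; have t0 : 0 <= t by rewrite -lee_fin -tE first_below_ge0.
have zt : 0 < z t by rewrite (first_below_attained zreg bz tE).
have zc : z @ at_right t --> z t by case: zreg => + _; exact.
have [e e0 he] := right_continuous_gt zc zt.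
apply: (@lt_le_trans _ _ (t + e)%:E); first by rewrite lte_fin ltrDl.
rewrite leNgt; apply/negP => /first_below_ltP[s [s0 ste zs]].
have [ts|st] := leP t s; first by have := he s ts ste; lra.
have : b <= z s by apply: (before_first_below s0); rewrite tE lte_fin.
lra.
Qed.

(** If the clock had not yet reached its value at the passage, X could be at or past the passage
    only by being exactly there, where the level is b and not below. *)
Lemma Tb_ge b t : b <= z 0 -> (X t < b%:E)%E ->
  exists2 r, first_below z b = r%:E & (eta r <= t%:E)%E.
Proof.
move=> bz /Xpath_lt_fin[r [r0 rE zr]].
have tr : (first_below z b <= r%:E)%E by exact: first_below_le.
have [s sE] : exists s, first_below z b = s%:E.
  by move: tr (first_below_ge0 z b); case: (first_below z b) => // s _ _; exists s.
exists s => //; rewrite leNgt; apply/negP => ts.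
have s0 : 0 <= s by rewrite -lee_fin -sE first_below_ge0.
have ri : (r%:E <= eta_inv Rt z t)%E by rewrite -rE ge_min lexx.
have rs : r = s.
  apply/eqP; rewrite eq_le -!lee_fin -{2}sE tr andbT.
  exact: (le_trans ri (eta_inv_le s0 ts)).
by move: zr; rewrite rs (first_below_attained zreg bz sE) ltxx.
Qed.

(** Shortly after the passage there is an interval on which the path is below b and the clock
    strictly increases; a rational clock value taken inside reads off a level below b. *)
Lemma Tb_lt b t c : 0 < b -> b <= z 0 -> first_below z b = t%:E -> (eta t < c%:E)%E ->
  exists q : rat, [/\ 0 <= ratr q :> R, ratr q < c & (X (ratr q) < b%:E)%E].
Proof.
move=> b0 bz tE etc; have t0 : 0 <= t by rewrite -lee_fin -tE first_below_ge0.
have tT := first_below_pos b0 bz tE.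
have zt : 0 < z t by rewrite (first_below_attained zreg bz tE).
have eta0 s : (0 <= eta s)%E := eta_ge0 Rt_cont Rt_gt0 zreg z0 s.
have [a aE] : exists a, eta t = a%:E.
  by move: (eta0 t) etc; case: (eta t) => // a _ _; exists a.
have e0 : 0 < (c - a) / 2 by rewrite divr_gt0// subr_gt0 -lte_fin -aE.
have [e e_gt0 he] := eta_right Rt_cont Rt_gt0 zreg z0 mz t0 zt tT e0.
have : (first_below z b < (t + e)%:E)%E by rewrite tE lte_fin ltrDl.
move=> /first_below_ltP[s [s0 ste zs]].
have ts : t <= s by rewrite -lee_fin -tE first_below_le.
have [e1 e10 he1] := below_right_open zreg s0 zs.
(* The halved [e1] keeps [s'] itself within the time span where the path is below b. *)
pose s' := Num.min (s + e1 / 2) (t + e).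
have ss' : s < s' by rewrite lt_min ste andbT ltrDl divr_gt0.
have s'e : s' <= t + e by rewrite ge_min lexx orbT.
have s's : s' < s + e1 by rewrite gt_min; apply/orP; left; lra.
have [sT _] := he s ts (ltW ste).
have [s'T] := he s' (le_trans ts (ltW ss')) s'e; rewrite aE -EFinD => etas'.
have etas'f : (eta s' < +oo)%E by rewrite (le_lt_trans etas')// ltry.
have etass' : (eta s <= eta s')%E by exact: (eta_le Rt_cont Rt_gt0 zreg z0 mz (ltW ss')).
have etasf := le_lt_trans etass' etas'f.
have := eta_lt Rt_cont Rt_gt0 zreg z0 mz s0 ss' sT etasf.
have fs : eta s = (fine (eta s))%:E by rewrite fineK// ge0_fin_numE.
have fs' : eta s' = (fine (eta s'))%:E by rewrite fineK// ge0_fin_numE.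
rewrite fs fs' lte_fin => /rat_itvP[q /andP[q1 q2]].
have q1' : (eta s <= (ratr q)%:E)%E by rewrite fs lee_fin ltW.
have q2' : ((ratr q)%:E < eta s')%E by rewrite fs' lte_fin.
exists q; split.
- by rewrite (le_trans _ (ltW q1))// fine_ge0.
- by rewrite (lt_le_trans q2)// -lee_fin -fs' (le_trans etas')// lee_fin; lra.
have i1 := eta_inv_ge s0 q1'.
have i2 := eta_inv_le (le_trans s0 (ltW ss')) q2'.
have [r rE] : exists r, eta_inv Rt z (ratr q) = r%:E.
  by move: i1 i2; case: (eta_inv Rt z (ratr q)) => // r _ _; exists r.
rewrite rE !lee_fin in i1 i2.
rewrite (@XpathE r); first by rewrite lte_fin he1// (le_lt_trans i2).
- exact: le_trans s0 i1.
- by rewrite rE min_l// ltW// (le_lt_trans _ s'T)// lee_fin.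
Qed.

(** The clock is 0 at time 0, where a single point carries no mass even if the cost there is
    infinite, and positive immediately afterwards unless the path is stopped at once. *)
Lemma Xpath0 : X 0 = (z 0)%:E.
Proof.
apply: XpathE => //; apply/eqP; rewrite eq_le le_min eta_inv_ge0 first_below_ge0 andbT.
have [->|T00] := eqVneq T0 0%E; first by rewrite ge_min lexx orbT.
have T0p : (0%:E < T0)%E by rewrite lt_neqAle eq_sym T00 first_below_ge0.
have H : (eta_inv Rt z 0 <= 0%:E)%E; last by rewrite ge_min H.
apply/lee_addgt0Pr => e e0; rewrite add0e.
apply: (eta_inv_le (ltW e0)).
have eta00 : eta 0 = 0%E.
  rewrite (eta_tcE Rt zreg z0); apply/eqP.
  rewrite eq_le integral_ge0 ?andbT; last by move=> v _; exact: (time_cost_ge0 z Rt_cont Rt_gt0).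
  rewrite -(@integral_set1 _ (time_cost Rt z) 0); apply: ge0_subset_integral.
  - apply: measurableI; first exact: measurable_itv.
    rewrite -[X in measurable X]setTI.
    by apply: (@emeasurable_fun_infty_c _ _ _ _ EFin measurableT) => //; exact/measurable_EFinP.
  - by [].
  - by apply: measurable_funTS; exact: (time_cost_measurable Rt_cont mz).
  - by move=> v _; exact: (time_cost_ge0 z Rt_cont Rt_gt0).
  - by move=> v [/=]; rewrite in_itv/= -eq_le => /eqP <-.
have := eta_lt Rt_cont Rt_gt0 zreg z0 mz (lexx 0) e0 T0p; rewrite eta00; apply; exact: ltry.
Qed.

End Time_changed_passage.

(** * Measurability in the starting point *)

Section Joint_measurability.
Context d (T : measurableType d) (R : realType) (P : probability T R)
  (L : R -> T -> R) (Ps : R -> R).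
Hypothesis HL : spec_pos_levy P L Ps.
Variable Rt : R -> R.
Hypotheses (Rt_cont : {within `[(0:R), +oo[, continuous Rt}) (Rt_gt0 : forall x, 0 < x -> 0 < Rt x).
Local Notation mu := (@lebesgue_measure R).

(* The starting point is clamped to [[0, +oo[], so that the maps below are measurable on the whole product. *)
Definition start_path (p : R * T) (r : R) : R := Num.max p.1 0 + L r p.2.

Lemma start_path_reg p : regular_path (start_path p).
Proof. exact: (level_reg HL (Num.max p.1 0) p.2). Qed.

Lemma start_path0 p : start_path p 0 = Num.max p.1 0.
Proof. by rewrite /start_path (levy0 HL) addr0. Qed.

Lemma start_path0_ge0 p : 0 <= start_path p 0.
Proof. by rewrite start_path0 le_max lexx orbT. Qed.

Let mstart : measurable_fun setT (fun p : R * T => Num.max p.1 0 : R).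
Proof. by apply: measurable_maxr => //; exact: measurable_fst. Qed.

Lemma start_path_measurable r : measurable_fun setT (fun p => start_path p r).
Proof.
apply: measurable_funD => //; apply: (measurableT_comp _ measurable_snd).
exact (levy_measurable HL r).
Qed.

Lemma start_path_joint : measurable_fun setT (fun q : R * (R * T) => start_path q.2 (Num.max q.1 0)).
Proof.
apply: measurable_funD; first exact: (measurableT_comp mstart measurable_snd).
have m2 : measurable_fun setT (fun q : R * (R * T) => (q.1, q.2.2)).
  apply: measurable_fun_pair; first exact: measurable_fst.
  exact: (measurableT_comp measurable_snd measurable_snd).
exact (measurableT_comp (levy_joint_measurable HL) m2).
Qed.

Lemma start_path_section p : measurable_fun setT (fun v : R => start_path p (Num.max v 0)).
Proof.
have := measurableT_comp start_path_joint (@pair2_measurable _ _ R (R * T)%type p).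
exact.
Qed.

Let rat_union (F : rat -> set (R * T)) : (forall q, measurable (F q)) ->
  measurable (\bigcup_q F q).
Proof. by move=> mF; apply: countable_bigcupT_measurable => //; exact: countableP. Qed.

Let mlt (f : R * T -> R) c : measurable_fun setT f -> measurable [set p | f p < c].
Proof.
move=> mf; have := mf measurableT _ (measurable_itv `]-oo, c[).
by rewrite setTI preimage_itvNyo.
Qed.

Lemma start_passage_measurable b : measurable_fun setT (fun p => first_below (start_path p) b).
Proof.
apply: emeasurable_from_lt => c.
have -> : [set p | (first_below (start_path p) b < c%:E)%E] = \bigcup_(q in [set: rat])
    (if (0 <= ratr q :> R) && (ratr q < c) then [set p | start_path p (ratr q) < b] else set0).
  apply/seteqP; split => p /=.
    move=> /(first_below_lt_ratP _ (start_path_reg p))[q [q0 qc zq]].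
    by exists q => //; rewrite q0 qc.
  move=> [q _]; case: ifPn => // /andP[q0 qc]/= zq.
  by apply/(first_below_lt_ratP _ (start_path_reg p)); exists q.
apply: rat_union => q; case: ifP => // _.
by apply: mlt; exact: start_path_measurable.
Qed.

Let mnat (A : set R) : measurable A -> measurable_fun setT (fun q : R * (R * T) => \1_A q.1 : R).
Proof. by move=> mA; exact: (measurableT_comp (measurable_indic mA) measurable_fst). Qed.

Lemma before_passage_measurable b :
  measurable_fun setT (fun q : R * (R * T) => ((q.1%:E <= first_below (start_path q.2) b)%E)%:R : R).
Proof.
apply: measurable_fun_natr; apply: measurable_fun_lee.
  by apply/measurable_EFinP; exact: measurable_fst.
exact: (measurableT_comp (start_passage_measurable b) measurable_snd).
Qed.

Lemma start_eta_measurable s : measurable_fun setT (fun p => eta_tc Rt (start_path p) s).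
Proof.
pose F (q : R * (R * T)) := ((\1_(`[0, s]%classic : set R) q.1 *
  ((q.1%:E <= first_below (start_path q.2) 0)%E)%:R)%:E * time_cost Rt (start_path q.2) q.1)%E.
have F0 q : (0 <= F q)%E by rewrite mule_ge0 ?lee_fin ?mulr_ge0//; exact: time_cost_ge0.
have mF : measurable_fun setT F.
  apply: emeasurable_funM.
    apply/measurable_EFinP; apply: measurable_funM; last exact: before_passage_measurable.
    by apply: mnat; exact: measurable_itv.
  apply: (measurableT_comp (@measurable_inve R)).
  exact: (measurableT_comp (clamped_rate_measurable Rt_cont) start_path_joint).
rewrite (_ : (fun p => _) = fun p => \int[mu]_v F (v, p))%E.
  exact: (@measurable_fun_fubini_tonelli_G _ _ _ _ _ mu F mF F0).
apply/funext => p; rewrite (eta_tcE _ (start_path_reg p) (start_path0_ge0 p)) integral_mkcond.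
apply: eq_integral => v _; rewrite patchE /F/= indicE in_setI.
case: (v \in _) => /=; last by rewrite mul0r mul0e.
have [vT|vT] := boolP (v%:E <= first_below (start_path p) 0)%E.
  by rewrite mem_set//= mulr1 mul1e.
by rewrite memNset/= ?mulr0 ?mul0e//; exact/negP.
Qed.

Lemma start_eta_inv_measurable t : measurable_fun setT (fun p => eta_inv Rt (start_path p) t).
Proof.
apply: emeasurable_from_lt => c.
have -> : [set p | (eta_inv Rt (start_path p) t < c%:E)%E] = \bigcup_(q in [set: rat])
    (if (0 <= ratr q :> R) && (ratr q < c)
     then [set p | (t%:E < eta_tc Rt (start_path p) (ratr q))%E] else set0).
  apply/seteqP; split => p /=.
    move=> /ereal_inf_lt[_ [r [r0 tr] <-]]; rewrite lte_fin => /rat_itvP[q /andP[rq qc]].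
    exists q => //; rewrite qc (le_trans r0 (ltW rq))/=.
    apply: (lt_le_trans tr).
    exact: (eta_le Rt_cont Rt_gt0 (start_path_reg p) (start_path0_ge0 p) (start_path_section p) (ltW rq)).
  move=> [q _]; case: ifPn => // /andP[q0 qc]/= tq.
  by apply: (le_lt_trans (eta_inv_le q0 tq)); rewrite lte_fin.
apply: rat_union => q; case: ifP => // _.
rewrite -[X in measurable X]setTI; apply: emeasurable_fun_o_infty => //.
exact: start_eta_measurable.
Qed.

(** The time-changed path reads Z at the random time [rho], so joint measurability in time and
    sample point applies. *)
Lemma time_changed_lt_measurable t b : measurable [set p | (Xpath Rt (start_path p) t < b%:E)%E].
Proof.
pose rho (p : R * T) := Order.min (eta_inv Rt (start_path p) t) (first_below (start_path p) 0).
have mrho : measurable_fun setT rho.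
  by apply: measurable_mine; [exact: start_eta_inv_measurable|exact: start_passage_measurable].
have -> : [set p | (Xpath Rt (start_path p) t < b%:E)%E] =
    [set p | (rho p < +oo)%E] `&` [set p | start_path p (Num.max (fine (rho p)) 0) < b].
  apply/seteqP; split => p /=.
    by move=> /Xpath_lt_fin[r [r0 rE zr]]; rewrite /rho rE ltry/= max_l.
  move=> [ry zr].
  have r0 : (0 <= rho p)%E by rewrite le_min eta_inv_ge0 first_below_ge0.
  have rE : rho p = (fine (rho p))%:E by rewrite fineK// ge0_fin_numE.
  rewrite max_l ?fine_ge0// in zr.
  by rewrite (XpathE (fine_ge0 r0) rE) lte_fin.
apply: measurableI.
  by rewrite -[X in measurable X]setTI; apply: emeasurable_fun_infty_o.
apply: mlt.
have m2 : measurable_fun setT (fun p : R * T => (fine (rho p), p)).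
  apply: measurable_fun_pair => //.
  by apply: (measurableT_comp (fine_measurable measurableT)).
exact (measurableT_comp start_path_joint m2).
Qed.

End Joint_measurability.

(** * Mean and tails of the time-changed passage time *)

Section Mean_passage.
Context d (T : measurableType d) (R : realType) (P : probability T R)
  (L : R -> T -> R) (Ps W : R -> R).
Hypotheses (HL : spec_pos_levy P L Ps) (scW : scale_function Ps W)
  (Ps_ge0 : forall q, 0 < q -> 0 <= Ps q).
Variable Rt : R -> R.
Hypotheses (Rt_cont : {within `[(0:R), +oo[, continuous Rt}) (Rt_gt0 : forall x, 0 < x -> 0 < Rt x).
Local Notation mu := (@lebesgue_measure R).
Local Notation path := (start_path L).

Let Ps_gt0 q : 0 < q -> 0 < Ps q. Proof. exact: (scale_exponent_gt0 scW Ps_ge0). Qed.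
Let W0 y : 0 <= W y. Proof. exact: (scale_ge0 scW Ps_ge0). Qed.

Lemma Xof_start x w : 0 <= x -> Xof Rt L x w = Xpath Rt (path (x, w)).
Proof. by move=> x0; rewrite /Xof /start_path /= max_l. Qed.

Lemma Tb_ge0 (Y : R -> \bar R) b : (0 <= Tb Y b)%E.
Proof. by apply: le_ereal_inf_tmp => _ [s [s0 _] <-]; rewrite lee_fin. Qed.

Lemma Tb_le (Y : R -> \bar R) b t : 0 <= t -> (Y t < b%:E)%E -> (Tb Y b <= t%:E)%E.
Proof. by move=> t0 Yt; apply: ereal_inf_lbound; exists t. Qed.

Section Start.
Variables (p : R * T) (b : R).
Hypothesis b0 : 0 < b.
Let zreg := start_path_reg HL p.
Let z0 := start_path0_ge0 HL p.
Let mz := start_path_section HL p.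
Local Notation TX := (Tb (Xpath Rt (path p)) b).

Lemma Tb_start_below : Num.max p.1 0 < b -> (Xpath Rt (path p) 0 < b%:E)%E.
Proof. by move=> pb; rewrite (Xpath0 Rt_cont Rt_gt0 zreg z0 mz) (start_path0 HL) lte_fin. Qed.

(** The reduction to rational times is drawn from the clock, through [Tb_lt], and not from path
    regularity of X; a start below b is witnessed by time 0. *)
Lemma Tb_lt_ratP c : reflect
  (exists q : rat, [/\ 0 <= ratr q :> R, ratr q < c & (Xpath Rt (path p) (ratr q) < b%:E)%E])
  (TX < c%:E)%E.
Proof.
apply: (iffP idP) => [|[q [q0 qc Xq]]]; last by rewrite (le_lt_trans (Tb_le q0 Xq))// lte_fin.
move=> /ereal_inf_lt[_ [t [t0 Xt] <-]]; rewrite lte_fin => tc.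
have [pb|bp] := ltP (Num.max p.1 0) b.
  by exists 0; rewrite rmorph0; split; [by []|exact: le_lt_trans tc|exact: Tb_start_below].
have bz : b <= path p 0 by rewrite (start_path0 HL).
have [r rE etar] := Tb_ge zreg bz Xt.
apply: (Tb_lt Rt_cont Rt_gt0 zreg z0 mz b0 bz rE).
by rewrite (le_lt_trans etar)// lte_fin.
Qed.

Hypothesis bp : b <= Num.max p.1 0.
Let bz : b <= path p 0. Proof. by rewrite (start_path0 HL). Qed.

Lemma Tb_eta t : first_below (path p) b = t%:E -> TX = eta_tc Rt (path p) t.
Proof.
move=> tE; apply/eqP; rewrite eq_le; apply/andP; split; last first.
  apply: le_ereal_inf_tmp => _ [s [s0 Xs] <-].
  by have [r] := Tb_ge zreg bz Xs; rewrite tE => -[->].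
have eta0 := eta_ge0 Rt_cont Rt_gt0 zreg z0 t.
case etE : (eta_tc Rt (path p) t) eta0 => [a| |]// a0; last by rewrite leey.
apply/lee_addgt0Pr => e e0.
have : (eta_tc Rt (path p) t < (a + e)%:E)%E by rewrite etE lte_fin ltrDl.
move=> /(Tb_lt Rt_cont Rt_gt0 zreg z0 mz b0 bz tE)[q [q0 qa Xq]].
by rewrite (le_trans (Tb_le q0 Xq))// -EFinD lee_fin ltW.
Qed.

Lemma Tb_infinite : first_below (path p) b = +oo%E -> TX = +oo%E.
Proof.
move=> tE; apply/eqP; rewrite -leye_eq; apply: le_ereal_inf_tmp => _ [s [s0 Xs] <-].
by have [r] := Tb_ge zreg bz Xs; rewrite tE.
Qed.

(** Up to the passage the levels are at least b > 0, where the extended inverse of the rate agrees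
    with [inv_rate]. *)
Lemma Tb_occupation : (first_below (path p) b < +oo)%E ->
  TX = occupation L (Num.max p.1 0) b (inv_rate Rt `[b, +oo[) p.2.
Proof.
move=> tf; have tE : first_below (path p) b = (fine (first_below (path p) b))%:E.
  by rewrite fineK// ge0_fin_numE// first_below_ge0.
rewrite (Tb_eta tE) (eta_tcE _ zreg z0) integral_mkcond; apply: eq_integral => v _; rewrite patchE.
set t := fine _ in tE *; have tT := first_below_pos zreg b0 bz tE.
rewrite /alive_reward/= -[first_below _ b]/(first_below (path p) b) tE lee_fin indicE mem_setE in_itv/= andbT.
case: ifPn => [|].
  rewrite inE/= in_itv/= => -[/andP[v0 vt] _]; rewrite v0 vt !mul1r (max_l v0).
  have bv : b <= path p v by apply: (le_first_below_ge zreg bz v0); rewrite tE lee_fin.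
  have zv : 0 < path p v by exact: lt_le_trans bv.
  rewrite time_cost_at// ?(ltW zv)// inver gt_eqF ?Rt_gt0// /inv_rate indicE mem_set ?mul1r//=.
  by rewrite in_itv/= andbT.
move=> nv; have [v0|] := leP 0 v; last by rewrite mul0r.
have [vt|] := leP v t; last by rewrite mul0r mulr0.
case/negP: nv; rewrite inE/=; split; first by rewrite in_itv/= v0.
by rewrite (le_trans _ (ltW tT))// lee_fin.
Qed.

End Start.

Lemma Tb_measurable b : 0 < b ->
  measurable_fun setT (fun p : R * T => Tb (Xpath Rt (path p)) b).
Proof.
move=> b0; apply: emeasurable_from_lt => c.
have -> : [set p | (Tb (Xpath Rt (path p)) b < c%:E)%E] = \bigcup_(q in [set: rat])
    (if (0 <= ratr q :> R) && (ratr q < c)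
     then [set p | (Xpath Rt (path p) (ratr q) < b%:E)%E] else set0).
  apply/seteqP; split => p /=.
    by move=> /(Tb_lt_ratP p b0)[q [q0 qc Xq]]; exists q => //; rewrite q0 qc.
  by move=> [q _]; case: ifPn => // /andP[q0 qc]/= Xq; apply/(Tb_lt_ratP p b0); exists q.
apply: countable_bigcupT_measurable => [|q]; first exact: countableP.
by case: ifP => // _; exact: (time_changed_lt_measurable HL Rt_cont Rt_gt0).
Qed.

Lemma Tb_Xof_measurable x b : 0 <= x -> 0 < b ->
  measurable_fun setT (fun w => Tb (Xof Rt L x w) b).
Proof.
move=> x0 b0; under eq_fun do rewrite Xof_start//.
exact: (measurableT_comp (Tb_measurable b0) (pair1_measurable x)).
Qed.

Lemma mean_Tb_le x b : 0 <= x -> 0 < b -> (\int[P]_w Tb (Xof Rt L x w) b <= m_of Rt W b)%E.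
Proof.
move=> x0 b0; have mpos : (0 <= m_of Rt W b)%E.
  rewrite m_ofE//; apply: integral_ge0 => y _; rewrite mule_ge0// ?lee_fin//.
  by apply: (inv_rate_ge0 Rt_gt0); exact: itv_ge_gt0.
have [xb|bx] := ltP x b.
  rewrite integral0_eq// => w _; apply/eqP; rewrite eq_le Tb_ge0 andbT.
  apply: Tb_le => //; rewrite Xof_start//.
  by apply: (@Tb_start_below (x, w)); rewrite /= max_l.
have mI := inv_rate_measurable Rt_cont (measurable_itv `[b, +oo[) (itv_ge_gt0 b0).
have I0 y := inv_rate_ge0 Rt_gt0 y (itv_ge_gt0 b0).
rewrite (_ : (\int[P]_w _)%E = \int[P]_w occupation L x b (inv_rate Rt `[b, +oo[) w)%E.
  rewrite (le_trans (occupation_mean_le HL scW Ps_ge0 bx mI I0))// m_ofE//.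
  by under eq_integral do rewrite muleC.
apply: ae_eq_integral => //.
- exact: Tb_Xof_measurable.
- exact: (occupation_measurable HL x b mI I0).
have mt := passage_lt_measurable HL x b +oo%E.
exists (~` [set w | (first_below (fun r => (x + L r w)%R) b < +oo)%E]); split; first exact: measurableC.
  have := probability_setC P mt; rewrite (passage_finite HL Ps_gt0 bx) subee//; exact.
move=> w /= H; apply: contra_not H => tw _; rewrite Xof_start//.
have := @Tb_occupation (x, w) b b0; rewrite /= (max_l x0); apply => //.
by rewrite /start_path/= (max_l x0).
Qed.

Lemma occupation_le_Tb x b N w : 0 < b -> b <= x ->
  (occupation L x b (inv_rate Rt `[b, N[) w <= Tb (Xof Rt L x w) b)%E.
Proof.
move=> b0 bx; have x0 : 0 <= x by exact: le_trans (ltW b0) bx.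
have bm : b <= Num.max (x, w).1 0 by rewrite /= max_l.
rewrite Xof_start//; have [tw|] := ltP (first_below (path (x, w)) b) +oo%E; last first.
  by rewrite leye_eq => /eqP tw; rewrite Tb_infinite ?leey.
rewrite Tb_occupation//= (max_l x0).
have mI := inv_rate_measurable Rt_cont (measurable_itv `[b, +oo[) (itv_ge_gt0 b0).
have I0 y := inv_rate_ge0 Rt_gt0 y (itv_ge_gt0 b0).
have mIN := inv_rate_measurable Rt_cont (measurable_itv `[b, N[) (itv_geN_gt0 b0).
have IN0 y := inv_rate_ge0 Rt_gt0 y (@itv_geN_gt0 _ b N b0).
have sec (h : R -> R) (mh : measurable_fun setT h) (h0 : forall y, 0 <= h y) :
    measurable_fun setT (fun v : R => (alive_reward L x b h (v, w))%:E).
  apply/measurable_EFinP.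
  exact (measurableT_comp (alive_reward_measurable HL x b mh) (pair2_measurable w)).
apply: ge0_le_integral => //.
- by move=> v _; rewrite lee_fin alive_reward_ge0.
- exact: sec.
- exact: sec.
move=> v _; rewrite lee_fin /alive_reward !ler_wpM2l//.
set y := x + _; rewrite {1}/inv_rate indicE; have [|_] := boolP (y \in _); last by rewrite mul0r.
rewrite inE/= in_itv/= => /andP[by_ _].
by rewrite /inv_rate indicE mem_set//= in_itv/= by_.
Qed.

Lemma inv_rate_bounded b N : 0 < b -> exists H, forall y, inv_rate Rt `[b, N[ y <= H.
Proof.
move=> b0; have [Nb|bN] := ltP N b.
  exists 0 => y; rewrite /inv_rate indicE memNset ?mul0r//= in_itv/= => /andP[by_ yN]; lra.
have Rc : {within `[b, N], continuous Rt}.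
  apply: continuous_subspaceW Rt_cont => y /=; rewrite !in_itv/= andbT => /andP[by_ _].
  exact: le_trans (ltW b0) by_.
have [c cbN cmin] := EVT_min bN Rc.
have c0 : 0 < c by move: cbN; rewrite in_itv/= => /andP[bc _]; exact: lt_le_trans bc.
exists (Rt c)^-1 => y; rewrite /inv_rate indicE; have [|_] := boolP (y \in _); last first.
  by rewrite mul0r invr_ge0 ltW// Rt_gt0.
rewrite inE/= in_itv/= => /andP[by_ yN]; have y0 := lt_le_trans b0 by_.
by rewrite mul1r lef_pV2 ?posrE ?Rt_gt0// cmin// in_itv/= by_ ltW.
Qed.

Local Notation truncated_mean b N :=
  (\int[mu]_y ((inv_rate Rt `[b, N[ y)%:E * (W (y - b))%:E))%E.

Let mIN b N : 0 < b -> measurable_fun setT (inv_rate Rt `[b, N[).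
Proof. by move=> b0; exact: (inv_rate_measurable Rt_cont (measurable_itv `[b, N[) (itv_geN_gt0 b0)). Qed.
Let IN0 b N y : 0 < b -> 0 <= inv_rate Rt `[b, N[ y.
Proof. by move=> b0; exact: (inv_rate_ge0 Rt_gt0 y (itv_geN_gt0 b0)). Qed.

Lemma truncated_mean_ge0 b N : 0 < b -> (0 <= truncated_mean b N)%E.
Proof. by move=> b0; apply: integral_ge0 => y _; rewrite mule_ge0// lee_fin// IN0. Qed.

Lemma truncated_mean_lty b N : 0 < b -> (truncated_mean b N < +oo)%E.
Proof.
move=> b0; have [H hH] := inv_rate_bounded N b0.
have H0 : 0 <= H by apply: le_trans (hH 0); exact: IN0.
apply: (@le_lt_trans _ _ (\int[mu]_(y in `[b, N]) (cst (H * W (N - b))%:E y))%E); last first.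
  rewrite integral_cst//= lebesgue_measure_itv/=; case: ifP => _; last by rewrite mule0 ltry.
  by rewrite -EFinB -EFinM ltry.
rewrite [leRHS]integral_mkcond; apply: ge0_le_integral => //.
- by move=> y _; rewrite mule_ge0// lee_fin// IN0.
- apply/measurable_EFinP; apply: measurable_funM; first exact: mIN.
  by apply: (measurableT_comp (scale_measurable scW)); exact: measurable_funB.
- exact ((measurable_restrictT (cst (H * W (N - b))%:E) (measurable_itv `[b, N])).1 (measurable_cst _)).
move=> y _; rewrite patchE; have [|yn] := boolP (y \in _).
  rewrite inE/= in_itv/= => /andP[by_ yN]; rewrite -EFinM lee_fin ler_pM ?IN0//.
  by apply: (scale_le scW); rewrite ?subr_ge0// lerD2r.
rewrite /inv_rate indicE memNset ?mul0r ?mul0e//=; apply/negP; apply: contra yn.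
by rewrite inE/= !in_itv/= => /andP[-> /ltW ->].
Qed.

Lemma occupation_truncated_mean x b N : 0 < b -> b <= x -> N <= x ->
  (\int[P]_w occupation L x b (inv_rate Rt `[b, N[) w = truncated_mean b N)%E.
Proof.
move=> b0 bx Nx; rewrite (occupation_mean HL scW Ps_ge0 bx (mIN N b0) (fun y => IN0 N y b0)).
  by apply: eq_integral => y _; rewrite muleC.
move=> y xy; rewrite /inv_rate indicE memNset ?mul0r//= in_itv/= => /andP[_].
by rewrite ltNge (le_trans Nx).
Qed.

Lemma mean_Tb_ge x b N : 0 < b -> b <= x -> N <= x ->
  (truncated_mean b N <= \int[P]_w Tb (Xof Rt L x w) b)%E.
Proof.
move=> b0 bx Nx; have x0 : 0 <= x by exact: le_trans (ltW b0) bx.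
rewrite -(occupation_truncated_mean b0 bx Nx); apply: ge0_le_integral => //.
- by move=> w _; apply: occupation_ge0 => y; exact: IN0.
- by apply: (occupation_measurable HL x b (mIN N b0)) => y; exact: IN0.
- exact: Tb_Xof_measurable.
- by move=> w _; exact: occupation_le_Tb.
Qed.

(** The truncated occupation is below T_b and exceeds half its mean, hence t, with probability at
    least 1 / 8; its mean is the same for all x >= N, so the bound is uniform. *)
Lemma late_passage x b N t : 0 < b -> b <= x -> N <= x -> 0 < t ->
  ((2 * t)%:E < truncated_mean b N)%E ->
  (P [set w | (Tb (Xof Rt L x w) b <= t%:E)%E] <= (7 / 8)%:E)%E.
Proof.
move=> b0 bx Nx t0; have x0 : 0 <= x by exact: le_trans (ltW b0) bx.
have mf : truncated_mean b N \is a fin_num.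
  by rewrite ge0_fin_numE ?truncated_mean_ge0// truncated_mean_lty.
rewrite -(fineK mf) lte_fin; set m := fine _ => tm.
have m0 : 0 < m by apply: lt_trans tm; rewrite mulr_gt0.
have [H hH] := inv_rate_bounded N b0.
have mocc := occupation_measurable HL x b (mIN N b0) (fun y => IN0 N y b0).
have EA : (\int[P]_w occupation L x b (inv_rate Rt `[b, N[) w = m%:E)%E.
  by rewrite occupation_truncated_mean// /m fineK.
have := occupation_square_le HL scW Ps_ge0 bx (mIN N b0) (fun y => IN0 N y b0) hH.
rewrite EA (_ : (\int[mu]_y _)%E = m%:E); last first.
  by rewrite /m fineK//; apply: eq_integral => y _; rewrite muleC.
rewrite -!EFinM -expr2 => EA2.
have := second_moment_bound m0 mocc (fun w => occupation_ge0 L x b (fun y => IN0 N y b0) w) EA EA2.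
have mT : measurable [set w | (Tb (Xof Rt L x w) b <= t%:E)%E].
  by rewrite -[X in measurable X]setTI; apply: emeasurable_fun_infty_c => //; exact: Tb_Xof_measurable.
move=> h; have : (8^-1%:E <= P (~` [set w | (Tb (Xof Rt L x w) b <= t%:E)%E]))%E.
  apply: (le_trans h); apply: le_measure; rewrite ?inE//.
  - by rewrite -[X in measurable X]setTI; exact: emeasurable_fun_o_infty.
  - exact: measurableC.
  move=> w /= mA; apply/negP; rewrite -ltNge; apply: lt_le_trans (occupation_le_Tb N w b0 bx).
  by apply: lt_trans mA; rewrite lte_fin ltr_pdivlMr// mulrC.
rewrite probability_setC//.
have Pf : P [set w | (Tb (Xof Rt L x w) b <= t%:E)%E] \is a fin_num by rewrite fin_num_measure.
rewrite -(fineK Pf) -EFinB !lee_fin; lra.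
Qed.

Lemma early_passage x b t : 0 <= x -> 0 < b -> 0 < t ->
  (1 - (t^-1)%:E * m_of Rt W b <= P [set w | (Tb (Xof Rt L x w) b <= t%:E)%E])%E.
Proof.
move=> x0 b0 t0.
have mT := Tb_Xof_measurable x0 b0.
have mE : measurable [set w | (t%:E < Tb (Xof Rt L x w) b)%E].
  by rewrite -[X in measurable X]setTI; exact: emeasurable_fun_o_infty.
have : (t%:E * P [set w | (t%:E < Tb (Xof Rt L x w) b)%E] <= m_of Rt W b)%E.
  apply: le_trans (mean_Tb_le x0 b0).
  set E := [set w | _] in mE *.
  have -> : P E = (\int[P]_w (\1_E w)%:E)%E by rewrite integral_indic// setIT.
  rewrite -ge0_integralZl_EFin ?(ltW t0)//; last first.
    by apply/measurable_EFinP; exact: measurable_indic.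
  apply: ge0_le_integral => //.
  - by move=> w _; rewrite mule_ge0// lee_fin// ltW.
  - by apply: measurable_funeM; apply/measurable_EFinP; exact: measurable_indic.
  move=> w _; rewrite indicE; have [|_] := boolP (w \in _); last by rewrite mule0 Tb_ge0.
  by rewrite inE/= mule1 => /ltW.
rewrite (_ : [set w | (Tb (Xof Rt L x w) b <= t%:E)%E] = ~` [set w | (t%:E < Tb (Xof Rt L x w) b)%E]).
  move=> h; rewrite probability_setC// leeB//.
  by rewrite -(@lee_pmul2l _ t%:E) ?lte_fin// muleA -EFinM divff ?gt_eqF// mul1e.
by apply/seteqP; split => w /=; [move=> h; apply/negP|move=> /negP]; rewrite -leNgt.
Qed.

End Mean_passage.

(** * The entrance criterion *)

Section Limit_inferior.
Context (R : realType).
Variables (f : R -> \bar R) (c : \bar R) (M : R).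

Lemma limf_einf_pinfty_le : (forall x, M <= x -> (f x <= c)%E) ->
  (limf_einf f (pinfty_nbhs R) <= c)%E.
Proof.
move=> fc; rewrite limf_einfE; apply: ge_ereal_sup => _ [V [m [_ Vm]] <-].
have Vx : V (Num.max M m + 1) by apply: Vm; rewrite (le_lt_trans (_ : m <= Num.max M m))// ?le_max ?lexx ?orbT// ltrDl.
apply: (@le_trans _ _ (f (Num.max M m + 1))); first by apply: ereal_inf_lbound; exists (Num.max M m + 1).
by apply: fc; rewrite ler_wpDr// le_max lexx.
Qed.

Lemma limf_einf_pinfty_ge : (forall x, M <= x -> (c <= f x)%E) ->
  (c <= limf_einf f (pinfty_nbhs R))%E.
Proof.
move=> cf; rewrite limf_einfE; apply: (@le_trans _ _ (ereal_inf (f @` `[M, +oo[%classic))).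
  by apply: le_ereal_inf_tmp => _ [x + <-]; rewrite /= in_itv/= andbT; exact: cf.
apply: ereal_sup_ubound; exists `[M, +oo[%classic => //.
exists M; split; first exact: num_real.
by move=> x Mx; rewrite /= in_itv/= andbT ltW.
Qed.

End Limit_inferior.

Section Entrance.
Context d (T : measurableType d) (R : realType) (P : probability T R)
  (L : R -> T -> R) (Ps W : R -> R).
Hypotheses (HL : spec_pos_levy P L Ps) (scW : scale_function Ps W)
  (Ps_ge0 : forall q, 0 < q -> 0 <= Ps q).
Variable Rt : R -> R.
Hypotheses (Rt_cont : {within `[(0:R), +oo[, continuous Rt}) (Rt_gt0 : forall x, 0 < x -> 0 < Rt x).
Local Notation mu := (@lebesgue_measure R).
Let Ps_gt0 q : 0 < q -> 0 < Ps q. Proof. exact: (scale_exponent_gt0 scW Ps_ge0). Qed.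

(** The passage below 0 is almost surely finite, so X always reads Z at a finite time. *)
Lemma levy_non_explosive : non_explosive P L Rt.
Proof.
move=> x x0; have mt := passage_lt_measurable HL x 0 +oo%E.
exists (~` [set w | (first_below (fun r => (x + L r w)%R) 0 < +oo)%E]); split; first exact: measurableC.
  have := probability_setC P mt; rewrite (passage_finite HL Ps_gt0 x0) subee//; exact.
by move=> w /= H; apply: contra_not H => tw t t0; exact: Xpath_finite.
Qed.

Lemma inst_entrance_mean_finite : inst_entrance P L Rt ->
  exists2 b, 0 < b & (m_of Rt W b < +oo)%E.
Proof.
move=> [_ /(_ 1 ltr01) lim1]; apply: contrapT => fin.
have inf b : 0 < b -> m_of Rt W b = +oo%E.
  move=> b0; apply/eqP; rewrite -leye_eq leNgt; apply/negP => mb.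
  by apply: fin; exists b.
suff : (1 <= (7 / 8)%:E :> \bar R)%E by rewrite lee_fin; lra.
apply: (cvge_le _ lim1); exists 0; split; first exact: num_real.
move=> b b0; have cm := truncated_mean_cvg scW Ps_ge0 Rt_cont Rt_gt0 b0.
rewrite (inf b b0) in cm.
(* The threshold 2 is twice the time 1 at which the entrance property is tested. *)
have [N _ hN] : \forall n \near \oo, (2%:E < \int[mu]_y ((inv_rate Rt `[b, n%:R[ y)%:E * (W (y - b))%:E))%E.
  move/cvgeyPgt : cm => /(_ 2); exact.
have {}hN := hN N (leqnn N).
apply: (@limf_einf_pinfty_le _ _ _ (Num.max b N%:R)) => x; rewrite ge_max => /andP[bx Nx].
by apply: (late_passage HL scW Ps_ge0 Rt_cont Rt_gt0 b0 bx Nx ltr01); rewrite mulr1.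
Qed.

Lemma mean_finite_inst_entrance : (forall b, 0 < b -> (m_of Rt W b < +oo)%E) -> inst_entrance P L Rt.
Proof.
move=> fin; split; first exact: levy_non_explosive.
move=> t t0; set v := (fun b => _).
have v1 b : 0 < b -> (v b <= 1)%E.
  by move=> b0; apply: (@limf_einf_pinfty_le _ _ _ 0) => x x0; apply: probability_le1; rewrite -[X in measurable X]setTI; apply: emeasurable_fun_infty_c => //; apply: (Tb_Xof_measurable HL Rt_cont Rt_gt0) => //.
have key e : 0 < e -> exists2 b0, 0 < b0 & forall b, b0 <= b -> ((1 - e)%:E <= v b)%E.
  (* Once m(b) is below e t, Markov's inequality at time t loses at most e, uniformly in the
     starting point. *)
  move=> e0; have et : 0 < e * t by rewrite mulr_gt0.
  have [b0 b00 hb] := m_of_cvg0 scW Ps_ge0 Rt_cont Rt_gt0 fin et.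
  exists b0 => // b bb; apply: (@limf_einf_pinfty_ge _ _ _ 0) => x x0.
  apply: (le_trans _ (early_passage HL scW Ps_ge0 Rt_cont Rt_gt0 x0 (lt_le_trans b00 bb) t0)).
  rewrite EFinB leeB//; apply: (@le_trans _ _ ((t^-1)%:E * (e * t)%:E)%E).
    by apply: lee_wpmul2l; [rewrite lee_fin invr_ge0 ltW|exact: hb].
  by rewrite -EFinM lee_fin mulrCA mulVf ?mulr1// gt_eqF.
have vfin b0 : 0 < b0 -> (forall b, b0 <= b -> ((1 - 1)%:E <= v b)%E) -> forall b, b0 <= b -> v b \is a fin_num.
  move=> b00 h b bb; rewrite ge0_fin_numE ?(le_lt_trans (v1 b (lt_le_trans b00 bb))) ?ltry//.
  by have := h b bb; rewrite subrr.
apply/fine_cvgP; split.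
  have [b0 b00 h] := key 1 ltr01; exists b0; split; first exact: num_real.
  by move=> b /ltW bb; exact: vfin b00 h b bb.
apply/cvgrPdist_le => e e0; have [b1 b10 h1] := key 1 ltr01; have [b0 b00 h] := key e e0.
exists (Num.max b0 b1); split; first exact: num_real.
move=> b; rewrite gt_max => /andP[/ltW bb /ltW bb1]/=.
have vb := fineK (vfin _ b10 h1 b bb1).
have := h b bb; have := v1 b (lt_le_trans b00 bb); rewrite -vb !lee_fin => H1 H2.
by rewrite ger0_norm ?subr_ge0// lerBlDl -lerBlDr.
Qed.

End Entrance.

(** * The process started from infinity *)

Section Rational_times.
Context (R : realType).
Variables (b c : R).
Hypothesis c0 : 0 < c.

(** Enumerates the rationals of [0, c[; the default 0 is itself such a time since c > 0. *)
Definition rational_time (n : nat) : R :=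
  if choice.unpickle n is Some q then
    if (0 <= ratr q :> R) && (ratr q < c) then ratr (q : rat) else 0 else 0.

Lemma rational_time_ge0 n : 0 <= rational_time n.
Proof. by rewrite /rational_time; case: choice.unpickle => [q|//]; case: ifP => // /andP[]. Qed.

Lemma rational_time_lt n : rational_time n < c.
Proof. by rewrite /rational_time; case: choice.unpickle => [q|//]; case: ifP => // /andP[]. Qed.

Definition rational_passage (y : R -> \bar R) := forall c, reflect
  (exists q : rat, [/\ 0 <= ratr q :> R, ratr q < c & (y (ratr q) < b%:E)%E]) (Tb y b < c%:E)%E.

Lemma le_Tb_rational y : rational_passage y ->
  (c%:E <= Tb y b)%E <-> forall n, (b%:E <= y (rational_time n))%E.
Proof.
move=> yP; split => [cT n|h].
  rewrite leNgt; apply/negP => yn; move: cT; rewrite leNgt => /negP; apply.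
  apply: (le_lt_trans (Tb_le (rational_time_ge0 n) yn)).
  by rewrite lte_fin rational_time_lt.
rewrite leNgt; apply/negP => /yP[q [q0 qc yq]].
by have := h (choice.pickle q); rewrite /rational_time choice.pickleK q0 qc leNgt yq.
Qed.

(** The event that T_b is at least c is a decreasing limit of events depending on finitely many
    times, the only ones about which the Markov property of [Pinfty_version] speaks. *)
Lemma cvg_le_Tb d (T : measurableType d) (M : probability T R) (y : T -> R -> \bar R) (A : set T) :
  measurable A -> (forall w, rational_passage (y w)) ->
  (forall n, measurable [set w | (b%:E <= y w (rational_time n))%E]) ->
  M (A `&` [set w | forall i : 'I_n, (b%:E <= y w (rational_time i))%E]) @[n --> \oo] -->
  M (A `&` [set w | (c%:E <= Tb (y w) b)%E]).
Proof.
move=> mA yP my.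
pose F n := A `&` [set w | forall i : 'I_n, (b%:E <= y w (rational_time i))%E].
have mF n : measurable (F n).
  apply: measurableI => //.
  rewrite (_ : [set w | _] = \bigcap_(i in `I_n) [set w | (b%:E <= y w (rational_time i))%E]).
    by apply: bigcap_measurableType.
  apply/seteqP; split => w /=; first by move=> h i /= ilt; exact: (h (Ordinal ilt)).
  by move=> h i; exact: (h i (ltn_ord i)).
rewrite (_ : A `&` [set w | (c%:E <= _)%E] = \bigcap_n F n); last first.
  apply/seteqP; split => w /=.
    by move=> [Aw /(le_Tb_rational (yP w)) h] n _; split.
  move=> h; split; first by case: (h 0%N I).
  by apply/(le_Tb_rational (yP w)) => n; have [_ /(_ (Ordinal (ltnSn n)))] := h n.+1 I.
apply: nonincreasing_cvg_mu => //.
- by rewrite (le_lt_trans (probability_le1 M (mF 0%N)))// ltry.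
- by apply: bigcap_measurableType => n _; exact: mF.
- move=> m n mn; rewrite subsetEset => w [Aw h]; split => // i.
  exact: (h (widen_ord mn i)).
Qed.

End Rational_times.

Lemma rational_passage_shift (R : realType) (y : R -> \bar R) (b e : R) : 0 <= e ->
  (forall t, 0 <= t -> y @ at_right t --> y t) -> rational_passage b (fun t => y (e + t)).
Proof.
move=> e0 yc c; apply: (iffP idP) => [|[q [q0 qc yq]]]; last first.
  by rewrite (@le_lt_trans _ _ (ratr q)%:E) ?lte_fin// (@Tb_le R (fun t => y (e + t))).
move=> /ereal_inf_lt[_ [t [t0 yt] <-]]; rewrite lte_fin => tc.
have : \forall s \near (e + t)^'+, (y s < b%:E)%E.
  have := yc (e + t) (addr_ge0 e0 t0) [set u | (u < b%:E)%E].
  by apply; apply: open_nbhs_nbhs; split => //; exact: open_ereal_lt_ereal.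
rewrite near_withinE => /nbhs_ballP[a /= a0 ha].
have [q /andP[tq qa]] : exists q : rat, t < ratr q < Num.min c (t + a).
  by apply: rat_itvP; rewrite lt_min tc ltrDl.
move: qa; rewrite lt_min => /andP[qc qa].
exists q; split => //; first by rewrite (le_trans t0)// ltW.
apply: ha; last by rewrite ltrD2l.
by rewrite /ball/= ltr0_norm; lra.
Qed.

Lemma layer_cake (R : realType) (u : \bar R) : (0 <= u)%E ->
  (\int[lebesgue_measure]_(c in `](0%R : R), +oo[) (((c%:E <= u)%E)%:R)%:E = u)%E.
Proof.
move=> u0; transitivity (\int[lebesgue_measure]_(c in `](0%R : R), +oo[ `&` [set c : R | (c%:E <= u)%E]) (cst 1%E c))%E.
  rewrite integral_mkcond [RHS]integral_mkcond; apply: eq_integral => c _; rewrite !patchE in_setI.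
  case: (c \in _) => //=; have [cu|cu] := boolP (c%:E <= u)%E; first by rewrite mem_set.
  by rewrite memNset//; exact/negP.
rewrite integral_cst/=; last first.
  apply: measurableI; first exact: measurable_itv.
  rewrite -[X in measurable X]setTI.
  by apply: (@emeasurable_fun_infty_c _ _ _ _ EFin measurableT) => //; exact/measurable_EFinP.
rewrite mul1e; case: u u0 => [u| |]// u0.
  rewrite (_ : _ `&` _ = `]0, u]%classic).
    move: u0; rewrite lee_fin le_eqVlt => /predU1P[<-|u0].
      by rewrite lebesgue_measure_itv/= ltxx.
    by rewrite lebesgue_measure_itv/= lte_fin u0 sube0.
  by apply/seteqP; split => c /=; rewrite !in_itv/= andbT lee_fin; [by case=> -> ->|by case/andP=> -> ->].
rewrite (_ : _ `&` _ = `]0, +oo[%classic); first by rewrite lebesgue_measure_itv/= ltry.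
by apply/seteqP; split => c /=; [case|move=> ->; rewrite leey].
Qed.

Section Entrance_law.
Context d (T : measurableType d) (R : realType) (P : probability T R)
  (L : R -> T -> R) (Ps W : R -> R).
Hypotheses (HL : spec_pos_levy P L Ps) (scW : scale_function Ps W)
  (Ps_ge0 : forall q, 0 < q -> 0 <= Ps q).
Variable Rt : R -> R.
Hypotheses (Rt_cont : {within `[(0:R), +oo[, continuous Rt}) (Rt_gt0 : forall x, 0 < x -> 0 < Rt x).
Context d' (T' : measurableType d') (Q : probability T' R) (Y : R -> T' -> \bar R).
Hypothesis HY : Pinfty_version P L Rt Q Y.
Local Notation mu := (@lebesgue_measure R).
Local Notation path := (start_path L).
Let Ps_gt0 q : 0 < q -> 0 < Ps q. Proof. exact: (scale_exponent_gt0 scW Ps_ge0). Qed.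

Let mY r : measurable_fun setT (Y r). Proof. by case: HY. Qed.
Let Y0 w : Y 0 w = +oo%E. Proof. by case: HY => _ []. Qed.
Let Y_ge0 w t : 0 <= t -> (0 <= Y t w)%E. Proof. by case: HY => _ [_ [+ _]]; exact. Qed.
Let Y_rc w t : 0 <= t -> (fun s => Y s w) @ at_right t --> Y t w.
Proof. by case: HY => _ [_ [_ [+ _]]]; exact. Qed.

Let mYge r (c : \bar R) : measurable [set w | (c <= Y r w)%E].
Proof.
by rewrite -[X in measurable X]setTI; apply: emeasurable_fun_c_infty => //; exact: mY.
Qed.
Let mYlt r (c : \bar R) : measurable [set w | (Y r w < c)%E].
Proof.
by rewrite -[X in measurable X]setTI; apply: emeasurable_fun_infty_o => //; exact: mY.
Qed.

Lemma nat_filtration_measurable e A : nat_filtration Y e A -> measurable A.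
Proof.
move: A; apply: smallest_sub.
  split; [exact: measurable0| |].
  - by move=> A mA; apply: measurableD.
  - by move=> F mF; exact: bigcup_measurable.
move=> _ [r [B [_ _ mB ->]]]; rewrite -[_ @^-1` _]setTI; exact: mY.
Qed.

Lemma nat_filtration_sigma e : sigma_algebra setT (nat_filtration Y e).
Proof. exact: smallest_sigma_algebra. Qed.

Lemma nat_filtrationT e : nat_filtration Y e setT.
Proof. by have [F0 FD _] := nat_filtration_sigma e; have := FD _ F0; rewrite setD0. Qed.

Lemma nat_filtration_le e s A : e <= s -> nat_filtration Y e A -> nat_filtration Y s A.
Proof.
move=> es; apply: smallest_sub; first exact: nat_filtration_sigma.
move=> _ [r [B [r0 re mB ->]]]; apply: sub_sigma_algebra.
by exists r, B; split => //; exact: le_trans es.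
Qed.

Local Notation finite_at e := [set w | (Y e w < +oo)%E].

(** The strong Markov property at a constant stopping time. *)
Lemma entrance_markov e A n (t : 'I_n -> R) (B : 'I_n -> set (\bar R)) : 0 <= e ->
  nat_filtration Y e A -> (forall i, 0 <= t i) -> (forall i, measurable (B i)) ->
  (Q ((A `&` finite_at e) `&` [set w | forall i, B i (Y (e + t i) w)]) =
   \int[Q]_(w in A `&` finite_at e)
     P [set w0 | forall i, B i (Xof Rt L (fine (Y e w)) w0 (t i))])%E.
Proof.
move=> e0 FA t0 mB.
have F0 s : nat_filtration Y s set0 by have [] := nat_filtration_sigma s.
case: HY => _ [_ [_ [_ [_ [_ SM]]]]].
have st : stopping_time Y (fun=> e%:E).
  split => [w|s s0]; first by rewrite lee_fin.
  have [es|es] := boolP (e%:E <= s%:E)%E.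
    by rewrite (_ : [set _ | _] = setT); [exact: nat_filtrationT|apply/seteqP; split].
  by rewrite (_ : [set _ | _] = set0) //; apply/seteqP; split => // w /=; rewrite (negbTE es).
have sA : stopped_sigma Y (fun=> e%:E) A.
  move=> s s0; have [es|es] := boolP (e%:E <= s%:E)%E.
    rewrite (_ : [set _ | _] = setT) ?setIT; first by apply: nat_filtration_le FA; rewrite -lee_fin.
    by apply/seteqP; split.
  by rewrite (_ : [set _ | _] = set0) ?setI0 //; apply/seteqP; split => // w /=; rewrite (negbTE es).
have := SM _ st A sA n t B t0 mB.
rewrite (_ : [set w | (e%:E < +oo)%E /\ (at_time (Y^~ w) e%:E < +oo)%E] = finite_at e)//.
by apply/seteqP; split => w /=; [case|rewrite ltry].
Qed.

(** Almost surely Y is finite somewhere in ]0, e[, hence by right continuity at a rational time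
    before e; from a finite state X does not explode, so finiteness persists to e off a countable
    union of null sets. *)
Lemma entrance_finite e : 0 < e -> Q (~` finite_at e) = 0%E.
Proof.
move=> e0; case: HY => _ [_ [_ [_ [_ [[N [mN QN0 leave]] _]]]]].
pose r n := rational_time e n.
pose F n := finite_at (r n) `&` ~` finite_at e.
have mF n : measurable (F n) by apply: measurableI; [exact: mYlt|apply: measurableC; exact: mYlt].
have r0 n : 0 <= r n by exact: rational_time_ge0.
have QF n : Q (F n) = 0%E.
  (* The Markov property at [r n] is applied to the one-time event of being at +oo after the delay e
     - r n. *)
  have eq0 : 0 <= e - r n by rewrite subr_ge0 ltW// rational_time_lt.
  have := @entrance_markov (r n) setT 1 (fun=> e - r n) (fun=> [set +oo%E]) (r0 n) (@nat_filtrationT (r n)) (fun=> eq0) (fun=> emeasurable_set1 _).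
  rewrite setTI integral0_eq => [<-|w wf].
    congr (Q _); apply/seteqP; split => w /= [wq].
      by move=> /negP; rewrite -leNgt leye_eq => /eqP we; split => // i; rewrite addrC subrK.
    by move=> /(_ ord0) /=; rewrite addrC subrK => we; split => //=; rewrite we ltxx.
  have x0 : 0 <= fine (Y (r n) w) by rewrite fine_ge0// Y_ge0.
  set x := fine _ in x0 *; have mt := passage_lt_measurable HL x 0 +oo%E.
  have m1 : measurable [set w0 | 'I_1 -> [set +oo%E] (Xof Rt L x w0 (e - r n))].
    rewrite (_ : [set w0 | _] = \bigcap_m ~` [set w0 | (Xpath Rt (path (x, w0)) (e - r n) < m%:R%:E)%E]).
      apply: bigcap_measurableType => m _; apply: measurableC.
      have := time_changed_lt_measurable HL Rt_cont Rt_gt0 (e - r n) m%:R.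
      by move=> /(measurable_xsection x); rewrite xsectionE.
    apply/seteqP; split => w0 /=.
      by move=> h m _ /=; rewrite -Xof_start// (h ord0) ltNge leey.
    move=> h _; rewrite Xof_start//.
    have hm m : (m%:R%:E <= Xpath Rt (path (x, w0)) (e - r n))%E.
      by rewrite leNgt; apply/negP; exact: (h m I).
    case: (Xpath _ _ _) hm => // [y|] hm; last by have := hm 0%N.
    by have := hm (Num.truncn y).+1; rewrite lee_fin leNgt truncnS_gt.
  apply/eqP; rewrite eq_le measure_ge0 andbT.
  have <- : P (~` [set w0 | (first_below (fun r => (x + L r w0)%R) 0 < +oo)%E]) = 0%E.
    by rewrite probability_setC// (passage_finite HL Ps_gt0 x0) subee.
  apply: le_measure; rewrite ?inE//; first exact: measurableC.
  by move=> w0 /= h tf; have := @Xpath_finite _ Rt _ (e - r n) tf; rewrite -/(Xof Rt L x w0) (h ord0) ltxx.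
have mfe : measurable (~` finite_at e) by apply: measurableC; exact: mYlt.
apply/eqP; rewrite eq_le measure_ge0 andbT.
have mUF : measurable (\bigcup_n F n) by exact: bigcupT_measurable.
have NU : Q (N `|` \bigcup_n F n) = 0%E.
  apply: null_set_setU => //; apply: (@negligibleP _ _ _ Q _ mUF).1.
  by apply: negligible_bigcup => n; exact: ((@negligibleP _ _ _ Q _ (mF n)).2 (QF n)).
rewrite -NU; apply: le_measure; rewrite ?inE//; first exact: measurableU.
move=> w /= we; have [wN|wN] := pselect (N w); [by left|right].
have {leave} : ~ ~ (forall e, 0 < e -> exists t, [/\ 0 < t, t < e & (Y t w < +oo)%E]).
  by move=> h; apply: wN; exact: leave.
move=> /contrapT /(_ e e0)[t [t0 te Yt]].
pose c := fine (Y t w) + 1.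
have Yc : (Y t w < c%:E)%E.
  have Yf : Y t w = (fine (Y t w))%:E by rewrite fineK// ge0_fin_numE// Y_ge0// ltW.
  by rewrite {1}Yf lte_fin ltrDl.
have [|q [q0 qe]] := elimT (@rational_passage_shift R (fun t => Y t w) c 0 (lexx 0) (@Y_rc w) e).
  apply: (@le_lt_trans _ _ t%:E); last by rewrite lte_fin.
  by apply: (@Tb_le R (fun t => Y (0 + t) w)); rewrite ?add0r// ltW.
rewrite add0r => Yq; exists (choice.pickle q) => //.
by rewrite /F /r /rational_time choice.pickleK q0 qe; split => //=; rewrite (lt_le_trans Yq)// leey.
Qed.

Section Passage_after.
Variables (b e : R).
Hypotheses (b0 : 0 < b) (e0 : 0 < e).
Local Notation S w := (Tb (fun t => Y (e + t) w) b).
Local Notation x w := (fine (Y e w)).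
Local Notation TB p := (Tb (Xpath Rt (path p)) b).

Let x_ge0 w : 0 <= x w. Proof. by rewrite fine_ge0// Y_ge0// ltW. Qed.
Let mx : measurable_fun setT (fun w => x w).
Proof. exact: (measurableT_comp (fine_measurable measurableT)). Qed.

Let SP w : rational_passage b (fun t => Y (e + t) w).
Proof. exact: (@rational_passage_shift R (fun t => Y t w) b e (ltW e0) (@Y_rc w)). Qed.

Let XP p : rational_passage b (Xpath Rt (path p)).
Proof. by move=> c; exact: (Tb_lt_ratP HL Rt_cont Rt_gt0 p b0). Qed.

Lemma passage_after_measurable : measurable_fun setT (fun w => S w).
Proof.
apply: emeasurable_from_lt => c.
have -> : [set w | (S w < c%:E)%E] = \bigcup_(q in [set: rat])
    (if (0 <= ratr q :> R) && (ratr q < c) then [set w | (Y (e + ratr q) w < b%:E)%E] else set0).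
  apply/seteqP; split => w /=.
    by move=> /SP[q [q0 qc Yq]]; exists q => //; rewrite q0 qc.
  by move=> [q _]; case: ifPn => // /andP[q0 qc]/= Yq; apply/SP; exists q.
apply: countable_bigcupT_measurable => [|q]; first exact: countableP.
by case: ifP => // _; exact: mYlt.
Qed.

Let mTB : measurable_fun setT (fun p : R * T => TB p).
Proof. exact: (Tb_measurable HL Rt_cont Rt_gt0 b0). Qed.

Let mXge t : measurable [set p : R * T | (b%:E <= Xpath Rt (path p) t)%E].
Proof.
rewrite (_ : [set p : R * T | _] = ~` [set p : R * T | (Xpath Rt (path p) t < b%:E)%E]).
  by apply: measurableC; exact: (time_changed_lt_measurable HL Rt_cont Rt_gt0).
by apply/seteqP; split => p /=; [move=> h; apply/negP|move=> /negP]; rewrite -leNgt.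
Qed.

Let Phi (c y : R) : \bar R := (\int[P]_w0 (((c%:E <= TB (y, w0))%E)%:R)%:E)%E.

Let mPhi : measurable_fun setT (fun z : R * R => Phi z.1 z.2).
Proof.
pose G (z : R * R * T) := (((z.1.1%:E <= TB (z.1.2, z.2))%E)%:R : R)%:E.
apply: (@measurable_fun_fubini_tonelli_F _ _ _ _ _ P G) => [|z]; last by rewrite lee_fin.
apply/measurable_EFinP; apply: measurable_fun_natr; apply: measurable_fun_lee.
  by apply/measurable_EFinP; exact: (measurableT_comp measurable_fst measurable_fst).
have m2 : measurable_fun setT (fun z : R * R * T => (z.1.2, z.2)).
  by apply: measurable_fun_pair => //; exact: (measurableT_comp measurable_snd measurable_fst).
exact (measurableT_comp mTB m2).
Qed.

Let Phi_ge0 c y : (0 <= Phi c y)%E.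
Proof. by apply: integral_ge0 => w0 _; rewrite lee_fin. Qed.

(** Limit of the finite-dimensional Markov identities along [rational_time]; the restriction to
    finite states at time e costs only a null set. *)
Let late_law A c : nat_filtration Y e A -> 0 < c ->
  (\int[Q]_w (\1_A w * ((c%:E <= S w)%E)%:R)%:E = \int[Q]_w ((\1_A w)%:E * Phi c (x w)))%E.
Proof.
move=> FA c0; have mA := nat_filtration_measurable FA.
have mG : measurable (finite_at e) by exact: mYlt.
have mAG : measurable (A `&` finite_at e) by exact: measurableI.
have mS : measurable [set w | (c%:E <= S w)%E].
  by rewrite -[X in measurable X]setTI; apply: emeasurable_fun_c_infty => //; exact: passage_after_measurable.
have mPx : measurable_fun setT (fun w => Phi c (x w)).
  have m2 : measurable_fun setT (fun w => (c, x w)) by exact: measurable_fun_pair.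
  exact (measurableT_comp mPhi m2).
have -> : (\int[Q]_w (\1_A w * ((c%:E <= S w)%E)%:R)%:E = Q ((A `&` finite_at e) `&` [set w | (c%:E <= S w)%E]))%E.
  transitivity (Q (A `&` [set w | (c%:E <= S w)%E])).
    rewrite -[in RHS](setIT (A `&` _)) -integral_indic//; last exact: measurableI.
    apply: eq_integral => w _; rewrite !indicE in_setI; case: (w \in A); rewrite ?mul0r// mul1r/=.
    by congr (_%:R)%:E; have [h|h] := boolP (_ <= _)%E; [rewrite mem_set|rewrite memNset//; exact/negP].
  rewrite -(measureU0 _ _ (entrance_finite e0)); last 2 first.
  - exact: measurableI.
  - exact: measurableC.
  rewrite -[RHS](measureU0 _ _ (entrance_finite e0)); last 2 first.
  - exact: measurableI.
  - exact: measurableC.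
  congr (Q _); apply/seteqP; split => w /=.
    move=> [[Aw cS]|]; last by right.
    by have [h|h] := pselect (Y e w < +oo)%E; [left|right].
  by move=> [[[Aw _] cS]|]; [left|right].
have -> : (\int[Q]_w ((\1_A w)%:E * Phi c (x w)) = \int[Q]_(w in A `&` finite_at e) Phi c (x w))%E.
  transitivity (\int[Q]_(w in A) Phi c (x w))%E.
    rewrite [RHS]integral_mkcond; apply: eq_integral => w _; rewrite patchE indicE.
    by case: (w \in A); rewrite ?mul1e ?mul0e.
  rewrite (ge0_negligible_integral (N := ~` finite_at e))//.
  - by rewrite setDE setCK.
  - exact: measurableC.
  - exact: measurable_funTS.
  - exact: entrance_finite.
have cl := @cvg_le_Tb R b c c0 _ T' Q (fun w t => Y (e + t) w) _ mAG SP (fun n => mYge _ _).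
apply: (cvg_unique (@ereal_hausdorff R) cl).
have -> : (fun n => Q ((A `&` finite_at e) `&`
     [set w | forall i : 'I_n, (b%:E <= Y (e + rational_time c i) w)%E])) =
   (fun n => \int[Q]_(w in A `&` finite_at e)
     P [set w0 | forall i : 'I_n, (b%:E <= Xpath Rt (path (x w, w0)) (rational_time c i))%E])%E.
  apply/funext => n.
  rewrite (@entrance_markov e A n (fun i => rational_time c i) (fun=> [set y | (b%:E <= y)%E]) (ltW e0) FA).
  - by apply: eq_integral => w _; congr (P _); apply/seteqP; split => w0 /= h i; move: (h i); rewrite Xof_start.
  - by move=> i; exact: rational_time_ge0.
  - move=> i; rewrite -[X in measurable X]setTI; apply: emeasurable_fun_c_infty => //; exact: measurable_id.
have mD n : measurable [set p : R * T | forall i : 'I_n, (b%:E <= Xpath Rt (path p) (rational_time c i))%E].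
  rewrite (_ : [set p : R * T | _] =
      \bigcap_(i in `I_n) [set p : R * T | (b%:E <= Xpath Rt (path p) (rational_time c i))%E]).
    by apply: bigcap_measurableType.
  apply/seteqP; split => p /=; first by move=> h i /= ilt; exact: (h (Ordinal ilt)).
  by move=> h i; exact: (h i (ltn_ord i)).
apply: (@cvg_integral_dominated _ _ _ Q (A `&` finite_at e) _ _ (cst 1%E)) => //.
- move=> n; apply: measurable_funTS.
  have := measurableT_comp (measurable_fun_xsection P (mD n)) mx.
  by apply: eq_measurable_fun => w _ /=; rewrite xsectionE.
- move=> w _; have mXs n : measurable [set w0 | (b%:E <= Xpath Rt (path (x w, w0)) (rational_time c n))%E].
    by have := measurable_xsection (x w) (mXge (rational_time c n)); rewrite xsectionE.
  have := @cvg_le_Tb R b c c0 _ T P (fun w0 => Xpath Rt (path (x w, w0))) _ measurableT (fun w0 => XP (x w, w0)) mXs.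
  under eq_fun do rewrite setTI.
  rewrite setTI (_ : P [set w0 | _] = Phi c (x w))//.
  rewrite /Phi; set D := [set w0 | _].
  have mDw : measurable D.
    rewrite -[X in measurable X]setTI; apply: emeasurable_fun_c_infty => //.
    exact (measurableT_comp mTB (pair1_measurable (x w))).
  have -> : P D = (\int[P]_w0 (\1_D w0)%:E)%E by rewrite integral_indic// setIT.
  apply: eq_integral => w0 _; rewrite indicE; congr (_%:R)%:E.
  by have [h|h] := boolP (_ <= _)%E; [rewrite mem_set|rewrite memNset//; exact/negP].
- by apply: (@integrableS _ _ _ Q setT) => //; exact: finite_measure_integrable_cst.
- move=> n w _; rewrite gee0_abs ?measure_ge0//; apply: probability_le1.
  by have := measurable_xsection (x w) (mD n); rewrite xsectionE.
Qed.

(** Integrating the tail identity [late_law] over the threshold c turns it into one for means. *)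
Lemma passage_after_mean A : nat_filtration Y e A ->
  (\int[Q]_w ((\1_A w)%:E * S w) =
   \int[Q]_w ((\1_A w)%:E * \int[P]_w0 Tb (Xof Rt L (fine (Y e w)) w0) b))%E.
Proof.
move=> FA; have mA := nat_filtration_measurable FA.
have m0y := measurable_itv `](0%R : R), +oo[.
pose F1 (z : R * T') := (\1_A z.2 * ((z.1%:E <= S z.2)%E)%:R)%:E : \bar R.
have mA2 : measurable_fun setT (fun z : R * T' => \1_A z.2 : R).
  exact: (measurableT_comp (measurable_indic mA) measurable_snd).
have mF1 : measurable_fun setT F1.
  apply/measurable_EFinP; apply: measurable_funM => //; apply: measurable_fun_natr.
  apply: measurable_fun_lee; first by apply/measurable_EFinP; exact: measurable_fst.
  exact: (measurableT_comp passage_after_measurable measurable_snd).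
have F10 z : (0 <= F1 z)%E by rewrite lee_fin mulr_ge0.
pose F2 (z : R * T') := ((\1_A z.2)%:E * Phi z.1 (x z.2))%E.
have mF2 : measurable_fun setT F2.
  apply: emeasurable_funM; first exact/measurable_EFinP.
  have m2 : measurable_fun setT (fun z : R * T' => (z.1, x z.2)).
    by apply: measurable_fun_pair; [exact: measurable_fst|exact: (measurableT_comp mx measurable_snd)].
  exact (measurableT_comp mPhi m2).
have F20 z : (0 <= F2 z)%E by rewrite mule_ge0// lee_fin.
transitivity (\int[Q]_w \int[mu]_(c in `](0%R : R), +oo[) F1 (c, w))%E.
  apply: eq_integral => w _; rewrite -{1}[S w](layer_cake (Tb_ge0 _ b)) /F1.
  rewrite -ge0_integralZl//; last first.
    apply: measurable_funTS; apply/measurable_EFinP; apply: measurable_fun_natr.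
    by apply: measurable_fun_lee => //; exact/measurable_EFinP.
transitivity (\int[Q]_w \int[mu]_(c in `](0%R : R), +oo[) F2 (c, w))%E.
  rewrite -(tonelli_on Q m0y mF1 F10) -(tonelli_on Q m0y mF2 F20).
  by apply: eq_integral => c; rewrite inE/= in_itv/= andbT => c0; exact: late_law.
apply: eq_integral => w _; rewrite /F2/= ge0_integralZl//; last first.
  have m2 : measurable_fun setT (fun c : R => (c, x w)) by exact: measurable_fun_pair.
  by apply: measurable_funTS; exact (measurableT_comp mPhi m2).
congr (_ * _)%E.
pose G (z : R * T) := (((z.1%:E <= TB (x w, z.2))%E)%:R : R)%:E.
have mTw : measurable_fun setT (fun w0 => TB (x w, w0)).
  exact (measurableT_comp mTB (pair1_measurable (x w))).
have mG : measurable_fun setT G.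
  apply/measurable_EFinP; apply: measurable_fun_natr; apply: measurable_fun_lee.
    by apply/measurable_EFinP; exact: measurable_fst.
  exact: (measurableT_comp mTw measurable_snd).
have G0 z : (0 <= G z)%E by rewrite lee_fin.
rewrite [LHS](@tonelli_on _ _ _ P _ G m0y mG G0).
by apply: eq_integral => w0 _; rewrite Xof_start// /G/= layer_cake// Tb_ge0.
Qed.

End Passage_after.

End Entrance_law.

(** * Mean passage time from infinity *)

Section Mean_from_infinity.
Context d (T : measurableType d) (R : realType) (P : probability T R)
  (L : R -> T -> R) (Ps W : R -> R).
Hypotheses (HL : spec_pos_levy P L Ps) (scW : scale_function Ps W)
  (Ps_ge0 : forall q, 0 < q -> 0 <= Ps q).
Variable Rt : R -> R.
Hypotheses (Rt_cont : {within `[(0:R), +oo[, continuous Rt}) (Rt_gt0 : forall x, 0 < x -> 0 < Rt x).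
Context d' (T' : measurableType d') (Q : probability T' R) (Y : R -> T' -> \bar R).
Hypothesis HY : Pinfty_version P L Rt Q Y.
Variable b : R.
Hypothesis b0 : 0 < b.
Local Notation mu := (@lebesgue_measure R).
Local Notation S e w := (Tb (fun t => Y (e + t) w) b).
Local Notation TY w := (Tb (Y ^~ w) b).
Local Notation x e w := (fine (Y e w)).
Local Notation E y := (\int[P]_w0 Tb (Xof Rt L y w0) b)%E.
Local Notation A e := [set w | (e%:E <= TY w)%E].

Let mY r : measurable_fun setT (Y r). Proof. by case: HY. Qed.
Let Y0 w : Y 0 w = +oo%E. Proof. by case: HY => _ []. Qed.
Let Y_ge0 w t : 0 <= t -> (0 <= Y t w)%E. Proof. by case: HY => _ [_ [+ _]]; exact. Qed.
Let Y_rc w t : 0 <= t -> (fun s => Y s w) @ at_right t --> Y t w.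
Proof. by case: HY => _ [_ [_ [+ _]]]; exact. Qed.

Let YP w : rational_passage b (Y ^~ w).
Proof.
have := @rational_passage_shift R (fun t => Y t w) b 0 (lexx 0) (@Y_rc w).
by rewrite (_ : (fun t => Y (0 + t) w) = Y ^~ w)//; apply/funext => t; rewrite add0r.
Qed.

(** Only rational times strictly before e decide the event, so it belongs to the past at e. *)
Lemma late_past e : 0 < e -> nat_filtration Y e (A e).
Proof.
move=> e0; pose G := [set A | exists r (B : set (\bar R)), [/\ 0 <= r, r <= e, measurable B & A = Y r @^-1` B]].
rewrite (_ : A e = \bigcap_n [set w | (b%:E <= Y (rational_time e n) w)%E]); last first.
  apply/seteqP; split => w /=; first by move=> /(le_Tb_rational e0 (YP w)) h n _; exact: h.
  by move=> h; apply/(le_Tb_rational e0 (YP w)) => n; exact: h.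
suff : @measurable _ (g_sigma_algebraType G) (\bigcap_n [set w | (b%:E <= Y (rational_time e n) w)%E]) by exact.
apply: bigcap_measurableType => n _; apply: sub_sigma_algebra.
exists (rational_time e n), [set y | (b%:E <= y)%E]; split => //.
- exact: rational_time_ge0.
- by rewrite ltW// rational_time_lt.
- by rewrite -[X in measurable X]setTI; apply: emeasurable_fun_c_infty => //; exact: measurable_id.
Qed.

Let mS e : 0 < e -> measurable_fun setT (fun w => S e w).
Proof. by move=> e0; exact: (passage_after_measurable HY b e0). Qed.

Let mA e : 0 < e -> measurable (A e).
Proof. by move=> e0; exact: (nat_filtration_measurable HY (late_past e0)). Qed.

Let near0 w M : exists2 a, 0 < a & forall s, 0 <= s -> s < a -> (M%:E <= Y s w)%E.
Proof.
have : \forall s \near 0^'+, (M%:E < Y s w)%E.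
  have := @Y_rc w 0 (lexx 0) [set u | (M%:E < u)%E]; apply.
  rewrite Y0; apply: open_nbhs_nbhs; split; last by rewrite /= ltry.
  exact: open_ereal_gt_ereal.
rewrite near_withinE => /nbhs_ballP[a /= a0 ha]; exists a => // s s0 sa.
move: s0; rewrite le_eqVlt => /predU1P[<-|s0]; first by rewrite Y0 leey.
by apply/ltW/ha => //; rewrite /ball/= sub0r normrN gtr0_norm.
Qed.

Let eps n : R := n.+1%:R^-1.
Let eps_gt0 n : 0 < eps n. Proof. by rewrite invr_gt0. Qed.

Let eps_lt a : 0 < a -> \forall n \near \oo, eps n < a.
Proof. by move=> a0; apply: near_infty_natSinv_lt (PosNum a0). Qed.

Let late_near w : \forall n \near \oo, A (eps n) w.
Proof.
have [a a0 ha] := near0 w b; near=> n.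
apply: (@le_trans _ _ a%:E); first by rewrite lee_fin ltW//; near: n; exact: eps_lt.
apply: le_ereal_inf_tmp => _ [s [s0 Ys] <-]; rewrite lee_fin leNgt; apply/negP => sa.
by have := ha s s0 sa; rewrite leNgt Ys.
Unshelve. all: by end_near. Qed.

Lemma late_passage_shift e w : 0 < e -> A e w -> TY w = (e%:E + S e w)%E.
Proof.
move=> e0 /= eT; apply/eqP; rewrite eq_le; apply/andP; split.
  rewrite addeC -leeBlDr//; apply: le_ereal_inf_tmp => _ [t [t0 Yt] <-].
  by rewrite leeBlDr// -EFinD addrC; apply: Tb_le => //; rewrite addr_ge0// ltW.
apply: le_ereal_inf_tmp => _ [t [t0 Yt] <-].
have et : e <= t by rewrite -lee_fin (le_trans eT)//; exact: Tb_le.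
have -> : t%:E = (e%:E + (t - e)%:E)%E by rewrite -EFinD addrC subrK.
apply: leeD2l; apply: (@Tb_le R (fun t => Y (e + t) w)).
  by rewrite subr_ge0.
by rewrite addrC subrK.
Qed.

Lemma entrance_Tb_measurable : measurable_fun setT (fun w => TY w).
Proof.
apply: emeasurable_from_lt => c; have [c0|c0] := ltP 0 c.
  rewrite (_ : [set w | _] = ~` A c); first by apply: measurableC; exact: mA.
  by apply/seteqP; split => w /=; [rewrite ltNge => /negP|move=> /negP; rewrite -ltNge].
rewrite (_ : [set w | _] = set0)//; apply/seteqP; split => // w /=.
by rewrite ltNge (le_trans _ (Tb_ge0 _ b))// lee_fin.
Qed.

Let mE : measurable_fun setT (fun y : R => \int[P]_w0 Tb (Xpath Rt (start_path L (y, w0))) b)%E.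
Proof.
apply: (@measurable_tonelli_F _ _ _ P (fun p => Tb (Xpath Rt (start_path L p)) b)).
  exact: (Tb_measurable HL Rt_cont Rt_gt0 b0).
by move=> p; exact: Tb_ge0.
Qed.

Let mEx e : 0 < e -> measurable_fun setT (fun w => E (x e w)).
Proof.
move=> e0; have mx : measurable_fun setT (fun w => x e w).
  exact: (measurableT_comp (fine_measurable measurableT)).
apply: eq_measurable_fun (measurableT_comp mE mx) => w _ /=.
by apply: eq_integral => w0 _; rewrite Xof_start// fine_ge0// Y_ge0// ltW.
Qed.

Let late_mean e : 0 < e ->
  (\int[Q]_w ((\1_(A e) w)%:E * TY w) = e%:E * Q (A e) + \int[Q]_w ((\1_(A e) w)%:E * E (x e w)))%E.
Proof.
move=> e0; rewrite -(passage_after_mean HL scW Ps_ge0 Rt_cont Rt_gt0 HY b0 e0 (late_past e0)).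
have mI : measurable_fun setT (fun w => (\1_(A e) w)%:E : \bar R).
  by apply/measurable_EFinP; exact: measurable_indic (mA e0).
have -> : Q (A e) = (\int[Q]_w (\1_(A e) w)%:E)%E by rewrite integral_indic ?setIT//; exact: mA.
rewrite -ge0_integralZl_EFin ?(ltW e0)//.
rewrite -ge0_integralD//; last 4 first.
- by move=> w _; rewrite -EFinM lee_fin mulr_ge0// ltW.
- exact: measurable_funeM.
- by move=> w _; rewrite mule_ge0 ?lee_fin ?Tb_ge0.
- by apply: emeasurable_funM => //; exact: mS.
apply: eq_integral => w _; rewrite indicE; have [|_] := boolP (w \in _); last by rewrite !mul0e mule0 adde0.
by rewrite inE => /(late_passage_shift e0) ->; rewrite !mul1e mule1.
Qed.

Let E_ge0 y : (0 <= E y)%E.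
Proof. by apply: integral_ge0 => w0 _; exact: Tb_ge0. Qed.
Let x_ge0 e w : 0 < e -> 0 <= x e w. Proof. by move=> e0; rewrite fine_ge0// Y_ge0// ltW. Qed.

Let mind e : 0 < e -> measurable_fun setT (fun w => (\1_(A e) w)%:E : \bar R).
Proof. by move=> e0; apply/measurable_EFinP; exact: measurable_indic (mA e0). Qed.

Let m_ge0 : (0 <= m_of Rt W b)%E.
Proof. exact: le_trans (E_ge0 b) (mean_Tb_le HL scW Ps_ge0 Rt_cont Rt_gt0 (ltW b0) b0). Qed.

(** As e decreases to 0 the events [A e] increase to the whole space, because Y starts at +oo and is
    right continuous; monotone convergence then applies to [late_mean]. *)
Lemma entrance_mean_le : (\int[Q]_w TY w <= m_of Rt W b)%E.
Proof.
apply/lee_addgt0Pr => e e0.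
have bound n : (\int[Q]_w ((\1_(A (eps n)) w)%:E * TY w) <= (eps n)%:E + m_of Rt W b)%E.
  rewrite late_mean//; apply: leeD.
    rewrite -[leRHS]mule1; apply: lee_wpmul2l; first by rewrite lee_fin ltW.
    by apply: probability_le1; exact: mA.
  apply: (@le_trans _ _ (\int[Q]_w (cst (m_of Rt W b) w))%E); last first.
    by rewrite integral_cst//= probability_setT mule1.
  apply: ge0_le_integral => //.
  - by move=> w _; rewrite mule_ge0 ?lee_fin.
  - by apply: emeasurable_funM; [exact: mind|exact: mEx].
  - move=> w _; rewrite indicE; case: (w \in _); rewrite ?mul0e ?mul1e//.
    exact: (mean_Tb_le HL scW Ps_ge0 Rt_cont Rt_gt0 (x_ge0 _ _) b0).
have mg n : measurable_fun setT (fun w => (\1_(A (eps n)) w)%:E * TY w)%E.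
  by apply: emeasurable_funM; [exact: mind|exact: entrance_Tb_measurable].
have g0 n w : setT w -> (0 <= (\1_(A (eps n)) w)%:E * TY w)%E.
  by move=> _; rewrite mule_ge0 ?lee_fin// Tb_ge0.
have nd w : setT w -> nondecreasing_seq (fun n => (\1_(A (eps n)) w)%:E * TY w)%E.
  move=> _ m n mn; apply: lee_wpmul2r; first exact: Tb_ge0.
  rewrite lee_fin !indicE; have [|_] := boolP (w \in A (eps m)); last by rewrite ler0n.
  rewrite inE => Aw; rewrite mem_set//=; apply: le_trans Aw.
  by rewrite lee_fin lef_pV2 ?posrE// ler_nat ltnS.
have cvT := cvg_monotone_convergence measurableT mg g0 nd.
have limT : (\int[Q]_w (limn (fun n => (\1_(A (eps n)) w)%:E * TY w)) = \int[Q]_w TY w)%E.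
  apply: eq_integral => w _; apply: cvg_lim => //; apply: cvg_near_cst.
  have := late_near w; apply: filterS => n Aw.
  by rewrite indicE mem_set// mul1e.
have {}cvT : (\int[Q]_w ((\1_(A (eps n)) w)%:E * TY w))%E @[n --> \oo] --> (\int[Q]_w TY w)%E.
  by rewrite -limT; exact: cvT.
apply: (cvge_le _ cvT).
have := eps_lt e0; apply: filterS => n en.
by rewrite (le_trans (bound n))// addeC leeD2l// lee_fin ltW.
Qed.

(** For small e the state at e exceeds both b and N with probability tending to 1, and from such
    states the mean of T_b is at least the truncated mean. The latter is finite, so the product
    passes to the limit. *)
Let truncated_le (N : R) :
  (\int[mu]_y ((inv_rate Rt `[b, N[ y)%:E * (W (y - b))%:E) <= \int[Q]_w TY w)%E.
Proof.
set mN := (\int[mu]_y _)%E; pose M := Num.max b N.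
have mN0 : (0 <= mN)%E by exact: (truncated_mean_ge0 scW Ps_ge0 Rt_gt0 N b0).
have mNf : mN \is a fin_num.
  by rewrite ge0_fin_numE//; exact: (truncated_mean_lty scW Ps_ge0 Rt_cont Rt_gt0 N b0).
have Tpos : (0 <= \int[Q]_w TY w)%E by apply: integral_ge0 => w _; exact: Tb_ge0.
pose C n := A (eps n) `&` [set w | (M%:E <= Y (eps n) w)%E].
have mM n : measurable [set w | (M%:E <= Y (eps n) w)%E].
  by rewrite -[X in measurable X]setTI; apply: emeasurable_fun_c_infty => //; exact: mY.
have mC n : measurable (C n) by apply: measurableI; [exact: mA|exact: mM].
have bound n : (mN * Q (C n) <= \int[Q]_w TY w)%E.
  have mfin : measurable [set w | (Y (eps n) w < +oo)%E].
    by rewrite -[X in measurable X]setTI; apply: emeasurable_fun_infty_o => //; exact: mY.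
  have -> : Q (C n) = Q (C n `&` [set w | (Y (eps n) w < +oo)%E]).
    have mnf := measurableC mfin; have mCf := measurableI _ _ (mC n) mfin.
    have qn := entrance_finite HL scW Ps_ge0 Rt_cont Rt_gt0 HY (eps_gt0 n).
    rewrite -(measureU0 (mC n) mnf qn) -[RHS](measureU0 mCf mnf qn).
    congr (Q _); apply/seteqP; split => w /=; last by move=> [[? _]|?]; [left|right].
    by move=> [Cw|?]; [have [h|h] := pselect (Y (eps n) w < +oo)%E; [left|right]|right].
  set D := C n `&` _; have mD : measurable D by exact: measurableI.
  have -> : Q D = (\int[Q]_w (\1_D w)%:E)%E by rewrite integral_indic ?setIT.
  rewrite -ge0_integralZl//; last by apply/measurable_EFinP; exact: measurable_indic.
  apply: (@le_trans _ _ (\int[Q]_w ((\1_(A (eps n)) w)%:E * E (x (eps n) w)))%E).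
    apply: ge0_le_integral => //.
    - by move=> w _; rewrite mule_ge0// lee_fin.
    - by apply: measurable_funeM; apply/measurable_EFinP; exact: measurable_indic.
    - by apply: emeasurable_funM; [exact: mind|exact: mEx].
    move=> w _; rewrite !indicE; have [|_] := boolP (w \in D); last first.
      by rewrite mule0 mule_ge0// lee_fin.
    rewrite inE => -[[Aw MY] Yf]; rewrite mem_set// mule1 mul1e.
    have Mx : M <= x (eps n) w.
      by rewrite -lee_fin fineK// ge0_fin_numE// Y_ge0// ltW.
    apply: (mean_Tb_ge HL scW Ps_ge0 Rt_cont Rt_gt0 b0).
      by rewrite (le_trans _ Mx)// le_max lexx.
    by rewrite (le_trans _ Mx)// le_max lexx orbT.
  apply: (@le_trans _ _ (\int[Q]_w ((\1_(A (eps n)) w)%:E * TY w))%E).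
    by rewrite late_mean// leeDr// mule_ge0// lee_fin ltW.
  apply: ge0_le_integral => //.
  - by move=> w _; rewrite mule_ge0 ?lee_fin ?Tb_ge0.
  - by apply: emeasurable_funM; [exact: mind|exact: entrance_Tb_measurable].
  - exact: entrance_Tb_measurable.
  - move=> w _; rewrite indicE; case: (w \in _); rewrite ?mul0e ?mul1e//; exact: Tb_ge0.
have cC : Q (C n) @[n --> \oo] --> 1%E.
  rewrite -(@probability_setT _ _ _ Q) -[X in _ --> X]mul1e -(integral_cst Q measurableT 1%E).
  have -> : (fun n => Q (C n)) = (fun n => \int[Q]_w (\1_(C n) w)%:E)%E.
    by apply/funext => n; rewrite integral_indic ?setIT.
  apply: (@cvg_integral_dominated _ _ _ Q setT _ _ (cst 1%E)) => //.
  - by move=> n; apply/measurable_EFinP; exact: measurable_indic.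
  - move=> w _; apply: cvg_near_cst; have [a a0 ha] := near0 w M.
    have := late_near w; apply: filterS2 (eps_lt a0) => n na Aw.
    by rewrite indicE mem_set//; split => //=; apply: ha => //; exact: ltW.
  - exact: finite_measure_integrable_cst.
  - by move=> n w _; rewrite gee0_abs ?lee_fin// indicE; case: (_ \in _).
have cm : (mN * Q (C n))%E @[n --> \oo] --> (mN * 1)%E by exact: cvgeZl.
rewrite -[leLHS]mule1; apply: (cvge_le _ cm).
by apply: nearW => n; exact: bound.
Qed.

Lemma entrance_mean : (\int[Q]_w TY w = m_of Rt W b)%E.
Proof.
apply/eqP; rewrite eq_le entrance_mean_le/=.
have cm := truncated_mean_cvg scW Ps_ge0 Rt_cont Rt_gt0 b0.
by apply: (cvge_le _ cm); apply: nearW => n; exact: truncated_le.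
Qed.

End Mean_from_infinity.

Theorem theorem3p1 (R : realType) (d : measure_display) (T : measurableType d)
  (P : probability T R) (L : R -> T -> R) (gam sig : R)
  (pi : {measure set R -> \bar R}) (Rt W : R -> R) :
  0 <= sig -> levy_measure_cond pi ->
  spec_pos_levy P L (Psi gam sig pi) ->
  {within `[0%R, +oo[, continuous Rt} -> (forall x, 0 < x -> 0 < Rt x) ->
  0 <= gam -> scale_function (Psi gam sig pi) W ->
  (inst_entrance P L Rt <->
     integrable_near_infty (fun x => (x * Psi gam sig pi x^-1 * Rt x)^-1)) /\
  (integrable_near_infty (fun x => (x * Psi gam sig pi x^-1 * Rt x)^-1) ->
   forall b, 0 < b ->
     (m_of Rt W b < +oo)%E /\
     forall (d' : measure_display) (T' : measurableType d') (Q : probability T' R)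
            (Y : R -> T' -> \bar R),
       Pinfty_version P L Rt Q Y ->
       (\int[Q]_w Tb (Y ^~ w) b = m_of Rt W b)%E).
Proof.
move=> _ pi_cond HL Rt_cont Rt_gt0 gam0 scW.
have Ps_ge0 q : 0 < q -> 0 <= Psi gam sig pi q by move=> q0; apply: Psi_ge0 => //; exact: ltW.
have Ps_homo q q' : 0 < q -> q <= q' -> Psi gam sig pi q <= Psi gam sig pi q'.
  by move=> q0; apply: Psi_homo => //; exact: ltW.
have Ps_double q : 0 < q -> Psi gam sig pi (2 * q) <= 6 * Psi gam sig pi q.
  by move=> q0; apply: Psi_double => //; exact: ltW.
have finite_mean : integrable_near_infty (fun x => (x * Psi gam sig pi x^-1 * Rt x)^-1) ->
    forall b, 0 < b -> (m_of Rt W b < +oo)%E.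
  by move=> ig b b0; exact: (integrable_near_infty_m_of scW Ps_ge0 Ps_homo Rt_cont Rt_gt0 b0 ig).
split; [split => [ent|ig]|move=> ig b b0; split; first exact: finite_mean].
- have [b b0 mb] := inst_entrance_mean_finite HL scW Ps_ge0 Rt_cont Rt_gt0 ent.
  exact: (m_of_integrable_near_infty scW Ps_ge0 Ps_homo Ps_double Rt_cont Rt_gt0 b0 mb).
- exact: (mean_finite_inst_entrance HL scW Ps_ge0 Rt_cont Rt_gt0 (finite_mean ig)).
- by move=> d' T' Q Y HY; exact: (entrance_mean HL scW Ps_ge0 Rt_cont Rt_gt0 HY b0).
Qed.
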